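(* For each large $N$ let $\mathcal{A}=\mathcal{A}_N\subset[1,N]$ be a set of positive integers with $$|\mathcal{A}|\ge N\exp\!\big(-\tfrac13\sqrt{\log N\,\log\log N}\big).$$ Suppose there exist subsets $\mathcal{S}=\mathcal{S}_N\subset\mathcal{A}$ with $|\mathcal{S}|=(1+o(1))|\mathcal{A}|$ and $$\#\{(s_1,s_2,s_3,s_4)\in\mathcal{S}^4:\ s_1s_2=s_3s_4\}=(2+o(1))|\mathcal{S}|^2,$$ where $o(1)$ denotes quantities tending to $0$ as $N\to\infty$. Then, as $N\to\infty$, the random variable $$\frac{1}{\sqrt{|\mathcal{A}|}}\sum_{n\in\mathcal{A}}f(n),$$ where $f$ is a Steinhaus random multiplicative function, converges in distribution to a standard complex normal random variable with mean $0$ and variance $1$.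
   Context: A Steinhaus random multiplicative function $f$ is a completely multiplicative function whose values $f(p)$ at primes $p$ are independent random variables, each uniformly distributed on the unit circle $\{z\in\mathbb{C}:|z|=1\}$. A standard complex normal random variable with mean $0$ and variance $1$ is $X+iY$, where $X,Y$ are independent real normal random variables with mean $0$ and variance $\tfrac12$. *)

(* Defs.v *)
From HB Require Import structures.
From mathcomp Require Import all_boot all_order all_algebra.
From mathcomp Require Import finmap.
From mathcomp Require Import all_classical all_reals all_analysis.
From mathcomp.real_closed Require Import complex.

Set Implicit Arguments.
Unset Strict Implicit.
Unset Printing Implicit Defensive.

Import Order.TTheory GRing.Theory Num.Theory.
Import numFieldNormedType.Exports.

Local Open Scope classical_set_scope.
Local Open Scope ring_scope.

(* R[i] carries no sigma-algebra in the library; measurability, laws and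
   continuous test functions of complex random variables go through this
   identification with R * R, whose product sigma-algebra is the Borel one. *)
Definition reim (R : realType) (z : R[i]) : R * R := (complex.Re z, complex.Im z).

Definition cplx_rv (R : realType) (d : measure_display) (T : measurableType d)
    (Z : T -> R[i]) : Prop :=
  measurable_fun [set: T] (@reim R \o Z).

Definition mutual_indep (R : realType) (d d' : measure_display)
    (T : measurableType d) (U : measurableType d') (P : probability T R)
    (I : choiceType) (D : set I) (X : I -> T -> U) : Prop :=
  forall (J : {fset I}) (B : I -> set U),
    [set` J] `<=` D -> (forall i, i \in J -> measurable (B i)) ->
    P (\bigcap_(i in [set` J]) X i @^-1` B i)
      = (\prod_(i <- J) P (X i @^-1` B i))%E.

Definition indep2 (R : realType) (d d1 d2 : measure_display)
    (T : measurableType d) (U : measurableType d1) (V : measurableType d2)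
    (P : probability T R) (X : T -> U) (Y : T -> V) : Prop :=
  forall (A : set U) (B : set V), measurable A -> measurable B ->
    P (X @^-1` A `&` Y @^-1` B) = (P (X @^-1` A) * P (Y @^-1` B))%E.

Definition circle (R : realType) (t : R) : R * R :=
  (cos (2 * pi * t), sin (2 * pi * t)).

Definition uniform_on_circle (R : realType) (d : measure_display)
    (T : measurableType d) (P : probability T R) (Z : T -> R[i]) : Prop :=
  cplx_rv Z /\
  forall B : set (R * R), measurable B ->
    pushforward P (@reim R \o Z) B
      = pushforward (uniform_prob (@ltr01 R)) (@circle R) B.

(* The value at 0 is irrelevant: multiplicativity is only over n >= 1. *)
Definition completely_multiplicative (R : realType) (g : nat -> R[i]) : Prop :=
  g 1%N = 1 /\
  forall m n : nat, (0 < m)%N -> (0 < n)%N -> g (m * n)%N = g m * g n.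

Definition steinhaus (R : realType) (d : measure_display)
    (T : measurableType d) (P : probability T R) (f : nat -> T -> R[i]) : Prop :=
  [/\ forall w, completely_multiplicative (fun n => f n w),
      forall p, prime p -> uniform_on_circle P (f p) &
      mutual_indep P [set p | prime p] (fun p => @reim R \o f p)].

Definition std_complex_normal (R : realType) (d : measure_display)
    (T : measurableType d) (P : probability T R) (Z : T -> R[i]) : Prop :=
  exists X Y : {RV P >-> R},
    [/\ forall B, measurable B ->
          distribution P X B = normal_prob 0 (Num.sqrt (2^-1)) B,
        forall B, measurable B ->
          distribution P Y B = normal_prob 0 (Num.sqrt (2^-1)) B,
        indep2 P X Y &
        forall w, Z w = (X w +i* Y w)%C].

Definition cvg_in_distribution (R : realType) (d d' : measure_display)
    (T : measurableType d) (P : probability T R) (Zn : nat -> T -> R[i])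
    (T' : measurableType d') (P' : probability T' R) (Z : T' -> R[i]) : Prop :=
  forall g : R * R -> R, continuous g -> (exists M, forall x, `|g x| <= M) ->
    ('E_P[ fun w => g (reim (Zn n w)) ] @[n --> \oo]
       --> 'E_P'[ fun w => g (reim (Z w)) ])%E.

(* u = (c + o(1)) v as n -> oo. *)
Definition asymp_const (R : realType) (c : R) (u v : nat -> R) : Prop :=
  exists2 e : nat -> R, e n @[n --> \oo] --> (0 : R) &
    \forall n \near \oo, u n = (c + e n) * v n.

Definition mult_energy (S : {fset nat}) : nat :=
  #|` [fset s in (S `*` S) `*` (S `*` S)
        | (s.1.1 * s.1.2 == s.2.1 * s.2.2)%N]%fset |.

(* Main.v *)
(* Grouping the elements of a set by their largest prime factor turns the normalized sum over
   it into a sum of martingale differences for the filtration generated by the values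
   [f q], [q <= p]. McLeish's argument bounds the distance between the characteristic function
   of such a sum and that of a Gaussian by the fourth moments of the differences and
   the variance of the sum of their squares. By orthogonality both are counts of
   quadruples: they are controlled by the nondiagonal solutions of
   [s1 s2 = s3 s4], negligible by the energy hypothesis, and by the pairs with the same
   largest prime factor. The latter are negligible because at most [N exp(-11 L / 30)]
   integers up to [N] share a given largest prime factor, where
   [L = sqrt (log N log log N)] (Rankin's trick for small primes, a trivial count for
   large ones), while [|A| >= N exp(-L / 3)]. The elements of [A] outside [S] contribute
   [o(1)] in mean square, and pointwise convergence of characteristic functions
   together with tightness gives convergence in distribution. *)
Require Import Defs.
From HB Require Import structures.
From mathcomp Require Import all_boot all_order all_algebra.
From mathcomp Require Import finmap.
From mathcomp Require Import all_classical all_reals all_analysis.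
From mathcomp.real_closed Require Import complex.
From mathcomp Require Import measurable_realfun ring lra zify.

Set Implicit Arguments.
Unset Strict Implicit.
Unset Printing Implicit Defensive.

Import Order.TTheory GRing.Theory Num.Theory.
Import numFieldNormedType.Exports.

Local Open Scope classical_set_scope.
Local Open Scope ring_scope.

(** The martingale argument runs without conditional expectations. One orthogonality relation
    replaces them: a power of [f p] against any bounded function measurable for the sigma-algebra of
    [pastT p]. The sum [V] of the squared differences has no deterministic bound, so it is cut to
    [H = min(V, v + 1)]. The compensated cosine [cos(S + phi) exp(H / 2)] is then bounded, and the
    cut costs at most the second moment of [V - v]. A real phase [phi] replaces complex
    exponentials, so every test function is a cosine. For the linear form [a Re + b Im], the sum of
    squares splits into a multiple of the sum of [|block|^2], which concentrates, and a linear form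
    in the sum of [block^2], which is small. The second fact is what makes the limit isotropic. In
    the counts, [2/5], [11/30] and [1/3] are [1/30] apart. The gap between [11/30] and [1/3] makes
    pairs with a common largest prime negligible; the gap between [2/5] and [11/30] absorbs the
    Euler product in Rankin's trick. A Steinhaus value lies on the circle only almost surely, so [f]
    is first set to [1] on a null event. *)

Section bounded_measurable.
Context (R : realType) (d : measure_display) (T : measurableType d).
Implicit Types X Y W : T -> R.

(** Random variables are kept bounded: integrability is then automatic, the class is closed under
    products and powers, and expectations can be taken in [R] instead of the extended reals. *)
Definition bmeas X := measurable_fun [set: T] X /\ exists M, forall w, `|X w| <= M.

Lemma bmeas_bound X : bmeas X -> exists2 M, 0 < M & forall w, `|X w| <= M.
Proof.
case=> _ [M hM]; exists (`|M| + 1); first by rewrite ltr_pwDr.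
by move=> w; rewrite (le_trans (hM w))// (le_trans (ler_norm _))// lerDl.
Qed.

Lemma bmeas_cst c : bmeas (fun=> c).
Proof. by split; [exact: measurable_cst|exists `|c|]. Qed.

Lemma bmeasD X Y : bmeas X -> bmeas Y -> bmeas (fun w => X w + Y w).
Proof.
move=> [mX [M hM]] [mY [M' hM']]; split; first exact: measurable_funD.
by exists (M + M') => w; rewrite (le_trans (ler_normD _ _))// lerD.
Qed.

Lemma bmeasM X Y : bmeas X -> bmeas Y -> bmeas (fun w => X w * Y w).
Proof.
move=> [mX [M hM]] [mY [M' hM']]; split; first exact: measurable_funM.
by exists (M * M') => w; rewrite normrM ler_pM.
Qed.

Lemma bmeasN X : bmeas X -> bmeas (fun w => - X w).
Proof.
move=> bX; rewrite (_ : (fun w => _) = fun w => -1 * X w).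
  exact: bmeasM (bmeas_cst _) bX.
by apply/funext => w; rewrite mulN1r.
Qed.

Lemma bmeasB X Y : bmeas X -> bmeas Y -> bmeas (fun w => X w - Y w).
Proof. by move=> bX bY; exact: bmeasD bX (bmeasN bY). Qed.

Lemma bmeasZ c X : bmeas X -> bmeas (fun w => c * X w).
Proof. exact: bmeasM (bmeas_cst _). Qed.

Lemma bmeasX n X : bmeas X -> bmeas (fun w => X w ^+ n).
Proof.
move=> bX; elim: n => [|n IH].
  by rewrite (_ : (fun w => _) = fun=> 1) //; exact: bmeas_cst.
rewrite (_ : (fun w => _) = fun w => X w * X w ^+ n); first exact: bmeasM.
by apply/funext => w; rewrite exprS.
Qed.

Lemma bmeas_norm X : bmeas X -> bmeas (fun w => `|X w|).
Proof.
move=> [mX [M hM]]; split; first exact: measurableT_comp.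
by exists M => w; rewrite normr_id.
Qed.

Lemma bmeas_sum I (r : seq I) (P : pred I) (X : I -> T -> R) :
  (forall i, P i -> bmeas (X i)) -> bmeas (fun w => \sum_(i <- r | P i) X i w).
Proof.
move=> bX; elim: r => [|i r IH].
  rewrite (_ : (fun w => _) = fun=> 0); first exact: bmeas_cst.
  by apply/funext => w; rewrite big_nil.
rewrite (_ : (fun w => _) =
    fun w => (if P i then X i w else 0) + \sum_(i <- r | P i) X i w).
  by case Pi: (P i); [exact: bmeasD (bX _ Pi) IH|exact: bmeasD (bmeas_cst _) IH].
by apply/funext => w; rewrite big_cons; case: ifP; rewrite ?add0r.
Qed.

Lemma bmeas_min X Y : bmeas X -> bmeas Y -> bmeas (fun w => Num.min (X w) (Y w)).
Proof.
move=> [mX [M hM]] [mY [M' hM']]; split; first exact: measurable_minr.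
exists (Num.max M M') => w; rewrite le_max.
by have [_|_] := leP (X w) (Y w); rewrite ?hM ?hM' ?orbT.
Qed.

Lemma bmeas_indic (A : set T) : measurable A -> bmeas (\1_A : T -> R).
Proof.
move=> mA; split; first exact: measurable_indic.
by exists 1 => w; rewrite indicE; case: (_ \in _); rewrite ?normr1 ?normr0.
Qed.

Lemma measurable_comp_continuous (h : R -> R) X :
  continuous h -> measurable_fun [set: T] X ->
  measurable_fun [set: T] (fun w => h (X w)).
Proof. by move=> ch mX; apply: measurableT_comp => //; exact: continuous_measurable_fun. Qed.

Lemma bmeas_cos X : measurable_fun [set: T] X -> bmeas (fun w => cos (X w)).
Proof.
move=> mX; split; first exact: measurable_comp_continuous (@continuous_cos R) mX.
by exists 1 => w; exact: cos_max.
Qed.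

Lemma bmeas_sin X : measurable_fun [set: T] X -> bmeas (fun w => sin (X w)).
Proof.
move=> mX; split; first exact: measurable_comp_continuous (@continuous_sin R) mX.
by exists 1 => w; exact: sin_max.
Qed.

Lemma bmeas_expR X : bmeas X -> bmeas (fun w => expR (X w)).
Proof.
move=> [mX [M hM]]; split; first exact: measurable_comp_continuous (@continuous_expR R) mX.
by exists (expR M) => w; rewrite ger0_norm ?expR_ge0// ler_expR (le_trans (ler_norm _)).
Qed.

End bounded_measurable.

(** * Expectations of bounded random variables *)

Section Ex.
Context (R : realType) (d : measure_display) (T : measurableType d).
Variable P : probability T R.
Implicit Types X Y W : T -> R.

Definition Ex X : R := \int[P]_w X w.

Lemma bmeas_integrable X : bmeas X -> P.-integrable [set: T] (EFin \o X).
Proof.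
move=> [mX [M hM]]; apply: measurable_bounded_integrable => //.
  by have /= -> := @probability_setT _ _ _ P; rewrite ltry.
by exists M; split; [exact: num_real|move=> x Mx y _ /=; exact: le_trans (hM y) (ltW Mx)].
Qed.

Lemma expectationE X : bmeas X -> ('E_P[X] = (Ex X)%:E)%E.
Proof.
move=> bX; rewrite unlock /Ex /Rintegral fineK//.
exact: integrable_fin_num (bmeas_integrable bX).
Qed.

Lemma Ex_cst c : Ex (fun=> c) = c.
Proof.
rewrite /Ex Rintegral_cst//; have /= -> := @probability_setT _ _ _ P.
by rewrite mulr1.
Qed.

Lemma eq_Ex X Y : (forall w, X w = Y w) -> Ex X = Ex Y.
Proof. by move=> h; congr Ex; exact/funext. Qed.

Lemma ExD X Y : bmeas X -> bmeas Y -> Ex (fun w => X w + Y w) = Ex X + Ex Y.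
Proof. by move=> bX bY; rewrite /Ex RintegralD//; exact: bmeas_integrable. Qed.

Lemma ExB X Y : bmeas X -> bmeas Y -> Ex (fun w => X w - Y w) = Ex X - Ex Y.
Proof. by move=> bX bY; rewrite /Ex RintegralB//; exact: bmeas_integrable. Qed.

Lemma ExZ c X : bmeas X -> Ex (fun w => c * X w) = c * Ex X.
Proof. by move=> bX; rewrite /Ex RintegralZl//; exact: bmeas_integrable. Qed.

Lemma Ex_sum I (r : seq I) (Q : pred I) (X : I -> T -> R) :
  (forall i, Q i -> bmeas (X i)) ->
  Ex (fun w => \sum_(i <- r | Q i) X i w) = \sum_(i <- r | Q i) Ex (X i).
Proof.
move=> bX; elim: r => [|i r IH].
  by rewrite big_nil -[RHS](Ex_cst 0); apply: eq_Ex => w; rewrite big_nil.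
rewrite big_cons -IH; case: ifP => Qi.
  rewrite -ExD; [|exact: bX|exact: bmeas_sum].
  by apply: eq_Ex => w; rewrite big_cons Qi.
by apply: eq_Ex => w; rewrite big_cons Qi.
Qed.

Lemma le_Ex X Y : bmeas X -> bmeas Y -> (forall w, X w <= Y w) -> Ex X <= Ex Y.
Proof.
by move=> bX bY h; apply: le_Rintegral => //; exact: bmeas_integrable.
Qed.

Lemma Ex_ge0 X : (forall w, 0 <= X w) -> 0 <= Ex X.
Proof. by move=> h; exact: Rintegral_ge0. Qed.

Lemma le_norm_Ex X : bmeas X -> `|Ex X| <= Ex (fun w => `|X w|).
Proof. by move=> bX; apply: le_normr_Rintegral => //; exact: bmeas_integrable. Qed.

Lemma norm_Ex_le X Y : bmeas X -> bmeas Y -> (forall w, `|X w| <= Y w) ->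
  `|Ex X| <= Ex Y.
Proof.
move=> bX bY h; apply: le_trans (le_norm_Ex bX) _.
by apply: le_Ex => //; exact: bmeas_norm.
Qed.

Lemma Ex_indic (A : set T) : measurable A -> (Ex \1_A)%:E = P A.
Proof.
by move=> mA; rewrite -expectationE ?expectation_indic//; exact: bmeas_indic.
Qed.

(* Uniform approximation of [h] by the step function [e * floor (h / e)]. *)
Lemma Ex_mul_eq0 W (h : T -> R) :
  bmeas W -> bmeas h ->
  (forall B : set R, measurable B -> Ex (fun w => W w * \1_(h @^-1` B) w) = 0) ->
  Ex (fun w => W w * h w) = 0.
Proof.
move=> bW bh hB; have [M M0 hM] := bmeas_bound bh; have [N N0 hN] := bmeas_bound bW.
apply/eqP; rewrite -normr_le0; apply/ler_addgt0Pl => e e0; rewrite addr0.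
pose s := e / N; have s0 : 0 < s by rewrite divr_gt0.
pose K := (Num.bound (2 * M / s)).+1.
have hK : 2 * M < K%:R * s.
  have h0 : 0 <= 2 * M / s by apply: divr_ge0; lra.
  rewrite -ltr_pdivrMr//; apply: lt_le_trans (archi_boundP h0) _.
  by rewrite ler_nat.
pose I (k : nat) : set R := [set` `[k%:R * s - M, k.+1%:R * s - M[].
have mh : measurable_fun [set: T] h by case: bh.
have mI k : measurable (h @^-1` I k).
  by rewrite -[X in measurable X]setTI; apply: mh => //; exact: measurable_itv.
have bI k : bmeas (\1_(h @^-1` I k) : T -> R) by exact: bmeas_indic.
pose g w := \sum_(k < K) (k%:R * s - M) * \1_(h @^-1` I k) w.
have bg : bmeas g by apply: bmeas_sum => k _; exact: bmeasZ.
have gh w : `|h w - g w| <= s.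
  pose y := (h w + M) / s.
  have y0 : 0 <= y.
    by rewrite divr_ge0 ?(ltW s0)//; have := hM w; rewrite ler_norml; lra.
  have /andP[k1 k2] : ((Num.truncn y)%:R <= y < (Num.truncn y).+1%:R) by exact: truncn_itv.
  set k := Num.truncn y in k1 k2.
  have k1' : k%:R * s - M <= h w by move: k1; rewrite /y ler_pdivlMr//; lra.
  have k2' : h w < k.+1%:R * s - M by move: k2; rewrite /y ltr_pdivrMr//; lra.
  have kK : (k < K)%N.
    rewrite -(ltr_nat R) (le_lt_trans k1)// /y ltr_pdivrMr//.
    by apply: le_lt_trans hK; have := hM w; rewrite ler_norml; lra.
  have -> : g w = k%:R * s - M.
    rewrite /g (bigD1 (Ordinal kK))//= indicE mem_set/=; last first.
      by rewrite /I/= in_itv/= k1' k2'.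
    rewrite mulr1 big1 ?addr0// => j jk; rewrite indicE memNset ?mulr0//.
    rewrite /I/= in_itv/= => /andP[j1 j2].
    have /negP := jk; apply; apply/eqP/val_inj => /=; apply/eqP.
    have lt1 : (j%:R : R) < k.+1%:R by rewrite -(ltr_pM2r s0); lra.
    have lt2 : (k%:R : R) < j.+1%:R by rewrite -(ltr_pM2r s0); lra.
    by move: lt1 lt2; rewrite !ltr_nat !ltnS eqn_leq => -> ->.
  rewrite ler_norml; apply/andP; split; first by lra.
  by move: k2'; rewrite -natr1 mulrDl mul1r; lra.
have -> : Ex (fun w => W w * h w) =
    Ex (fun w => W w * (h w - g w)) + Ex (fun w => W w * g w).
  rewrite -ExD; first by apply: eq_Ex => w; ring.
  - by apply: bmeasM => //; exact: bmeasB.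
  - exact: bmeasM.
have -> : Ex (fun w => W w * g w) = 0.
  rewrite (eq_Ex (Y := fun w =>
    \sum_(k < K) (k%:R * s - M) * (W w * \1_(h @^-1` I k) w))); last first.
    by move=> w; rewrite mulr_sumr; apply: eq_bigr => k _; ring.
  rewrite Ex_sum; last by move=> k _; exact/bmeasZ/bmeasM.
  rewrite big1// => k _; rewrite ExZ ?hB ?mulr0//; first exact: measurable_itv.
  exact: bmeasM.
rewrite addr0 (le_trans (norm_Ex_le (Y := fun=> e) _ _ _))// ?Ex_cst//.
- by apply: bmeasM => //; exact: bmeasB.
- exact: bmeas_cst.
- move=> w; rewrite normrM (_ : e = N * s) ?ler_pM//.
  by rewrite /s mulrC divfK// gt_eqF.
Qed.

(** This stands in for the Cauchy-Schwarz inequality. Splitting at [|x| = t] gives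
    [|x| <= t + x^2 / t] pointwise, so a second moment of order [t^2] yields a first absolute moment
    of order [t]. *)
Lemma Ex_sqr_norm X (t : R) : bmeas X -> 0 < t ->
  Ex (fun w => `|X w|) <= t + Ex (fun w => X w ^+ 2) / t.
Proof.
move=> bX t0.
rewrite -[X in X + _]Ex_cst mulrC -ExZ; last exact: bmeasX.
rewrite -ExD; [|exact: bmeas_cst|exact/bmeasZ/bmeasX].
apply: le_Ex; first exact: bmeas_norm.
  by apply: bmeasD; [exact: bmeas_cst|exact/bmeasZ/bmeasX].
move=> w; rewrite -real_normK ?num_real//; set x := `|_|.
have x0 : 0 <= x by rewrite normr_ge0.
have [xt|tx] := leP x t.
  by rewrite (le_trans xt)// lerDl mulr_ge0 ?sqr_ge0// invr_ge0 ltW.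
rewrite (@le_trans _ _ (t^-1 * x ^+ 2))//; last by rewrite lerDr ltW.
by rewrite mulrC ler_pdivlMr// expr2 ler_wpM2l// ltW.
Qed.

End Ex.

(** * Bernstein averages and the binomial variance *)

Section bernstein.
Context (R : realType).
Implicit Types (u v : R) (p q : nat -> R).

(* The [n]-th Bernstein average: the mean of [p] under the binomial law of
   parameters [n] and [u], defined by conditioning on the first trial. *)
Fixpoint bern u n p : R :=
  if n is m.+1 then u * bern u m (fun j => p j.+1) + (1 - u) * bern u m p
  else p 0%N.

Lemma eq_bern u n p q : (forall j, p j = q j) -> bern u n p = bern u n q.
Proof. by move=> h; congr bern; exact/funext. Qed.

Lemma bernD u n p q : bern u n (fun j => p j + q j) = bern u n p + bern u n q.
Proof. by elim: n p q => [//|n IH] p q /=; rewrite !IH; ring. Qed.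

Lemma bernZ u n c p : bern u n (fun j => c * p j) = c * bern u n p.
Proof. by elim: n p => [//|n IH] p /=; rewrite !IH; ring. Qed.

Lemma bern_cst u n c : bern u n (fun=> c) = c.
Proof. by elim: n => [//|n IH] /=; rewrite !IH; ring. Qed.

Lemma le_bern u n p q : 0 <= u <= 1 -> (forall j, (j <= n)%N -> p j <= q j) ->
  bern u n p <= bern u n q.
Proof.
move=> /andP[u0 u1]; elim: n p q => [|n IH] p q h /=; first exact: h.
apply: lerD; apply: ler_wpM2l => //; first by apply: IH => j jn; exact: h.
  by rewrite subr_ge0.
by apply: IH => j jn; apply: h; exact: leqW.
Qed.

Lemma norm_bern_le_bern u n p q : 0 <= u <= 1 ->
  (forall j, (j <= n)%N -> `|p j| <= q j) -> `|bern u n p| <= bern u n q.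
Proof.
move=> u01 h; rewrite ler_norml; apply/andP; split.
  have -> : - bern u n q = bern u n (fun j => -1 * q j) by rewrite bernZ mulN1r.
  by apply: le_bern => // j /h; rewrite ler_norml mulN1r => /andP[].
by apply: le_bern => // j /h; rewrite ler_norml => /andP[].
Qed.

Lemma norm_bern_le u n p M : 0 <= u <= 1 ->
  (forall j, (j <= n)%N -> `|p j| <= M) -> `|bern u n p| <= M.
Proof.
by move=> u01 h; rewrite -[leRHS](bern_cst u n); exact: norm_bern_le_bern.
Qed.

(** The binomial law has mean [n u] and variance [n u (1 - u)]. The shift [a] makes the induction
    close: a success in the first trial replaces [a] by [1 + a]. *)
Lemma bern_sqr u n a :
  bern u n (fun j => (j%:R + a) ^+ 2) = (n%:R * u + a) ^+ 2 + n%:R * (u * (1 - u)).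
Proof.
elim: n a => [|n IH] a /=; first by rewrite !mul0r addr0 !add0r.
rewrite IH (@eq_bern u n _ (fun j => (j%:R + (1 + a)) ^+ 2)); last first.
  by move=> j; rewrite -natr1 addrA.
by rewrite IH -natr1; ring.
Qed.

Lemma bern_var_le u n : 0 <= u <= 1 ->
  bern u n.+1 (fun j => (j%:R / n.+1%:R - u) ^+ 2) <= n.+1%:R^-1.
Proof.
move=> /andP[u0 u1]; set m := n.+1%:R : R.
have m0 : 0 < m by rewrite ltr0n.
have mn : m != 0 by rewrite gt_eqF.
rewrite (@eq_bern u n.+1 _ (fun j => m ^- 2 * (j%:R + - (m * u)) ^+ 2)); last first.
  by move=> j; field.
rewrite bernZ bern_sqr -/m subrr expr0n add0r /=.
have -> : m ^- 2 * (m * (u * (1 - u))) = (u * (1 - u)) * m^-1 by field.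
by rewrite ler_piMl ?invr_ge0 ?(ltW m0)//; nra.
Qed.

End bernstein.

(** * Trigonometric polynomials and approximation on a box *)

Section trig.
Context (R : realType).

(** Real trigonometric polynomials with arbitrary frequencies. Allowing a phase puts constants and
    sines in the class and makes it closed under products, by the product-to-sum formula. *)
Inductive trig : (R -> R -> R) -> Prop :=
| trig_cos c a b phi : trig (fun x y => c * cos (a * x + b * y + phi))
| trigD F G : trig F -> trig G -> trig (fun x y => F x y + G x y).

Lemma trig_cst c : trig (fun _ _ => c).
Proof.
rewrite (_ : (fun _ _ => c) = fun x y => c * cos (0 * x + 0 * y + 0)).
  exact: trig_cos.
by apply/funext => x; apply/funext => y; rewrite !mul0r !addr0 cos0 mulr1.
Qed.

Lemma trigM F G : trig F -> trig G -> trig (fun x y => F x y * G x y).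
Proof.
move=> tF tG; elim: tF => {F} [c a b f|F1 F2 _ h1 _ h2].
  elim: tG => {G} [c' a' b' f'|G1 G2 _ h1 _ h2].
    rewrite (_ : (fun _ _ => _) = fun x y =>
      (c * c' / 2) * cos ((a + a') * x + (b + b') * y + (f + f')) +
      (c * c' / 2) * cos ((a - a') * x + (b - b') * y + (f - f'))).
      by apply: trigD; exact: trig_cos.
    apply/funext => x; apply/funext => y.
    set A := a * x + b * y + f; set B := a' * x + b' * y + f'.
    have -> : (a + a') * x + (b + b') * y + (f + f') = A + B by rewrite /A /B; ring.
    have -> : (a - a') * x + (b - b') * y + (f - f') = A - B by rewrite /A /B; ring.
    by rewrite (cosD A B) (cosB A B); field.
  rewrite (_ : (fun _ _ => _) = fun x y =>
    c * cos (a * x + b * y + f) * G1 x y + c * cos (a * x + b * y + f) * G2 x y).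
    exact: trigD.
  by apply/funext => x; apply/funext => y; rewrite mulrDr.
rewrite (_ : (fun _ _ => _) = fun x y => F1 x y * G x y + F2 x y * G x y).
  exact: trigD.
by apply/funext => x; apply/funext => y; rewrite mulrDl.
Qed.

(** A Bernstein average is a polynomial in its parameter, so substituting a trigonometric polynomial
    for the parameter stays in the class. *)
Lemma trig_bern (U : R -> R -> R) n (p : nat -> R -> R -> R) :
  trig U -> (forall j, trig (p j)) ->
  trig (fun x y => bern (U x y) n (fun j => p j x y)).
Proof.
move=> tU; elim: n p => [|n IH] p tp /=; first exact: tp.
apply: trigD; apply: trigM => //.
- by apply: (IH (fun j => p j.+1)).
- rewrite (_ : (fun _ _ => _) = fun x y => 1 + (-1) * U x y).
    by apply: trigD; [exact: trig_cst|apply: trigM => //; exact: trig_cst].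
  by apply/funext => x; apply/funext => y; rewrite mulN1r.
- exact: IH.
Qed.

(** For [|x| <= K] the value [sin (x / K)] lies in [[- sin 1, sin 1]]. Since [1 < pi / 2], this
    interval is strictly inside []-1, 1[], where [asin] is continuous. *)
Let c1 : R := sin 1.

Let pihalf_gt1 : 1 < pi / 2 :> R.
Proof.
rewrite lt_neqAle pihalf_ge1 andbT; apply/eqP => h.
by have := @cos1_gt0 R; rewrite h cos_pihalf ltxx.
Qed.

Let c1_gt0 : 0 < c1.
Proof. by apply: sin_gt0_pihalf; rewrite ltr01 pihalf_gt1. Qed.

Let c1_lt1 : c1 < 1.
Proof.
have h := pihalf_gt1.
have : c1 < sin (pi / 2) by rewrite /c1 ltr_sin ?in_itv//=; lra.
by rewrite sin_pihalf.
Qed.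

(* A continuous left inverse of [x |-> (1 + sin (x / K)) / 2] on [[-K, K]]. *)
Let clamp (s : R) : R := Num.max (- c1) (Num.min c1 s).
Let tau (K s : R) : R := K * asin (clamp (2 * s - 1)).

Let clamp_bnd s : - c1 <= clamp s <= c1.
Proof.
have := c1_gt0; rewrite /clamp le_max lexx/= ge_max ge_min lexx/= andbT => h.
by lra.
Qed.

Let continuous_clamp : continuous clamp.
Proof.
move=> x; have -> : clamp = (cst (- c1)) \max ((cst c1) \min id) by [].
apply: (@continuous_max R R (cst (- c1))); first exact: cvg_cst.
by apply: (@continuous_min R R (cst c1)); [exact: cvg_cst|exact: cvg_id].
Qed.

Let continuous_tau K : continuous (tau K).
Proof.
move=> s; apply: cvgM; first exact: cvg_cst.
have h : {for s, continuous (fun s : R => clamp (2 * s - 1))}.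
  apply: (@continuous_comp _ _ _ (fun s : R => 2 * s - 1) clamp); last exact: continuous_clamp.
  by apply: cvgB; [apply: cvgM; [exact: cvg_cst|exact: cvg_id]|exact: cvg_cst].
apply: (continuous_comp h); apply: continuous_asin.
by have /andP[h1 h2] := clamp_bnd (2 * s - 1); have := c1_lt1; lra.
Qed.

Let tauK (K x : R) : 0 < K -> `|x| <= K -> tau K ((1 + sin (x / K)) / 2) = x.
Proof.
move=> K0 xK; have xK1 : - 1 <= x / K <= 1.
  by rewrite ler_pdivlMr// ler_pdivrMr// mulN1r mul1r -ler_norml.
have xpi : x / K \in `[(- (pi / 2)), pi / 2]%R.
  by rewrite in_itv/=; have := pihalf_gt1; lra.
have i1 : (1 : R) \in `[(- (pi / 2)), pi / 2]%R.
  by rewrite in_itv/=; have := pihalf_gt1; lra.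
have iN1 : (- 1 : R) \in `[(- (pi / 2)), pi / 2]%R.
  by rewrite in_itv/=; have := pihalf_gt1; lra.
rewrite /tau (_ : 2 * _ - 1 = sin (x / K)); last by field.
have h1 : sin (x / K) <= c1 by rewrite /c1 leNgt ltr_sin// -leNgt; lra.
have h2 : - c1 <= sin (x / K) by rewrite /c1 -sinN leNgt ltr_sin// -leNgt; lra.
rewrite /clamp (min_idPr h1) (max_idPr h2) sinK//.
by rewrite mulrC divfK// gt_eqF.
Qed.

(** The estimate behind Bernstein's proof: nearby points are handled by uniform continuity, and for
    distant points [2 M] is dominated by a multiple of the squared distance. Squared distances are
    exactly what a binomial variance controls. *)
Lemma continuous_square_modulus (H : R * R -> R) (M e : R) :
  continuous H -> (forall z, `|H z| <= M) -> 0 < e ->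
  exists2 C : R, 0 <= C & forall s t u v : R, 0 <= s <= 1 -> 0 <= t <= 1 ->
    0 <= u <= 1 -> 0 <= v <= 1 ->
    `|H (s, t) - H (u, v)| <= e + C * ((s - u) ^+ 2 + (t - v) ^+ 2).
Proof.
move=> cH bH e0.
have cp : compact (`[0, 1]%classic `*` `[0, 1]%classic : set (R * R)).
  by apply: compact_setX; exact: segment_compact.
(* Uniform continuity is drawn from compactness of the square in its near-covering form, the radius
   tending to [0] from the right. *)
have := (compact_near_coveringP _).1 cp R (0^'+)
  (fun dl z => forall z', ball z dl z' -> `|H z - H z'| <= e).
move=> /(_ _) [].
  move=> z _.
  have /cvgrPdist_lt/(_ (e / 2)) := cH z.
  rewrite divr_gt0// => /(_ isT) /nbhs_ballP[r /= r0 hr].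
  exists (ball z (r / 2), [set dl : R | dl < r / 2]) => /=.
    split; first by apply: nbhsx_ballx; rewrite divr_gt0.
    exact: nbhs_right_lt (divr_gt0 _ _).
  move=> [z1 dl] /= [hz1 hdl] z2 hz2.
  have b1 : `|H z - H z1| < e / 2.
    by apply: hr; apply: le_ball hz1; rewrite ler_pdivrMr// ler_pMr// ler1n.
  have b2 : `|H z - H z2| < e / 2.
    apply: hr; rewrite [r]splitr; apply: ball_triangle hz1 _.
    by apply: le_ball hz2; exact: ltW.
  rewrite (_ : H z1 - H z2 = (H z - H z2) - (H z - H z1)); last by ring.
  by apply: le_trans (ler_normB _ _) _; rewrite [leRHS]splitr ltW// addrC ltrD.
move=> d0 /= d0pos hd.
have dl0 : 0 < d0 / 2 by rewrite divr_gt0.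
have {}hd : forall z : R * R, (`[0, 1]%classic `*` `[0, 1]%classic) z ->
    forall z' : R * R, ball z (d0 / 2) z' -> `|H z - H z'| <= e.
  by apply: hd => //=; rewrite sub0r normrN gtr0_norm// ltr_pdivrMr// ltr_pMr// ltr1n.
set dl := d0 / 2 in dl0 hd.
have M0 : 0 <= M by exact: le_trans (normr_ge0 _) (bH 0).
have C0 : 0 <= 2 * M / dl ^+ 2 by apply: divr_ge0; [exact: mulr_ge0|exact: sqr_ge0].
exists (2 * M / dl ^+ 2) => //.
move=> s t u v s01 t01 u01 v01.
have [h|h] := boolP ((`|s - u| < dl) && (`|t - v| < dl)).
  case/andP: h => h1 h2; apply: (@le_trans _ _ e).
    by apply: hd => //=; rewrite ?in_itv.
  by rewrite lerDl; apply: mulr_ge0 => //; apply: addr_ge0; exact: sqr_ge0.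
apply: (@le_trans _ _ (2 * M)).
  apply: le_trans (ler_normB _ _) _.
  by rewrite mulr_natl mulr2n lerD.
apply: (@le_trans _ _ (2 * M / dl ^+ 2 * ((s - u) ^+ 2 + (t - v) ^+ 2))); last by rewrite lerDr ltW.
rewrite mulrAC -mulrA ler_peMr ?mulr_ge0//.
rewrite ler_pdivlMr ?exprn_gt0// mul1r.
have sq (a : R) : dl <= `|a| -> dl ^+ 2 <= a ^+ 2.
  by move=> ha; rewrite -[leRHS]real_normK ?num_real// ler_pXn2r ?nnegrE// ltW.
move: h; rewrite negb_and -!leNgt => /orP[/sq h|/sq h].
  by apply: le_trans h _; rewrite lerDl sqr_ge0.
by apply: le_trans h _; rewrite lerDr sqr_ge0.
Qed.

Lemma continuous_fst : continuous (fst : R * R -> R).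
Proof.
move=> [a b] U /= hU; exists (U, setT) => /=; first by split => //; exact: filterT.
by move=> [x y] /= [].
Qed.

Lemma continuous_snd : continuous (snd : R * R -> R).
Proof.
move=> [a b] U /= hU; exists (setT, U) => /=; first by split => //; exact: filterT.
by move=> [x y] /= [].
Qed.

(** [F] is the Bernstein polynomial of [H = g] composed with [tau] in both variables, evaluated at
    [U x = (1 + sin (x / K)) / 2]. On the box, [tau] inverts [U] and [H (U x, U y) = g (x, y)].
    Everywhere else [U] still takes values in [[0, 1]], so [F] inherits the global bound [M]; tail
    events therefore cost no more for [F] than for [g]. *)
Lemma trig_approx (g : R * R -> R) (M K e : R) :
  continuous g -> (forall z, `|g z| <= M) -> 0 < K -> 0 < e ->
  exists F, [/\ trig F, forall x y, `|F x y| <= M &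
    forall x y, `|x| <= K -> `|y| <= K -> `|F x y - g (x, y)| <= e].
Proof.
move=> cg bg K0 e0.
pose H z := g (tau K z.1, tau K z.2).
have cH : continuous H.
  move=> z; apply: (@continuous_comp _ _ _ (fun z : R * R => (tau K z.1, tau K z.2)) g); last exact: cg.
  have h1 : {for z, continuous (fun z : R * R => tau K z.1)}.
    by apply: (@continuous_comp _ _ _ fst (tau K)); [exact: continuous_fst|exact: continuous_tau].
  have h2 : {for z, continuous (fun z : R * R => tau K z.2)}.
    by apply: (@continuous_comp _ _ _ snd (tau K)); [exact: continuous_snd|exact: continuous_tau].
  exact: (cvg_pair h1 h2).
have bH z : `|H z| <= M by exact: bg.
have e20 : 0 < e / 2 by rewrite divr_gt0.
have [C C0 hC] := continuous_square_modulus cH bH e20.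
(* Each coordinate contributes a variance at most [1 / (n + 1)], hence [2 C / (n + 1)] in total, to
   be fitted into [e / 2]. *)
pose n := Num.bound (2 * C / (e / 2)).
have hn : 2 * C / n.+1%:R <= e / 2.
  have h0 : 0 <= 2 * C / (e / 2) by rewrite divr_ge0 ?mulr_ge0// ltW.
  have := ltW (archi_boundP h0); rewrite ler_pdivrMr// => h.
  rewrite ler_pdivrMr ?ltr0n// [leRHS]mulrC; apply: le_trans h _.
  by rewrite ler_pM2r// ler_nat.
pose U (x : R) : R := (1 + sin (x / K)) / 2.
have U01 x : 0 <= U x <= 1.
  by rewrite /U; have := sin_max (x / K); rewrite ler_norml; lra.
pose F x y := bern (U x) n.+1 (fun j => bern (U y) n.+1
   (fun k => H (j%:R / n.+1%:R, k%:R / n.+1%:R))).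
have tU1 : trig (fun x _ => U x).
  rewrite (_ : (fun _ _ => _) = fun x y => 2^-1 + 2^-1 * cos (K^-1 * x + 0 * y + - (pi / 2))).
    by apply: trigD; [exact: trig_cst|exact: trig_cos].
  apply/funext => x; apply/funext => y; rewrite mul0r addr0 cosBpihalf /U.
  by rewrite [K^-1 * x]mulrC; field.
have tU2 : trig (fun _ y => U y).
  rewrite (_ : (fun _ _ => _) = fun x y => 2^-1 + 2^-1 * cos (0 * x + K^-1 * y + - (pi / 2))).
    by apply: trigD; [exact: trig_cst|exact: trig_cos].
  apply/funext => x; apply/funext => y; rewrite mul0r add0r cosBpihalf /U.
  by rewrite [K^-1 * y]mulrC; field.
exists F; split.
- apply: (trig_bern n.+1 (p := fun j x y => bern (U y) n.+1
   (fun k => H (j%:R / n.+1%:R, k%:R / n.+1%:R))) tU1) => j.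
  by apply: (trig_bern n.+1 (p := fun k _ _ => H (j%:R / n.+1%:R, k%:R / n.+1%:R)) tU2) => k; exact: trig_cst.
- by move=> x y; apply: norm_bern_le => // j _; apply: norm_bern_le.
move=> x y xK yK.
have -> : g (x, y) = H (U x, U y) by rewrite /H /= !tauK.
(* The constant [H (U x, U y)] is its own Bernstein average, so the difference becomes an average of
   increments of [H]. *)
rewrite -[H (U x, U y)](bern_cst (U x) n.+1) -[X in _ - X]mul1r -mulNr -bernZ -bernD.
have in01 j : (j <= n.+1)%N -> 0 <= (j%:R / n.+1%:R : R) <= 1.
  by move=> jn; rewrite divr_ge0 ?ler0n//= ler_pdivrMr ?ltr0n// mul1r ler_nat.
have step1 j : (j <= n.+1)%N ->
  `|bern (U y) n.+1 (fun k => H (j%:R / n.+1%:R, k%:R / n.+1%:R)) + -1 * H (U x, U y)|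
   <= e / 2 + C / n.+1%:R + C * (j%:R / n.+1%:R - U x) ^+ 2.
  move=> jn; rewrite -[X in -1 * X](bern_cst (U y) n.+1) -bernZ -bernD.
  have : `|bern (U y) n.+1 (fun k => H (j%:R / n.+1%:R, k%:R / n.+1%:R) + -1 * H (U x, U y))|
    <= bern (U y) n.+1 (fun k => (e / 2 + C * (j%:R / n.+1%:R - U x) ^+ 2) + C * (k%:R / n.+1%:R - U y) ^+ 2).
    have h k : (k <= n.+1)%N -> `|H (j%:R / n.+1%:R, k%:R / n.+1%:R) + -1 * H (U x, U y)| <=
       (e / 2 + C * (j%:R / n.+1%:R - U x) ^+ 2) + C * (k%:R / n.+1%:R - U y) ^+ 2.
      move=> kn; rewrite mulN1r -addrA -mulrDr; apply: hC => //; exact: in01.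
    exact: norm_bern_le_bern.
  move=> /le_trans; apply; rewrite bernD bern_cst bernZ.
  rewrite [leRHS]addrAC lerD2l.
  exact: ler_wpM2l C0 _ _ (bern_var_le n (U01 y)).
have : `|bern (U x) n.+1 (fun j => bern (U y) n.+1 (fun k => H (j%:R / n.+1%:R, k%:R / n.+1%:R))
    + -1 * H (U x, U y))| <= bern (U x) n.+1 (fun j => (e / 2 + C / n.+1%:R) + C * (j%:R / n.+1%:R - U x) ^+ 2).
  exact: norm_bern_le_bern.
move=> /le_trans; apply; rewrite bernD bern_cst bernZ.
apply: (@le_trans _ _ (e / 2 + C / n.+1%:R + C * n.+1%:R^-1)).
  by rewrite lerD2l; exact: ler_wpM2l C0 _ _ (bern_var_le n (U01 x)).
by move: hn; rewrite -mulrA; move: (C / n.+1%:R) => c hc; lra.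
Qed.

End trig.

(** * Convergence in distribution from cosines and tightness *)

Section portmanteau.
Context (R : realType).

Lemma trig_bmeas (d : measure_display) (T : measurableType d) (F : R -> R -> R) (X Y : T -> R) :
  trig F -> measurable_fun [set: T] X -> measurable_fun [set: T] Y ->
  bmeas (fun w => F (X w) (Y w)).
Proof.
move=> tF mX mY; elim: tF => {F} [c a b f|F1 F2 _ h1 _ h2]; last exact: bmeasD.
apply: bmeasZ; apply: bmeas_cos; apply: measurable_funD; last exact: measurable_cst.
by apply: measurable_funD; apply: measurable_funM => //; exact: measurable_cst.
Qed.

(** Measurability comes from a pointwise limit: the trigonometric polynomials that approximate [g]
    within [1 / (n + 1)] on the box of half-width [n + 1] are measurable functions of [X] and
    [Y]. *)
Lemma continuous2_bmeas (d : measure_display) (T : measurableType d) (g : R * R -> R) (X Y : T -> R) :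
  continuous g -> (exists M, forall z, `|g z| <= M) ->
  measurable_fun [set: T] X -> measurable_fun [set: T] Y ->
  bmeas (fun w => g (X w, Y w)).
Proof.
move=> cg [M bg] mX mY; split; last by exists M.
have /choice[F hF] : forall n : nat, exists F, [/\ trig F, forall x y, `|F x y| <= M &
    forall x y, `|x| <= n.+1%:R -> `|y| <= n.+1%:R -> `|F x y - g (x, y)| <= n.+1%:R^-1].
  by move=> n; apply: trig_approx => //; rewrite ?invr_gt0 ltr0n.
apply: (@measurable_fun_cvg _ _ _ [set: T] (fun n w => F n (X w) (Y w))).
  by move=> n; have [tF _ _] := hF n; have [] := trig_bmeas tF mX mY.
move=> w _; apply/cvgrPdist_le => e e0.
pose N := (Num.bound (Num.max `|X w| (Num.max `|Y w| e^-1))).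
have hN : Num.max `|X w| (Num.max `|Y w| e^-1) < N%:R.
  by apply: archi_boundP; rewrite le_max normr_ge0.
near=> n; have nN : (N <= n)%N by near: n; exact: nbhs_infty_ge.
have {}hN : Num.max `|X w| (Num.max `|Y w| e^-1) <= n.+1%:R.
  by apply: le_trans (ltW hN) _; rewrite ler_nat leqW.
move: hN; rewrite !ge_max => /and3P[h1 h2 h3].
have [_ _ h] := hF n; rewrite distrC; apply: le_trans (h _ _ h1 h2) _.
by rewrite -[leRHS]invrK lef_pV2 ?posrE ?invr_gt0// ltr0n.
Unshelve. all: by end_near.
Qed.

Context (d d' : measure_display) (T : measurableType d) (T' : measurableType d').
Variables (P : probability T R) (P' : probability T' R).
Variables (Xn Yn : nat -> T -> R) (X Y : T' -> R).
Hypotheses (mXn : forall n, measurable_fun [set: T] (Xn n))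
  (mYn : forall n, measurable_fun [set: T] (Yn n))
  (mX : measurable_fun [set: T'] X) (mY : measurable_fun [set: T'] Y).
(** With all phases allowed, this is pointwise convergence of the joint characteristic functions. *)
Hypothesis hcos : forall a b f,
  Ex P (fun w => cos (a * Xn n w + b * Yn n w + f)) @[n --> \oo] -->
  Ex P' (fun w => cos (a * X w + b * Y w + f)).
Hypothesis tight : forall e : R, 0 < e -> exists2 K : R, 0 < K &
  (\forall n \near \oo, Ex P \1_[set w | K < `|Xn n w|] <= e /\
     Ex P \1_[set w | K < `|Yn n w|] <= e) /\
  (Ex P' \1_[set w | K < `|X w|] <= e /\ Ex P' \1_[set w | K < `|Y w|] <= e).

Lemma trig_cvg F : trig F ->
  Ex P (fun w => F (Xn n w) (Yn n w)) @[n --> \oo] --> Ex P' (fun w => F (X w) (Y w)).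
Proof.
elim=> {F} [c a b f|F1 F2 t1 h1 t2 h2].
  have bc n : bmeas (fun w => cos (a * Xn n w + b * Yn n w + f)).
    apply: bmeas_cos; apply: measurable_funD; last exact: measurable_cst.
    by apply: measurable_funD; apply: measurable_funM => //; exact: measurable_cst.
  have bc' : bmeas (fun w => cos (a * X w + b * Y w + f)).
    apply: bmeas_cos; apply: measurable_funD; last exact: measurable_cst.
    by apply: measurable_funD; apply: measurable_funM => //; exact: measurable_cst.
  rewrite ExZ//; under eq_fun do rewrite ExZ//.
  by apply: cvgM; [exact: cvg_cst|exact: hcos].
rewrite ExD; [|exact: trig_bmeas..].
have E n : Ex P (fun w => F1 (Xn n w) (Yn n w) + F2 (Xn n w) (Yn n w)) =
    Ex P (fun w => F1 (Xn n w) (Yn n w)) + Ex P (fun w => F2 (Xn n w) (Yn n w)).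
  by rewrite ExD//; exact: trig_bmeas.
by under eq_fun do rewrite E; exact: cvgD.
Qed.

(** Inside the box the integrands differ by at most [e1]. Outside, both are bounded by [M], so each
    of the two tail events costs at most [2 M e2]. *)
Lemma Ex_trig_dist (d1 : measure_display) (T1 : measurableType d1)
    (P1 : probability T1 R) (X1 Y1 : T1 -> R) (F : R -> R -> R) (g : R * R -> R) (M K e1 e2 : R) :
  measurable_fun [set: T1] X1 -> measurable_fun [set: T1] Y1 -> trig F ->
  continuous g -> (forall z, `|g z| <= M) -> (forall x y, `|F x y| <= M) ->
  (forall x y, `|x| <= K -> `|y| <= K -> `|F x y - g (x, y)| <= e1) ->
  0 <= e1 -> Ex P1 \1_[set w | K < `|X1 w|] <= e2 -> Ex P1 \1_[set w | K < `|Y1 w|] <= e2 ->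
  `|Ex P1 (fun w => F (X1 w) (Y1 w)) - Ex P1 (fun w => g (X1 w, Y1 w))| <= e1 + 4 * M * e2.
Proof.
move=> mX1 mY1 tF cg bg bF Fg e10 hX hY.
have M0 : 0 <= M by exact: le_trans (normr_ge0 _) (bg 0).
have ms (W : T1 -> R) : measurable_fun [set: T1] W -> measurable [set w | K < `|W w|].
  move=> mW; rewrite -[X in measurable X]setTI.
  have mW' : measurable_fun [set: T1] (fun w => `|W w|) by exact: measurableT_comp.
  have := mW' measurableT (`]K, +oo[%classic) (measurable_itv _).
  by congr (measurable _); apply/seteqP; split => w /=; rewrite in_itv/= andbT.
have bX : bmeas (\1_[set w | K < `|X1 w|] : T1 -> R) by apply: bmeas_indic; exact: ms.
have bY : bmeas (\1_[set w | K < `|Y1 w|] : T1 -> R) by apply: bmeas_indic; exact: ms.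
have bFw := trig_bmeas tF mX1 mY1.
have bgw : bmeas (fun w => g (X1 w, Y1 w)) by apply: continuous2_bmeas => //; exists M.
rewrite -ExB//.
apply: (@le_trans _ _ (Ex P1 (fun w => e1 + 2 * M * (\1_[set w | K < `|X1 w|] w + \1_[set w | K < `|Y1 w|] w)))).
  apply: norm_Ex_le.
  - exact: bmeasB.
  - by apply: bmeasD; [exact: bmeas_cst|apply: bmeasZ; exact: bmeasD].
  move=> w; rewrite !indicE.
  have far : `|F (X1 w) (Y1 w) - g (X1 w, Y1 w)| <= 2 * M.
    by apply: le_trans (ler_normB _ _) _; rewrite mulr_natl mulr2n lerD.
  have [h1|h1] := boolP (w \in [set w | K < `|X1 w|]).
    by have [h2|h2] := boolP (w \in [set w | K < `|Y1 w|]) => /=; nra.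
  have [h2|h2] := boolP (w \in [set w | K < `|Y1 w|]) => /=; first by nra.
  rewrite addr0 mulr0 addr0; apply: Fg.
    by move: h1; rewrite notin_setE/= => /negP; rewrite -leNgt.
  by move: h2; rewrite notin_setE/= => /negP; rewrite -leNgt.
rewrite ExD; [|exact: bmeas_cst|by apply: bmeasZ; exact: bmeasD].
rewrite Ex_cst ExZ; last exact: bmeasD.
rewrite ExD// lerD2l.
have : 2 * M * (Ex P1 \1_[set w | K < `|X1 w|] + Ex P1 \1_[set w | K < `|Y1 w|]) <= 2 * M * (e2 + e2).
  by rewrite ler_wpM2l ?mulr_ge0// lerD.
by lra.
Qed.

Lemma portmanteau (g : R * R -> R) : continuous g -> (exists M, forall z, `|g z| <= M) ->
  Ex P (fun w => g (Xn n w, Yn n w)) @[n --> \oo] --> Ex P' (fun w => g (X w, Y w)).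
Proof.
move=> cg [M' bg']; pose M := `|M'| + 1.
have M0 : 0 < M by rewrite /M ltr_wpDl.
have bg z : `|g z| <= M by rewrite (le_trans (bg' z))// (le_trans (ler_norm _))// lerDl.
apply/cvgrPdist_le => e e0.
(* Error budget: replacing [g] by [F] costs [e1 + 4 M e2 = 2 e / 5] on each side of the limit, and
   the convergence for [F] takes the remaining [e / 5]. *)
pose e1 := e / 5; have e10 : 0 < e1 by rewrite divr_gt0.
pose e2 := e / (20 * M); have e20 : 0 < e2 by rewrite divr_gt0 ?mulr_gt0.
have Me2 : 4 * M * e2 = e / 5 by rewrite /e2; field; rewrite gt_eqF.
have [K K0 [htn [ht1 ht2]]] := tight e20.
have [F [tF bF Fg]] := trig_approx cg bg K0 e10.
have hF := trig_cvg tF.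
have hlim := Ex_trig_dist mX mY tF cg bg bF Fg (ltW e10) ht1 ht2.
near=> n.
have hn : `|Ex P (fun w => F (Xn n w) (Yn n w)) - Ex P (fun w => g (Xn n w, Yn n w))| <= e1 + 4 * M * e2.
  have [h1 h2] : Ex P \1_[set w | K < `|Xn n w|] <= e2 /\ Ex P \1_[set w | K < `|Yn n w|] <= e2.
    by near: n.
  exact: (Ex_trig_dist (mXn n) (mYn n) tF cg bg bF Fg (ltW e10)).
have hm : `|Ex P' (fun w => F (X w) (Y w)) - Ex P (fun w => F (Xn n w) (Yn n w))| <= e1.
  by near: n; move/cvgrPdist_le : hF; exact.
move: hn hm hlim; rewrite Me2 /e1.
set a := Ex P _; set b := Ex P _; set c := Ex P' _; set dd := Ex P' _.
by rewrite !ler_norml; lra.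
Unshelve. all: by end_near.
Qed.

End portmanteau.

(** * Characteristic function of the real normal law of variance 1/2 *)

Section gauss.
Context (R : realType).
Notation mu := (@lebesgue_measure R).
Let s : R := Num.sqrt 2^-1.

Let s2 : s ^+ 2 *+ 2 = 1.
Proof. by rewrite sqr_sqrtr ?invr_ge0// -mulr_natr mulVf. Qed.

Let s_neq0 : s != 0.
Proof. by rewrite gt_eqF// sqrtr_gt0 invr_gt0. Qed.

(** The density: as [2 s^2 = 1], the exponent is [- x^2] without a factor. *)
Let k (x : R) : R := normal_peak s * expR (- x ^+ 2).

Let normal_pdf_k x : normal_pdf 0 s x = k x.
Proof. by rewrite normal_pdfE// /normal_fun subr0 s2 divr1. Qed.

Let k_ge0 x : 0 <= k x.
Proof. by rewrite -normal_pdf_k normal_pdf_ge0. Qed.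

Let mk : measurable_fun [set: R] k.
Proof. by rewrite -(_ : normal_pdf 0 s = k); [exact: measurable_normal_pdf|apply/funext => x; exact: normal_pdf_k]. Qed.

Let mEFin (g : R -> R) : measurable_fun [set: R] g ->
  measurable_fun [set: measurableTypeR R] (EFin \o g).
Proof. by move=> mg; have := (measurable_EFinP [set: R] g).2 mg; exact. Qed.

Let intk : mu.-integrable [set: R] (EFin \o k).
Proof.
rewrite (_ : EFin \o k = fun x => (normal_pdf 0 s x)%:E); first exact: integrable_normal_pdf.
by apply/funext => x /=; rewrite normal_pdf_k.
Qed.

Let Rintk : \int[mu]_x k x = 1.
Proof.
have h := integral_normal_pdf (0 : R) s.
rewrite /Rintegral -[RHS]/(fine 1%E) -h; congr fine.
by apply: eq_integral => x _; rewrite normal_pdf_k.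
Qed.

(** The Radon-Nikodym derivative of the normal law and [k] have the same integral over every
    measurable set, hence agree almost everywhere. *)
Lemma normal_prob_integral (h : R -> R) : bmeas h ->
  (\int[normal_prob 0 s]_x (h x)%:E = \int[mu]_x (h x * k x)%:E)%E.
Proof.
move=> bh.
have ih : (normal_prob 0 s).-integrable [set: R] (EFin \o h) by exact: (bmeas_integrable (normal_prob 0 s)).
rewrite -(Radon_Nikodym_change_of_variables (normal_prob_dominates 0 s) measurableT ih).
have mh : measurable_fun [set: R] (EFin \o h) by apply/measurable_EFinP; case: bh.
have nd := normal_prob_dominates (0 : R) s.
have iRN := Radon_Nikodym_integrable (nu := charge_of_finite_measure (normal_prob 0 s)) nd.
have /integrableP[mRN _] := iRN.
apply: ae_eq_integral => //.
- by apply: emeasurable_funM => //; exact: (mEFin (proj1 bh)).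
- by apply: mEFin; apply: measurable_funM => //; case: bh.
- have ae : ae_eq mu setT (Radon_Nikodym (charge_of_finite_measure (normal_prob 0 s)) mu) (EFin \o k).
    apply: integral_ae_eq => //; first exact: mEFin.
    move=> A _ mA; rewrite -Radon_Nikodym_integral//= /normal_prob.
    by apply: eq_integral => x _; rewrite normal_pdf_k.
  apply: filterS ae => x /= /(_ I) ->//.
Qed.

Let E (x : R) : R := expR (- (x ^+ 2 / 2)).

Let intE c : mu.-integrable [set: R] (EFin \o (fun x => c * E x)).
Proof.
have h := integrable_normal_pdf (0 : R) 1.
have -> : EFin \o (fun x => c * E x) = fun x => ((c / normal_peak 1)%:E * (normal_pdf 0 1 x)%:E)%E.
  apply/funext => x /=; rewrite -EFinM normal_pdfE ?oner_neq0// /normal_fun subr0 expr1n mulNr.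
  by rewrite mulrA divfK ?gt_eqF ?normal_peak_gt0 ?oner_neq0// /E -[1 *+ 2]/2.
exact: integrableZl.
Qed.

(** One of the two factors [exp(- x^2 / 2)] absorbs [|x|], because
    [|x| <= 1 + x^2 / 2 <= exp(x^2 / 2)]. The other remains as an integrable majorant. *)
Let xk_le x : `|x * k x| <= normal_peak s * E x.
Proof.
rewrite normrM (ger0_norm (k_ge0 x)) /k mulrCA ler_wpM2l ?normal_peak_ge0//.
have -> : expR (- x ^+ 2) = E x * E x by rewrite /E -expRD; congr expR; field.
rewrite mulrA ler_piMl ?expR_ge0// /E expRN ler_pdivrMr ?expR_gt0// mul1r.
apply: le_trans (expR_ge1Dx _); rewrite -(real_normK (num_real x)).
have := sqr_ge0 (`|x| - 1); rewrite sqrrB1; lra.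
Qed.

Variable phi : R.

Let cF (a x : R) := cos (a * x + phi) * k x.

Let mlin a : measurable_fun [set: R] (fun x : R => a * x + phi).
Proof.
apply: measurable_funD; last exact: measurable_cst.
by apply: measurable_funM => //; exact: measurable_cst.
Qed.

Let mcF a : measurable_fun [set: R] (cF a).
Proof.
apply: measurable_funM => //; apply: measurable_comp_continuous; last exact: mlin.
exact: continuous_cos.
Qed.

Let msF a : measurable_fun [set: R] (fun x => x * sin (a * x + phi) * k x).
Proof.
apply: measurable_funM => //; apply: measurable_funM => //.
by apply: measurable_comp_continuous; [exact: continuous_sin|exact: mlin].
Qed.

Let icF a : mu.-integrable [set: R] (EFin \o cF a).
Proof.
apply: (le_integrable measurableT _ _ intk); first exact: mEFin.
move=> x _ /=; rewrite lee_fin /cF normrM ler_piMl//.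
exact: cos_max.
Qed.

Let isF a : mu.-integrable [set: R] (EFin \o (fun x => x * sin (a * x + phi) * k x)).
Proof.
apply: (le_integrable measurableT _ _ (intE (normal_peak s))); first exact: mEFin.
move=> x _ /=; rewrite lee_fin mulrAC normrM.
apply: (@le_trans _ _ `|x * k x|); first by rewrite ler_piMr// sin_max.
by apply: le_trans (xk_le x) (ler_norm _).
Qed.

Let dlin (a x : R) : is_derive x 1 (fun x : R => a * x + phi) a.
Proof.
apply: (is_derive_eq (is_deriveD (is_deriveZ a (is_derive_id x 1)) (is_derive_cst phi x 1))).
by rewrite addr0 /GRing.scale/= mulr1.
Qed.

Let dk (x : R) : is_derive x 1 k (- (2 * x) * k x).
Proof.
have h1 : is_derive x 1 (fun x : R => - x ^+ 2) (- (2 * x)).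
  have -> : (fun x : R => - x ^+ 2) = (fun x : R => - (x * x)) by apply/funext => y; rewrite expr2.
  apply: (is_derive_eq (is_deriveN (is_deriveM (is_derive_id x 1) (is_derive_id x 1)))).
  by rewrite /GRing.scale/= mulr1 mulr_natl mulr2n.
have h2 := is_derive1_comp (is_derive_expR _) h1.
apply: (is_derive_eq (is_deriveZ (normal_peak s) h2)).
by rewrite /GRing.scale/= /k; ring.
Qed.

(* The integrand is the derivative of [sin (a x + phi) * k x], which vanishes at infinity. *)
Let parts a : \int[mu]_x (a * cF a x - 2 * (x * sin (a * x + phi) * k x)) = 0.
Proof.
pose F (x : R) := sin (a * x + phi) * k x.
pose F' (x : R) := a * cF a x - 2 * (x * sin (a * x + phi) * k x).
have dF (x : R) : is_derive x 1 F (F' x).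
  have h := is_derive1_comp (is_derive_sin _) (dlin a x).
  apply: (is_derive_eq (is_deriveM h (dk x))).
  by rewrite /GRing.scale/= /F' /cF; ring.
have ck : continuous k.
  by move=> x; apply: differentiable_continuous; apply/derivable1_diffP; have [] := dk x.
have clin : continuous (fun x : R => a * x + phi).
  by move=> x; apply: differentiable_continuous; apply/derivable1_diffP; have [] := dlin a x.
have cFF : continuous F.
  by move=> x; apply: differentiable_continuous; apply/derivable1_diffP; have [] := dF x.
have cF' : continuous F'.
  move=> x; apply: cvgB; apply: cvgM; [exact: cvg_cst| |exact: cvg_cst|].
    by apply: cvgM; [apply: continuous_comp; [exact: clin|exact: continuous_cos]|exact: ck].
  apply: cvgM; [|exact: ck]; apply: cvgM; first exact: cvg_id.
  by apply: continuous_comp; [exact: clin|exact: continuous_sin].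
have iF' : mu.-integrable [set: R] (EFin \o F').
  have -> : EFin \o F' = ((fun x => a%:E * (EFin \o cF a) x) \- (fun x => 2%:E * (EFin \o (fun x => x * sin (a * x + phi) * k x)%R) x))%E.
    by apply/funext => x /=; rewrite -!EFinM -EFinB.
  by apply: integrableB => //; apply: integrableZl => //.
have mF' : measurable_fun [set: R] F' by exact: continuous_measurable_fun.
(* Integrals of [F'] over growing symmetric intervals have two limits: the full integral by
   dominated convergence, and [0] by the fundamental theorem of calculus, since [F] is bounded by
   [k]. *)
pose D (n : nat) : set R := `[- n.+1%:R, n.+1%:R]%classic.
have mD n : measurable (D n) by exact: measurable_itv.
have fin n : (\int[mu]_(x in D n) (F' x)%:E = (F n.+1%:R)%:E - (F (- n.+1%:R))%:E)%E.
  apply: continuous_FTC2.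
  - by apply: (@lt_trans _ _ 0); rewrite ?oppr_lt0 ltr0n.
  - by apply: continuous_subspaceT.
  - split.
    + by move=> x _; have [] := dF x.
    + by apply: cvg_at_right_filter; exact: cFF.
    + by apply: cvg_at_left_filter; exact: cFF.
  - by move=> x _; rewrite derive1E; have [_ ->] := dF x.
pose f_ n (x : R) := ((F' \_ (D n)) x)%:E.
have [_ _ lim1] : [/\ mu.-integrable setT (EFin \o F'),
   [sequence (\int[mu]_x (`|f_ n x - (EFin \o F') x|))%E]_n @ \oo --> 0%E &
   [sequence (\int[mu]_x f_ n x)%E]_n @ \oo --> (\int[mu]_x (EFin \o F') x)%E].
  apply: (@dominated_convergence _ _ _ mu setT measurableT f_ (EFin \o F') (fun x => `|(EFin \o F') x|%E)) => //.
  - by move=> n; apply: mEFin; apply/(measurable_restrictT F' (mD n)); exact: measurable_funTS.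
  - exact: mEFin.
  - apply: aeW => x _; apply: (@cvg_near_cst _ _ _ _ \oo).
    pose N := Num.bound `|x|.
    near=> n; rewrite /f_ patchE mem_set// /D/= in_itv/= -ler_norml.
    have xN : `|x| < N%:R by exact: archi_boundP.
    apply: le_trans (ltW xN) _; rewrite ler_nat; apply: leqW.
    by near: n; exact: nbhs_infty_ge.
  - exact: integrable_abse.
  - apply: aeW => x n _; rewrite /f_ patchE; case: ifP => _ //=.
    by rewrite normr0 lee_fin.
have lim2 : [sequence (\int[mu]_x f_ n x)%E]_n @ \oo --> 0%E.
  have E1 n : (\int[mu]_x f_ n x = (F n.+1%:R - F (- n.+1%:R))%:E)%E.
    by rewrite EFinB -fin [RHS]integral_mkcond; apply: eq_integral => x _; rewrite restrict_EFin.
  rewrite (_ : [sequence _]_n = EFin \o (fun n : nat => F n.+1%:R - F (- n.+1%:R))); last first.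
    by apply/funext => n /=; rewrite E1.
  apply: cvg_EFin; first by apply: nearW => n.
  have Fk (x : R) : `|F x| <= k x.
    by rewrite /F normrM (ger0_norm (k_ge0 x)) ler_piMl// sin_max.
  have kn (n : nat) : k n.+1%:R <= normal_peak s / n.+1%:R.
    rewrite /k ler_pM2l ?normal_peak_gt0// expRN lef_pV2 ?posrE ?expR_gt0 ?ltr0n//.
    apply: le_trans (expR_ge1Dx _); rewrite expr2.
    have : 1 <= n.+1%:R :> R by rewrite ler1n.
    by nra.
  have kN x : k (- x) = k x by rewrite /k sqrrN.
  apply/cvgrPdist_le => e e0.
  pose N := Num.bound (2 * normal_peak s / e).
  have hN : 2 * normal_peak s / e < N%:R.
    by apply: archi_boundP; rewrite divr_ge0 ?mulr_ge0 ?normal_peak_ge0// ltW.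
  near=> n.
  have nN : N%:R <= n.+1%:R :> R by rewrite ler_nat leqW//; near: n; exact: nbhs_infty_ge.
  rewrite /= sub0r normrN; apply: le_trans (ler_normB _ _) _.
  apply: le_trans (lerD (Fk _) (Fk _)) _; rewrite kN.
  apply: le_trans (lerD (kn n) (kn n)) _.
  rewrite -mulrDl ler_pdivrMr ?ltr0n// [leRHS]mulrC -ler_pdivrMr//.
  by apply: le_trans nN; apply: le_trans (ltW hN); rewrite ler_pM2r ?invr_gt0//; lra.
have := cvg_unique _ lim1 lim2 => /(_ (@ereal_hausdorff R)) h.
by rewrite /Rintegral; move: h => /= ->.
Unshelve. all: by end_near.
Qed.

Let C (a : R) : R := \int[mu]_x cF a x.

(** Differentiation under the integral gives minus the integral of [x sin (a x + phi) k x], which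
    [parts] turns into a multiple of [C a]: the differential equation of a Gaussian. *)
Let dC (a : R) : is_derive a 1 C (- (a / 2) * C a).
Proof.
have d1 (b x : R) : is_derive b 1 (fun b => cF b x) (- (x * sin (b * x + phi) * k x)).
  have hl : is_derive b 1 (fun b : R => b * x + phi) x.
    have -> : (fun b : R => b * x + phi) = (fun b : R => x * b + phi) by apply/funext => y; rewrite mulrC.
    apply: (is_derive_eq (is_deriveD (is_deriveZ x (is_derive_id b 1)) (is_derive_cst phi b 1))).
    by rewrite addr0 /GRing.scale/= mulr1.
  have h := is_derive1_comp (is_derive_cos _) hl.
  have -> : (fun b => cF b x) = (fun b => k x * (cos \o (fun b : R => b * x + phi)) b).
    by apply/funext => y; rewrite /cF mulrC.
  apply: (is_derive_eq (is_deriveZ (k x) h)).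
  by rewrite /GRing.scale/=; ring.
have p1 b x : partial1of2 cF b x = - (x * sin (b * x + phi) * k x).
  by rewrite partial1of2E; have [_ ->] := d1 b x.
(* The majorant of the partial derivative does not depend on the parameter, so any neighbourhood of
   [a] serves. *)
have Ia : `](a - 1), (a + 1)[%classic a by rewrite /= in_itv/=; lra.
have iG := intE (normal_peak s).
have G0 x : 0 <= normal_peak s * E x by rewrite mulr_ge0 ?normal_peak_ge0 ?expR_ge0.
have derf b x : `](a - 1), (a + 1)[%classic b -> [set: R] x -> derivable (cF ^~ x) b 1.
  by move=> _ _; have [] := d1 b x.
have Gub b x : `](a - 1), (a + 1)[%classic b -> [set: R] x -> `|partial1of2 cF b x| <= normal_peak s * E x.
  move=> _ _; rewrite p1 normrN mulrAC normrM.
  apply: le_trans (xk_le x); by rewrite ler_piMr// sin_max.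
have intf b : `](a - 1), (a + 1)[%classic b -> mu.-integrable [set: R] (EFin \o cF b) by move=> _; exact: icF.
have h1 := @derivable_under_integral R _ _ mu cF setT measurableT a (a - 1) (a + 1) Ia intf derf _ G0 iG Gub.
have h2 := @differentiation_under_integral R _ _ mu cF setT measurableT a (a - 1) (a + 1) Ia intf derf _ G0 iG Gub.
split; first exact: h1.
rewrite -derive1E h2 (@eq_Rintegral _ _ _ mu setT (fun x => (-1) * (x * sin (a * x + phi) * k x))); last first.
  by move=> x _; rewrite p1 mulN1r.
rewrite RintegralZl//.
have := parts a; rewrite RintegralB//; last 2 first.
- by have := integrableZl measurableT a (icF a).
- by have := integrableZl measurableT 2 (isF a).
rewrite !RintegralZl// -/(C a); lra.
Qed.

(** By the differential equation, [C a exp(a^2 / 4)] has derivative zero; its constant value is read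
    off at [a = 0]. *)
Lemma gauss_cos (a : R) : \int[mu]_x (cos (a * x + phi) * k x) = cos phi * expR (- (a ^+ 2 / 4)).
Proof.
pose D (a : R) := C a * expR (a ^+ 2 / 4).
have dD (b : R) : is_derive b 1 D 0.
  have h1 : is_derive b 1 (fun b : R => b ^+ 2 / 4) (b / 2).
    have -> : (fun b : R => b ^+ 2 / 4) = (fun b : R => 4^-1 * (b * b)) by apply/funext => y; rewrite mulrC expr2.
    apply: (is_derive_eq (is_deriveZ 4^-1 (is_deriveM (is_derive_id b 1) (is_derive_id b 1)))).
    by rewrite /GRing.scale/= mulr1; field.
  have h2 := is_derive1_comp (is_derive_expR _) h1.
  apply: (is_derive_eq (is_deriveM (dC b) h2)).
  by rewrite /GRing.scale/=; ring.
have := is_derive_0_is_cst a 0 dD; rewrite /D expr0n mul0r expR0 mulr1 => h.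
have C0 : C 0 = cos phi.
  rewrite /C (@eq_Rintegral _ _ _ mu setT (fun x => cos phi * k x)); last by move=> x _; rewrite /cF mul0r add0r.
  by rewrite RintegralZl// Rintk mulr1.
rewrite -/(C a) -C0 -h -mulrA -expRD subrr expR0 mulr1//.
Qed.

End gauss.

(** * Independent normal variables and the complex normal law *)

Section normal_rv.
Context (R : realType) (d : measure_display) (T : measurableType d) (P : probability T R).

Lemma normal_cos (X : {RV P >-> R}) (a phi : R) :
  (forall B, measurable B -> distribution P X B = normal_prob 0 (Num.sqrt 2^-1) B) ->
  Ex P (fun w => cos (a * X w + phi)) = cos phi * expR (- (a ^+ 2 / 4)).
Proof.
move=> hX.
have bc : bmeas (fun x : R => cos (a * x + phi)).
  apply: bmeas_cos; apply: measurable_funD; last exact: measurable_cst.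
  by apply: measurable_funM => //; exact: measurable_cst.
have mc : measurable_fun [set: R] (EFin \o (fun x : R => cos (a * x + phi))).
  by apply/measurable_EFinP; case: bc.
have bcX : bmeas (fun w => cos (a * X w + phi)).
  split; last by exists 1 => w; exact: cos_max.
  by apply: (measurableT_comp (proj1 bc)); exact: measurable_funPT.
rewrite -gauss_cos /Ex /Rintegral -normal_prob_integral//; congr fine.
have mX0 : measurable_fun [set: T] X by exact: measurable_funPT.
have mX : measurable_fun [set: T] (X : T -> measurableTypeR R) := mX0.
have := @integral_pushforward _ _ T (measurableTypeR R) R X mX P setT
  (EFin \o (fun x : R => cos (a * x + phi))) mc (bmeas_integrable P bcX) measurableT.
rewrite preimage_setT => /= <-.
by apply: eq_measure_integral => B mB _; exact: hX.
Qed.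

(** Independence of events is upgraded to functions one variable at a time by [Ex_mul_eq0]: first
    the centred indicator of a [Y]-event is orthogonal to [h (X w)], then the centred [h (X w)] is
    orthogonal to [k (Y w)]. *)
Lemma Ex_indep2 (X Y : {RV P >-> R}) (h k : R -> R) : indep2 P X Y ->
  bmeas h -> bmeas k ->
  Ex P (fun w => h (X w) * k (Y w)) = Ex P (fun w => h (X w)) * Ex P (fun w => k (Y w)).
Proof.
move=> ind bh bk.
have bcomp (g : R -> R) (Z : {RV P >-> R}) : bmeas g -> bmeas (fun w => g (Z w)).
  move=> [mg [M hM]]; split; last by exists M => w; exact: hM.
  by apply: (measurableT_comp mg); exact: measurable_funPT.
have bhX := bcomp h X bh; have bkY := bcomp k Y bk.
have mpre (Z : {RV P >-> R}) B : measurable B -> measurable (Z @^-1` B).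
  by move=> mB; have := @measurable_funPT _ _ _ _ Z measurableT B mB; rewrite setTI.
have step1 B : measurable B ->
    Ex P (fun w => (\1_(Y @^-1` B) w - Ex P \1_(Y @^-1` B)) * h (X w)) = 0.
  move=> mB; have mYB := mpre Y B mB.
  have bY : bmeas (\1_(Y @^-1` B) : T -> R) by exact: bmeas_indic.
  apply: Ex_mul_eq0 => //; first by apply: bmeasB => //; exact: bmeas_cst.
  move=> A mA.
  have mhA : measurable (h @^-1` A) by have := proj1 bh measurableT A mA; rewrite setTI.
  have mXA := mpre X _ mhA.
  rewrite -[(fun w => h (X w)) @^-1` A]/(X @^-1` (h @^-1` A)).
  have bX : bmeas (\1_(X @^-1` (h @^-1` A)) : T -> R) by exact: bmeas_indic.
  rewrite (eq_Ex P (Y := fun w => \1_(X @^-1` (h @^-1` A) `&` Y @^-1` B) w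
     - Ex P \1_(Y @^-1` B) * \1_(X @^-1` (h @^-1` A)) w)); last first.
    by move=> w; rewrite mulrBl indicI mulrC.
  rewrite ExB; [|by apply: bmeas_indic; exact: measurableI|exact: bmeasZ].
  rewrite ExZ//; apply/eqP; rewrite subr_eq0; apply/eqP/EFin_inj.
  rewrite EFinM !Ex_indic//; last exact: measurableI.
  by rewrite ind// muleC.
have step2 : Ex P (fun w => (h (X w) - Ex P (fun w => h (X w))) * k (Y w)) = 0.
  apply: Ex_mul_eq0 => //; first by apply: bmeasB => //; exact: bmeas_cst.
  move=> A mA.
  have mkA : measurable (k @^-1` A) by have := proj1 bk measurableT A mA; rewrite setTI.
  have mYA := mpre Y _ mkA.
  rewrite -[(fun w => k (Y w)) @^-1` A]/(Y @^-1` (k @^-1` A)).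
  have bY : bmeas (\1_(Y @^-1` (k @^-1` A)) : T -> R) by exact: bmeas_indic.
  have := step1 _ mkA.
  rewrite (eq_Ex P (Y := fun w => h (X w) * \1_(Y @^-1` (k @^-1` A)) w - Ex P \1_(Y @^-1` (k @^-1` A)) * h (X w))); last by move=> w; ring.
  rewrite ExB; [|exact: bmeasM|exact: bmeasZ]; rewrite ExZ// => h1.
  rewrite (eq_Ex P (Y := fun w => h (X w) * \1_(Y @^-1` (k @^-1` A)) w - Ex P (fun w => h (X w)) * \1_(Y @^-1` (k @^-1` A)) w)); last by move=> w; ring.
  rewrite ExB; [|exact: bmeasM|exact: bmeasZ]; rewrite ExZ// -[RHS]h1.
  by congr (_ - _); rewrite mulrC.
move: step2; rewrite (eq_Ex P (Y := fun w => h (X w) * k (Y w) - Ex P (fun w => h (X w)) * k (Y w))); last by move=> w; ring.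
rewrite ExB; [|exact: bmeasM|exact: bmeasZ]; rewrite ExZ// => /eqP.
by rewrite subr_eq0 => /eqP.
Qed.

(** The exponent is written as half of [v = (a^2 + b^2) / 2], the variance of [a Re + b Im], to
    match the form [exp(- v / 2)] of the martingale bound. *)
Lemma std_complex_normal_cos (Z : T -> R[i]) (a b phi : R) : std_complex_normal P Z ->
  Ex P (fun w => cos (a * complex.Re (Z w) + b * complex.Im (Z w) + phi)) =
  cos phi * expR (- ((a ^+ 2 + b ^+ 2) / 2 / 2)).
Proof.
case=> X [Y [hX hY ind ZE]].
have bl (g : R -> R) c f : (forall Z : R -> R, measurable_fun [set: R] Z -> bmeas (fun w => g (Z w))) ->
    bmeas (fun x : R => g (c * x + f)).
  move=> hg; apply: hg; apply: measurable_funD; last exact: measurable_cst.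
  by apply: measurable_funM => //; exact: measurable_cst.
have bc c f : bmeas (fun x : R => cos (c * x + f)) by apply: bl => ? ?; exact: bmeas_cos.
(* The addition formula, with both sines written as shifted cosines so that every factor has a mean
   given by [normal_cos]. The second product vanishes in the mean because [cos (pi / 2) = 0]. *)
rewrite (eq_Ex P (Y := fun w => cos (a * X w + phi) * cos (b * Y w + 0)
    + cos (a * X w + (phi + pi / 2)) * cos (b * Y w + - (pi / 2)))); last first.
  move=> w; rewrite ZE /= addr0 addrA cosDpihalf cosBpihalf mulNr -cosD; congr cos; ring.
have bcomp (g : R -> R) (Z0 : {RV P >-> R}) : bmeas g -> bmeas (fun w => g (Z0 w)).
  move=> [mg [M hM]]; split; last by exists M => w; exact: hM.
  by apply: (measurableT_comp mg); exact: measurable_funPT.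
rewrite ExD; last 2 first.
- apply: bmeasM; [exact: (bcomp (fun x => cos (a * x + phi)))|exact: (bcomp (fun x => cos (b * x + 0)))].
- apply: bmeasM; [exact: (bcomp (fun x => cos (a * x + (phi + pi / 2))))|exact: (bcomp (fun x => cos (b * x + - (pi / 2))))].
rewrite (Ex_indep2 (h := fun x => cos (a * x + phi)) (k := fun x => cos (b * x + 0)) ind)//.
rewrite (Ex_indep2 (h := fun x => cos (a * x + (phi + pi / 2))) (k := fun x => cos (b * x + - (pi / 2))) ind)//.
rewrite !(normal_cos _ _ hX) !(normal_cos _ _ hY) cos0 cosN cos_pihalf !mul0r mulr0 addr0 mul1r.
by rewrite -mulrA -expRD; congr (_ * expR _); field.
Qed.

End normal_rv.

(** * Complex random variables through real and imaginary parts *)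

Section complex_rv.
Context (R : realType).
Implicit Types z : R[i].

Lemma cReM z z' : complex.Re (z * z') =
  complex.Re z * complex.Re z' - complex.Im z * complex.Im z'.
Proof. by case: z; case: z'. Qed.

Lemma cImM z z' : complex.Im (z * z') =
  complex.Re z * complex.Im z' + complex.Im z * complex.Re z'.
Proof. by case: z => a b; case: z' => a' b'. Qed.

Lemma cReD z z' : complex.Re (z + z') = complex.Re z + complex.Re z'.
Proof. by case: z; case: z'. Qed.

Lemma cImD z z' : complex.Im (z + z') = complex.Im z + complex.Im z'.
Proof. by case: z; case: z'. Qed.

Lemma cRe_conjc z : complex.Re (conjc z) = complex.Re z.
Proof. by case: z. Qed.

Lemma cIm_conjc z : complex.Im (conjc z) = - complex.Im z.
Proof. by case: z. Qed.

Lemma eq_ReIm z z' : complex.Re z = complex.Re z' ->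
  complex.Im z = complex.Im z' -> z = z'.
Proof. by case: z => a b; case: z' => a' b' /= -> ->. Qed.

(** The squared modulus as an element of [R], ready for real expectations and inequalities. *)
Definition nsq z : R := complex.Re z ^+ 2 + complex.Im z ^+ 2.

Lemma nsqM z z' : nsq (z * z') = nsq z * nsq z'.
Proof. by rewrite /nsq cReM cImM; ring. Qed.

Lemma nsqE z : (nsq z)%:C%C = z * conjc z.
Proof.
by apply: eq_ReIm; rewrite ?cReM ?cImM cRe_conjc cIm_conjc /nsq /=; ring.
Qed.

Context (d : measure_display) (T : measurableType d).
Implicit Types Z : T -> R[i].

Definition cbmeas Z := bmeas (fun w => complex.Re (Z w)) /\ bmeas (fun w => complex.Im (Z w)).

Lemma cbmeas_cst z : cbmeas (fun=> z).
Proof. by split; exact: bmeas_cst. Qed.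

Lemma cbmeasM Z Z' : cbmeas Z -> cbmeas Z' -> cbmeas (fun w => Z w * Z' w).
Proof.
move=> [h1 h2] [h3 h4]; split.
  under eq_fun do rewrite cReM.
  by apply: bmeasB; exact: bmeasM.
under eq_fun do rewrite cImM.
by apply: bmeasD; exact: bmeasM.
Qed.

Lemma cbmeasD Z Z' : cbmeas Z -> cbmeas Z' -> cbmeas (fun w => Z w + Z' w).
Proof.
move=> [h1 h2] [h3 h4]; split.
  by under eq_fun do rewrite cReD; exact: bmeasD.
by under eq_fun do rewrite cImD; exact: bmeasD.
Qed.

Lemma cbmeas_conjc Z : cbmeas Z -> cbmeas (fun w => conjc (Z w)).
Proof.
move=> [h1 h2]; split; first by under eq_fun do rewrite cRe_conjc.
by under eq_fun do rewrite cIm_conjc; exact: bmeasN.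
Qed.

Lemma cbmeasX n Z : cbmeas Z -> cbmeas (fun w => Z w ^+ n).
Proof.
move=> hZ; elim: n => [|n IH].
  by rewrite (_ : (fun w => _) = fun=> 1) //; exact: cbmeas_cst.
by rewrite (_ : (fun w => _) = fun w => Z w * Z w ^+ n);
  [exact: cbmeasM|apply/funext => w; rewrite exprS].
Qed.

Lemma cbmeas_sum I (r : seq I) (Q : pred I) (Z : I -> T -> R[i]) :
  (forall i, Q i -> cbmeas (Z i)) -> cbmeas (fun w => \sum_(i <- r | Q i) Z i w).
Proof.
move=> hZ; elim: r => [|i r IH].
  rewrite (_ : (fun w => _) = fun=> 0); first exact: cbmeas_cst.
  by apply/funext => w; rewrite big_nil.
rewrite (_ : (fun w => _) =
    fun w => (if Q i then Z i w else 0) + \sum_(i <- r | Q i) Z i w).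
  by case Qi: (Q i); [exact: cbmeasD (hZ _ Qi) IH|exact: cbmeasD (cbmeas_cst _) IH].
by apply/funext => w; rewrite big_cons; case: ifP; rewrite ?add0r.
Qed.

End complex_rv.

(** * Moments of the uniform law on the circle *)

Section circle_moments.
Context (R : realType).

Definition cplx (z : R * R) : R[i] := (z.1 +i* z.2)%C.

Lemma circle_nsq (t : R) : nsq (cplx (circle t)) = 1.
Proof. by rewrite /nsq /= cos2Dsin2. Qed.

Lemma circleX (t : R) n : cplx (circle t) ^+ n =
  (cos (2 * pi * n%:R * t) +i* sin (2 * pi * n%:R * t))%C.
Proof.
elim: n => [|n IH]; first by rewrite expr0 mulr0 mul0r cos0 sin0.
rewrite exprS IH; have -> : 2 * pi * n.+1%:R * t = 2 * pi * t + 2 * pi * n%:R * t.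
  by rewrite -natr1; ring.
by apply: eq_ReIm; rewrite ?cReM ?cImM /= ?cosD ?sinD//; ring.
Qed.

Lemma measurable_circle : measurable_fun [set: measurableTypeR R] (@circle R).
Proof.
apply: measurable_fun_pair.
  apply: measurable_comp_continuous; first exact: continuous_cos.
  by apply: measurable_funM => //; exact: measurable_cst.
apply: measurable_comp_continuous; first exact: continuous_sin.
by apply: measurable_funM => //; exact: measurable_cst.
Qed.

Lemma cos_pi_nat n : cos (2 * pi * n%:R + 0) = 1 :> R.
Proof.
rewrite addr0; elim: n => [|n IH]; first by rewrite mulr0 cos0.
rewrite (_ : 2 * pi * n.+1%:R = 2 * pi * n%:R + pi *+ 2) ?cosD2pi//.
by rewrite -[n.+1%:R]natr1 mulrDr mulr1 (mulr_natl pi).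
Qed.

Lemma sin_pi_nat n : sin (2 * pi * n%:R) = 0 :> R.
Proof.
have := cos2Dsin2 (2 * pi * n%:R : R); have := cos_pi_nat n; rewrite addr0 => ->.
rewrite expr1n => /eqP; rewrite addrC -subr_eq0 addrK sqrf_eq0 => /eqP; exact.
Qed.

Lemma Rintegral_cos_eq0 n phi : (0 < n)%N ->
  \int[lebesgue_measure]_(t in `[(0:R), 1]) cos (2 * pi * n%:R * t + phi) = 0.
Proof.
move=> n0; set b := 2 * pi * n%:R.
have b0 : b != 0 by rewrite /b !mulf_neq0 ?pnatr_eq0 -?lt0n// gt_eqF// pi_gt0.
pose F (t : R) := b^-1 * sin (b * t + phi).
have dF (t : R) : is_derive t 1 F (cos (b * t + phi)).
  rewrite /F.
  have h1 : is_derive t 1 (fun t : R => b * t + phi) b.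
    apply: (is_derive_eq (is_deriveD (is_deriveZ b (is_derive_id t 1)) (is_derive_cst phi t 1))).
    by rewrite addr0 /GRing.scale/= mulr1.
  have h2 : is_derive t 1 (fun t : R => sin (b * t + phi)) (b * cos (b * t + phi)).
    have -> : (fun t : R => sin (b * t + phi)) = sin \o (fun t : R => b * t + phi) by [].
    by apply: (is_derive_eq (is_derive1_comp (is_derive_sin _) h1)); rewrite /GRing.scale/= mulrC.
  apply: (is_derive_eq (is_deriveZ b^-1 h2)).
  by rewrite /GRing.scale/= mulrA mulVf ?mul1r.
have cc : continuous (fun t : R => cos (b * t + phi)).
  move=> t; apply: (@continuous_comp _ _ _ (fun t : R => b * t + phi) cos); last exact: continuous_cos.
  by apply: cvgD; [apply: cvgM; [exact: cvg_cst|exact: cvg_id]|exact: cvg_cst].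
have cF : continuous F by move=> t; apply: differentiable_continuous; apply/derivable1_diffP; have [] := dF t.
rewrite /Rintegral (continuous_FTC2 (F := F)) ?ltr01//.
- rewrite /= /F mulr1 mulr0 add0r sinD sin_pi_nat mul0r add0r.
  by have := cos_pi_nat n; rewrite addr0 -/b => ->; rewrite mul1r subrr.
- by apply: continuous_subspaceT.
- split.
  + by move=> x _; have [] := dF x.
  + by apply: cvg_at_right_filter; exact: cF.
  + by apply: cvg_at_left_filter; exact: cF.
- by move=> x _; rewrite derive1E; have [_ ->] := dF x.
Qed.

Lemma uniform_cos_eq0 n phi : (0 < n)%N ->
  Ex (uniform_prob (@ltr01 R)) (fun t => cos (2 * pi * n%:R * t + phi)) = 0.
Proof.
move=> n0; set b := 2 * pi * n%:R.
have mc : measurable_fun [set: R] (fun t : R => b * t + phi).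
  apply: measurable_funD; last exact: measurable_cst.
  by apply: measurable_funM => //; exact: measurable_cst.
have bc : bmeas (fun t : R => cos (b * t + phi)) by exact: bmeas_cos.
(* The integrand is made nonnegative before the uniform law is turned into a Lebesgue integral; the
   constant is removed by linearity. *)
suff : Ex (uniform_prob (@ltr01 R)) (fun t => 1 + cos (b * t + phi)) = 1.
  rewrite ExD//; last exact: bmeas_cst.
  by rewrite Ex_cst => /eqP; rewrite addrC -subr_eq0 addrK => /eqP.
have mE : measurable_fun [set: R] (fun t : R => (1 + cos (b * t + phi))%:E).
  apply/measurable_EFinP; apply: measurable_funD; first exact: measurable_cst.
  by case: bc.
rewrite /Ex /Rintegral integral_uniform//=.
rewrite subr0 invr1 mul1e.
have lm : (lebesgue_measure (`[0%R, 1%R]%classic : set R) < +oo)%E.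
  by rewrite lebesgue_measure_itv/= lte_fin ltr01 -EFinB ltry.
have ic : lebesgue_measure.-integrable `[(0:R), 1] (EFin \o (fun t => cos (b * t + phi))).
  apply: measurable_bounded_integrable => //.
  - by apply: measurable_funTS; case: bc.
  - by exists 1; split; [exact: num_real|move=> x x1 y _ /=; exact: le_trans (cos_max _) (ltW x1)].
have i1 : lebesgue_measure.-integrable `[(0:R), 1] (EFin \o (fun t => (1 : R))).
  apply: measurable_bounded_integrable => //.
  - by exists 1; split; [exact: num_real|move=> x x1 y _ /=; rewrite normr1 ltW].
have mI : measurable (`[0%R, 1%R]%classic : set (measurableTypeR R)) by exact: measurable_itv.
have := RintegralD mI i1 ic; rewrite /Rintegral => ->.
rewrite -[X in _ + X = _]/(\int[lebesgue_measure]_(t in `[(0:R), 1]) cos (b * t + phi)).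
rewrite Rintegral_cos_eq0// addr0 -[LHS]/(\int[lebesgue_measure]_(t in `[(0:R), 1]) 1).
have lmE : lebesgue_measure (`[0%R, 1%R]%classic : set R) = 1%:E.
  by rewrite lebesgue_measure_itv/= lte_fin ltr01 -EFinB subr0.
by rewrite Rintegral_cst// mul1r -[RHS]/(fine 1%:E) -lmE.
Qed.

End circle_moments.

(** * Steinhaus functions corrected on a null event *)

Section steinhaus_unimodular.
Context (R : realType) (d : measure_display) (T : measurableType d).
Variables (P : probability T R) (f : nat -> T -> R[i]).

(* What the argument uses of a Steinhaus function once the null event where
   some [f p] is off the circle has been discarded. *)
Record unimodular_steinhaus : Prop := UnimodularSteinhaus {
  us1 : forall w, f 1%N w = 1;
  usM : forall m n w, (0 < m)%N -> (0 < n)%N -> f (m * n)%N w = f m w * f n w;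
  us_nsq : forall n w, (0 < n)%N -> nsq (f n w) = 1;
  us_meas : forall p, prime p -> measurable_fun [set: T] (@reim R \o f p);
  us_Re : forall p a, prime p -> (0 < a)%N -> Ex P (fun w => complex.Re (f p w ^+ a)) = 0;
  us_Im : forall p a, prime p -> (0 < a)%N -> Ex P (fun w => complex.Im (f p w ^+ a)) = 0;
  us_indep : mutual_indep P [set p | prime p] (fun p => @reim R \o f p) }.

End steinhaus_unimodular.

Section steinhaus_modification.
Context (R : realType) (d : measure_display) (T : measurableType d).
Variables (P : probability T R) (f : nat -> T -> R[i]).
Hypothesis hf : steinhaus P f.

Let Cset : set (R * R) := [set z | z.1 ^+ 2 + z.2 ^+ 2 = 1].

Let mCset : measurable Cset.
Proof.
have m : measurable_fun [set: R * R] (fun z : R * R => z.1 ^+ 2 + z.2 ^+ 2).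
  apply: measurable_funD; apply: measurable_funX; [exact: measurable_fst|exact: measurable_snd].
by have := m measurableT [set 1] (measurable_set1 1); rewrite setTI.
Qed.

Let mf p : prime p -> measurable_fun [set: T] (@reim R \o f p).
Proof. by move=> pp; case: hf => _ /(_ p pp) []. Qed.

Definition good := \bigcap_p [set w | prime p -> Cset (reim (f p w))].

Let E p := [set w | prime p -> Cset (reim (f p w))].

Let mE p : measurable (E p).
Proof.
have [pp|npp] := boolP (prime p); last first.
  rewrite (_ : E p = setT)//; apply/seteqP; split => w //= _ pp.
  by rewrite pp in npp.
rewrite (_ : E p = (@reim R \o f p) @^-1` Cset); last first.
  by apply/seteqP; split => w /= h; [exact: h pp|move=> _].
by have := mf pp measurableT mCset; rewrite setTI.
Qed.

Let PE p : P (~` E p) = 0%E.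
Proof.
have [pp|npp] := boolP (prime p); last first.
  rewrite (_ : ~` E p = set0) ?measure0//; apply/seteqP; split => w //=.
  by apply => pp; rewrite pp in npp.
suff PE1 : P (E p) = 1%E.
  by rewrite probability_setC; [rewrite PE1 subee|exact: mE].
have -> : E p = (@reim R \o f p) @^-1` Cset.
  by apply/seteqP; split => w /= h; [exact: h pp|move=> _].
have [_ hu _] := hf; have [_ hu'] := hu p pp; have := hu' Cset mCset.
rewrite /pushforward => ->.
have -> : (@circle R) @^-1` Cset = setT.
  by apply/seteqP; split => t //= _; rewrite /Cset/= cos2Dsin2.
exact: probability_setT.
Qed.

Lemma measurable_good : measurable good.
Proof. by apply: bigcapT_measurable => p; exact: mE. Qed.

Lemma probability_good_setC : P (~` good) = 0%E.
Proof.
rewrite /good setC_bigcap.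
have mC p : measurable (~` E p) by apply: measurableC; exact: mE.
have : P.-negligible (\bigcup_p (~` E p)).
  by apply: negligible_bigcup => p; apply/negligibleP => //; exact: PE.
by move/negligibleP; apply; exact: bigcupT_measurable.
Qed.

(** The constant function [1] is completely multiplicative and unimodular, so this replacement makes
    both properties hold at every sample point. *)
Definition modif n w : R[i] := if w \in good then f n w else 1.

Lemma modifE n w : good w -> modif n w = f n w.
Proof. by move=> gw; rewrite /modif mem_set. Qed.

Lemma measure_eq_mod_good (A B : set T) : measurable A -> measurable B ->
  (forall w, good w -> A w <-> B w) -> P A = P B.
Proof.
move=> mA mB AB.
have mg := measurable_good.
have h (C : set T) : measurable C -> P C = P (C `&` good).
  move=> mC; have := measureDI P mC mg; move=> /= ->.
  rewrite [X in (X + _)%E](_ : _ = 0%E) ?add0e//.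
  apply/eqP; rewrite eq_le measure_ge0 andbT -probability_good_setC.
  by apply: le_measure; rewrite ?inE; [exact: measurableD|exact: measurableC|move=> w []].
rewrite (h A)// (h B)//; congr (P _).
by apply/seteqP; split => w /= [/AB h1 gw]; split => //; exact/h1.
Qed.

Lemma Ex_eq_mod_good (X Y : T -> R) : bmeas X -> bmeas Y ->
  (forall w, good w -> X w = Y w) -> Ex P X = Ex P Y.
Proof.
move=> bX bY XY; apply/eqP; rewrite -subr_eq0 -ExB//.
have bXY : bmeas (fun w => X w - Y w) by exact: bmeasB.
have [M M0 hM] := bmeas_bound bXY.
have mg := measurableC measurable_good.
rewrite -normr_le0.
apply: (@le_trans _ _ (Ex P (fun w => M * \1_(~` good) w))).
  apply: norm_Ex_le => //; first by apply: bmeasZ; exact: bmeas_indic.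
  move=> w; rewrite indicE; have [gw|gw] := pselect (good w).
    by rewrite XY// subrr normr0 mulr_ge0 ?ler0n// ltW.
  by rewrite mem_set// mulr1.
rewrite ExZ; last exact: bmeas_indic.
have := Ex_indic P mg; rewrite probability_good_setC => -[->].
by rewrite mulr0.
Qed.

Let mmodif p : prime p -> measurable_fun [set: T] (@reim R \o modif p).
Proof.
move=> pp; have -> : @reim R \o modif p =
    fun w => if w \in good then (@reim R \o f p) w else reim 1.
  by apply/funext => w /=; rewrite /modif; case: ifP.
apply: measurable_fun_ifT => //; last exact: mf.
apply: (measurable_fun_bool true); rewrite setTI.
rewrite (_ : _ @^-1` [set true] = good); first exact: measurable_good.
by apply/seteqP; split => w /=; [exact: set_mem|exact: mem_set].
Qed.

Let nsq_prime p w : prime p -> nsq (modif p w) = 1.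
Proof.
move=> pp; rewrite /modif; case: ifPn => [|_].
  by rewrite inE => /(_ p I pp).
by rewrite /nsq/= expr1n expr0n addr0.
Qed.

Let modif1 w : modif 1 w = 1.
Proof. by rewrite /modif; case: ifP => // _; have [/(_ w) [-> _]] := hf. Qed.

Let modifM m n w : (0 < m)%N -> (0 < n)%N -> modif (m * n) w = modif m w * modif n w.
Proof.
move=> m0 n0; rewrite /modif; case: ifP => _; last by rewrite mulr1.
by have [/(_ w) [_ h] _ _] := hf; exact: h.
Qed.

Lemma complete_mult_ind (Q : nat -> Prop) : Q 1%N ->
  (forall p n, prime p -> (0 < n)%N -> Q n -> Q (p * n)%N) ->
  forall n, (0 < n)%N -> Q n.
Proof.
move=> Q1 QM; elim/ltn_ind => n IH n0.
have [n1|n1] := leqP n 1.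
  by have -> : n = 1%N by apply/eqP; rewrite eqn_leq n1.
have pd := pdiv_dvd n; have pp := pdiv_prime n1.
rewrite -(divnK pd) mulnC; apply: QM => //.
  by rewrite divn_gt0 ?prime_gt0// dvdn_leq.
apply: IH; first by rewrite ltn_Pdiv// prime_gt1.
by rewrite divn_gt0 ?prime_gt0// dvdn_leq.
Qed.

Let law p (h : R * R -> R) : prime p -> measurable_fun [set: R * R] h ->
  bmeas (fun w => h (reim (modif p w))) -> bmeas (fun t : measurableTypeR R => h (circle t)) ->
  Ex P (fun w => h (reim (modif p w))) = Ex (uniform_prob (@ltr01 R)) (fun t => h (circle t)).
Proof.
move=> pp mh b1 b2.
have mh' : measurable_fun [set: R * R] (EFin \o h) by exact/measurable_EFinP.
rewrite /Ex /Rintegral; congr fine.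
have := @integral_pushforward _ _ _ _ R _ (mmodif pp) P setT (EFin \o h) mh' (bmeas_integrable P b1) measurableT.
rewrite preimage_setT => /= <-.
have := @integral_pushforward _ _ (measurableTypeR R) _ R (@circle R) (@measurable_circle R) (uniform_prob (@ltr01 R)) setT (EFin \o h) mh' (bmeas_integrable (uniform_prob (@ltr01 R)) b2) measurableT.
rewrite preimage_setT => /= <-.
apply: eq_measure_integral; [exact: measurable_circle|exact: mmodif|move=> mc1 mc2 B mB BT].
have [_ hu _] := hf; have [_ hu'] := hu p pp; have e := hu' B mB.
transitivity (P ((@reim R \o f p) @^-1` B)); last exact: e.
rewrite -[LHS]/(P ((@reim R \o modif p) @^-1` B)); apply: measure_eq_mod_good.
- by have := mmodif pp measurableT mB; rewrite setTI.
- by have := mf pp measurableT mB; rewrite setTI.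
- by move=> w gw /=; rewrite modifE.
Qed.

Let cX a : forall h : R * R -> R, (h = fun z => complex.Re (cplx z ^+ a)) \/ (h = fun z => complex.Im (cplx z ^+ a)) ->
  measurable_fun [set: R * R] h.
Proof.
have : measurable_fun [set: R * R] (fun z : R * R => complex.Re (cplx z ^+ a)) /\
   measurable_fun [set: R * R] (fun z : R * R => complex.Im (cplx z ^+ a)).
  elim: a => [|a [h1 h2]].
    by split; under eq_fun do rewrite expr0; exact: measurable_cst.
  split; under eq_fun do rewrite exprS ?cReM ?cImM.
    by apply: measurable_funB; apply: measurable_funM => //=; [exact: measurable_fst|exact: measurable_snd].
  by apply: measurable_funD; apply: measurable_funM => //=; [exact: measurable_fst|exact: measurable_snd].
by move=> [h1 h2] h [->|->].
Qed.

Lemma nsq_bound (z : R[i]) : nsq z = 1 -> `|complex.Re z| <= 1 /\ `|complex.Im z| <= 1.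
Proof.
rewrite /nsq => h; have h1 := sqr_ge0 (complex.Re z); have h2 := sqr_ge0 (complex.Im z).
by split; rewrite -(ler_pXn2r (n := 2)) ?nnegrE ?normr_ge0// real_normK ?num_real// expr1n; lra.
Qed.

Let nsqX (z : R[i]) a : nsq z = 1 -> nsq (z ^+ a) = 1.
Proof.
move=> h; elim: a => [|a IH]; first by rewrite expr0 /nsq/= expr1n expr0n addr0.
by rewrite exprS nsqM h IH mulr1.
Qed.

(** Multiplicativity and modulus are checked pointwise. Laws and independence carry over from [f]
    because the events concerned agree on [good], whose complement is null. *)
Lemma modif_unimodular : unimodular_steinhaus P modif.
Proof.
have cpr (p : nat) w : cplx (reim (modif p w)) = modif p w by rewrite /cplx /reim; case: (modif p w).
have bRe p a : prime p -> bmeas (fun w => complex.Re (cplx (reim (modif p w)) ^+ a)).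
  move=> pp; split.
    by apply: (measurableT_comp (cX (a := a) (or_introl erefl)) (mmodif pp)).
  by exists 1 => w; rewrite cpr; have [] := nsq_bound (nsqX a (nsq_prime w pp)).
have bIm p a : prime p -> bmeas (fun w => complex.Im (cplx (reim (modif p w)) ^+ a)).
  move=> pp; split.
    by apply: (measurableT_comp (cX (a := a) (or_intror erefl)) (mmodif pp)).
  by exists 1 => w; rewrite cpr; have [] := nsq_bound (nsqX a (nsq_prime w pp)).
split.
- exact: modif1.
- exact: modifM.
- move=> n w; move: n; apply: complete_mult_ind.
    by rewrite modif1 /nsq/= expr1n expr0n addr0.
  by move=> p n pp n0 h; have -> := modifM w (prime_gt0 pp) n0; rewrite nsqM h nsq_prime// mulr1.
- exact: mmodif.
- move=> p a pp a0.
  rewrite (eq_Ex P (Y := fun w => complex.Re (cplx (reim (modif p w)) ^+ a))); last by move=> w; rewrite cpr.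
  rewrite (law pp (h := fun z => complex.Re (cplx z ^+ a)))//.
  + rewrite -[RHS](uniform_cos_eq0 (n := a) 0)//; apply: eq_Ex => t.
    by rewrite circleX/= addr0.
  + by apply: cX; left.
  + exact: bRe.
  + split; last by exists 1 => t; have [] := nsq_bound (nsqX a (circle_nsq t)).
    by apply: (measurableT_comp (cX (a := a) (or_introl erefl)) (@measurable_circle R)).
- move=> p a pp a0.
  rewrite (eq_Ex P (Y := fun w => complex.Im (cplx (reim (modif p w)) ^+ a))); last by move=> w; rewrite cpr.
  rewrite (law pp (h := fun z => complex.Im (cplx z ^+ a)))//.
  + rewrite -[RHS](uniform_cos_eq0 (n := a) (- (pi / 2)))//; apply: eq_Ex => t.
    by rewrite circleX/= cosBpihalf.
  + by apply: cX; right.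
  + exact: bIm.
  + split; last by exists 1 => t; have [] := nsq_bound (nsqX a (circle_nsq t)).
    by apply: (measurableT_comp (cX (a := a) (or_intror erefl)) (@measurable_circle R)).
- move=> J B JD mB; have [_ _ hi] := hf.
  have mi (g : nat -> T -> R[i]) : (forall p, prime p -> measurable_fun [set: T] (@reim R \o g p)) ->
      forall i, i \in J -> measurable ((@reim R \o g i) @^-1` B i).
    move=> mg i iJ; have := mg i (JD i iJ) measurableT (B i) (mB i iJ).
    by rewrite setTI.
  have -> : P (\bigcap_(i in [set` J]) (@reim R \o modif i) @^-1` B i) =
       P (\bigcap_(i in [set` J]) (@reim R \o f i) @^-1` B i).
    apply: measure_eq_mod_good.
    + by apply: fin_bigcap_measurable => // i iJ; exact: (mi _ mmodif).
    + by apply: fin_bigcap_measurable => // i iJ; exact: (mi _ mf).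
    + by move=> w gw; split => h i iJ; have := h i iJ; rewrite /= modifE.
  rewrite hi//; apply: eq_big_seq => i iJ; apply: measure_eq_mod_good.
  + exact: (mi _ mf).
  + exact: (mi _ mmodif).
  + by move=> w gw /=; rewrite modifE.
Qed.

End steinhaus_modification.

(** * Orthogonality to the past and orthonormality of the values *)

Section past.
Context (R : realType) (d : measure_display) (T : measurableType d).
Variables (P : probability T R) (f : nat -> T -> R[i]).
Hypothesis uf : unimodular_steinhaus P f.

Let X p : T -> R * R := @reim R \o f p.

(* A pi-system generating the sigma-algebra of the [f q] with [q < p]. *)
Definition pastG p : set (set T) := [set D | exists (J : {fset nat}) (B : nat -> set (R * R)),
  [/\ forall q, q \in J -> prime q && (q < p)%N, forall q, measurable (B q) &
      D = \bigcap_(q in [set` J]) X q @^-1` B q]].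

(** The same carrier [T] with a smaller sigma-algebra: being known before [p] becomes [bmeas] for a
    function on [pastT p]. *)
Definition pastT p := g_sigma_algebraType (pastG p).

Let mX p B : prime p -> measurable B -> measurable (X p @^-1` B).
Proof. by move=> pp mB; have := us_meas uf pp measurableT mB; rewrite setTI. Qed.

Lemma pastG_measurable p : pastG p `<=` measurable.
Proof.
move=> D [J [B [hJ mB ->]]]; apply: fin_bigcap_measurable => // q qJ.
by apply: mX => //; have /andP[] := hJ q qJ.
Qed.

Lemma past_measurable p : (@measurable _ (pastT p)) `<=` (@measurable _ T).
Proof.
apply: smallest_sub; first exact: sigma_algebra_measurable.
exact: pastG_measurable.
Qed.

Lemma pastG_setI p : setI_closed (pastG p).
Proof.
move=> A B [J [BJ [hJ mJ ->]]] [K [BK [hK mK ->]]].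
exists (J `|` K)%fset, (fun q => (if q \in J then BJ q else setT) `&` (if q \in K then BK q else setT)).
split.
- by move=> q; rewrite inE => /orP[/hJ|/hK].
- by move=> q; apply: measurableI; case: ifP.
apply/seteqP; split => w.
  move=> [h1 h2] q /=; rewrite inE => _; split; case: ifP => //= h; [exact: h1|exact: h2].
move=> h; split => q /= qJ.
  by have := h q; rewrite /= inE qJ /= => /(_ isT) [].
by have := h q; rewrite /= inE qJ orbT => /(_ isT) [_].
Qed.

Lemma bmeas_past p (G : pastT p -> R) : bmeas G -> bmeas (G : T -> R).
Proof.
move=> [mG bG]; split => // _ B mB; rewrite setTI.
by apply: (@past_measurable p); have := mG measurableT B mB; rewrite setTI => h; exact: h.
Qed.

Section orth.
Variables (p : nat) (h : R * R -> R).
Hypotheses (pp : prime p) (mh : measurable_fun [set: R * R] h)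
  (bh : bmeas (fun w => h (X p w))) (h0 : Ex P (fun w => h (X p w)) = 0).
Let u w := h (X p w).

(** [D] constrains finitely many [f q] with [q < p]; adding the index [p] gives a family to which
    mutual independence applies. Hence the centred indicator of [D] is orthogonal to every indicator
    of an event in [u], so to [u] itself, and [u] has mean zero. *)
Let orth_pi D : pastG p D -> Ex P (fun w => u w * \1_D w) = 0.
Proof.
move=> GD; have mD := pastG_measurable GD.
have bD : bmeas (\1_D : T -> R) by exact: bmeas_indic.
pose c := Ex P \1_D.
have bDc : bmeas (fun w => \1_D w - c) by apply: bmeasB => //; exact: bmeas_cst.
have : Ex P (fun w => (\1_D w - c) * u w) = 0.
  apply: Ex_mul_eq0 => // B mB.
  have mhB : measurable (h @^-1` B) by have := mh measurableT mB; rewrite setTI.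
  have mu : measurable (u @^-1` B).
    by rewrite (_ : u @^-1` B = X p @^-1` (h @^-1` B))//; exact: mX.
  have bu : bmeas (\1_(u @^-1` B) : T -> R) by exact: bmeas_indic.
  rewrite (eq_Ex P (Y := fun w => \1_(D `&` u @^-1` B) w - c * \1_(u @^-1` B) w)); last first.
    by move=> w; rewrite mulrBl indicI.
  rewrite ExB; [|by apply: bmeas_indic; exact: measurableI|exact: bmeasZ].
  rewrite ExZ// (_ : Ex P \1_(D `&` u @^-1` B) = c * Ex P \1_(u @^-1` B)) ?subrr//.
  have [J [BJ [hJ mJ DE]]] := GD.
  have pJ : p \notin J by apply/negP => /hJ; rewrite ltnn andbF.
  (* The event that [u] lies in [B] is a constraint on [f p], namely by the preimage of [B] under
     [h]; it occupies slot [p], which is not in [J]. *)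
  pose B' q := if q == p then h @^-1` B else BJ q.
  have mB' q : measurable (B' q) by rewrite /B'; case: ifP.
  have := @us_indep _ _ _ _ _ uf (p |` J)%fset B' => /(_ _ _) ind.
  apply/EFin_inj; rewrite EFinM /c !Ex_indic//; last exact: measurableI.
  have -> : D `&` u @^-1` B = \bigcap_(i in [set` (p |` J)%fset]) (@reim R \o f i) @^-1` B' i.
    rewrite DE; apply/seteqP; split => w.
      move=> [h1 h2] q /=; rewrite !inE => /orP[/eqP->|qJ].
        by rewrite /B' eqxx.
      rewrite /B'; case: eqP => [qp|_]; first by rewrite -qp qJ in pJ.
      exact: h1.
    move=> hh; split.
      move=> q /= qJ; have := hh q; rewrite /= !inE qJ orbT => /(_ isT).
      by rewrite /B'; case: eqP => [qp|//]; rewrite -qp qJ in pJ.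
    by have := hh p; rewrite /= !inE eqxx => /(_ isT); rewrite /B' eqxx.
  rewrite ind; last 2 first.
  - by move=> q /=; rewrite !inE => /orP[/eqP->//|/hJ /andP[]].
  - by move=> q _.
  rewrite big_fsetU1//= {1}/B' eqxx muleC; congr (_ * _)%E.
  rewrite DE; have := @us_indep _ _ _ _ _ uf J BJ => -> //.
  - apply: eq_big_seq => q qJ; rewrite /B'; case: eqP => [qp|//].
    by rewrite -qp qJ in pJ.
  - by move=> q /hJ /andP[].
rewrite (eq_Ex P (Y := fun w => u w * \1_D w - c * u w)); last by move=> w; ring.
rewrite ExB; [|exact: bmeasM|exact: bmeasZ].
by rewrite ExZ// h0 mulr0 subr0.
Qed.

(** The sets whose indicator is orthogonal to [u] form a Dynkin system containing the generating
    pi-system. For disjoint unions the expectation is read as an integral over the set, which is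
    countably additive. *)
Let orth_set D : (@measurable _ (pastT p)) D -> Ex P (fun w => u w * \1_D w) = 0.
Proof.
have key (S : set T) : measurable S ->
    ((\int[P]_(x in S) (u x)%:E)%E = 0%E <-> Ex P (fun w => u w * \1_S w) = 0).
  move=> mS; have bu : bmeas (fun w => u w * \1_S w) by apply: bmeasM => //; exact: bmeas_indic.
  have -> : (\int[P]_(x in S) (u x)%:E)%E = (Ex P (fun w => u w * \1_S w))%:E.
    rewrite -expectationE// unlock integral_mkcond; apply: eq_integral => w _.
    by rewrite patchE indicE; case: ifP => _; rewrite ?mulr1 ?mulr0.
  by split => [[]|->].
move=> mD; apply: (@dynkin_induction _ (pastT p) (pastG p)
  (fun S => Ex P (fun w => u w * \1_S w) = 0)) => //.
- exact: pastG_setI.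
- rewrite -[RHS]h0; apply: eq_Ex => w; by rewrite indicT mulr1.
- move=> S mS hS; have mS' := past_measurable mS.
  rewrite (eq_Ex P (Y := fun w => u w - u w * \1_S w)); last first.
    move=> w; rewrite !indicE in_setC; case: (w \in S) => /=; rewrite ?mulr1 ?mulr0 ?subrr ?subr0//.
  rewrite ExB//; last by apply: bmeasM => //; exact: bmeas_indic.
  by rewrite h0 hS subrr.
- move=> F mF tF hF; have mF' n := past_measurable (mF n).
  apply/key; first exact: bigcupT_measurable.
  rewrite integral_bigcup//.
    by apply: eseries0 => n _ _; apply/key.
  apply: (@integrableS _ _ _ _ setT) => //; first exact: bigcupT_measurable.
  exact: bmeas_integrable.
Qed.

(** This is the statement that [u] has conditional expectation zero given the past, tested against
    bounded past-measurable functions. *)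
Lemma Ex_past_mul_eq0 (G : pastT p -> R) : bmeas G -> Ex P (fun w => u w * G w) = 0.
Proof.
move=> bG; apply: Ex_mul_eq0 => //; first exact: bmeas_past.
move=> B mB; apply: orth_set; have [mG _] := bG.
by have := mG measurableT B mB; rewrite setTI.
Qed.

End orth.

Lemma cbmeas_prime p : prime p -> cbmeas (f p).
Proof.
move=> pp; have /measurable_fun_pairP[m1 m2] := us_meas uf pp.
split; split => //; exists 1 => w; have [] := nsq_bound (us_nsq uf w (prime_gt0 pp)) => //.
Qed.

Lemma cbmeas_us n : (0 < n)%N -> cbmeas (f n).
Proof.
move: n; apply: complete_mult_ind.
  by rewrite (_ : f 1%N = fun=> 1); [exact: cbmeas_cst|apply/funext => w; exact: us1 uf w].
move=> p n pp n0 h; rewrite (_ : f (p * n)%N = fun w => f p w * f n w).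
  by apply: cbmeasM => //; exact: cbmeas_prime.
by apply/funext => w; apply: usM uf _ _ _ _ n0; exact: prime_gt0.
Qed.

Lemma cbmeas_past_prime p q : prime q -> (q < p)%N -> cbmeas (f q : pastT p -> R[i]).
Proof.
move=> pq qp.
have m : measurable_fun [set: pastT p] (@reim R \o f q).
  move=> _ B mB; rewrite setTI; apply: sub_sigma_algebra.
  exists [fset q]%fset, (fun=> B); split => //.
    by move=> r; rewrite inE => /eqP->; rewrite pq qp.
  apply/seteqP; split => w /=.
    by move=> h r /=; rewrite inE => /eqP->.
  by move=> /(_ q); apply; rewrite /= inE.
have /measurable_fun_pairP[m1 m2] := m.
split; split => //; exists 1 => w; have [] := nsq_bound (us_nsq uf w (prime_gt0 pq)) => //.
Qed.

Lemma cbmeas_past p n : (0 < n)%N -> (forall q, prime q -> (q %| n)%N -> (q < p)%N) ->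
  cbmeas (f n : pastT p -> R[i]).
Proof.
move: n; apply: complete_mult_ind.
  move=> _; rewrite (_ : f 1%N = fun=> 1); first exact: cbmeas_cst.
  by apply/funext => w; exact: us1 uf w.
move=> q n pq n0 h hq; rewrite (_ : f (q * n)%N = fun w => f q w * f n w).
  apply: (@cbmeasM _ _ (pastT p)).
    by apply: cbmeas_past_prime => //; apply: hq => //; exact: dvdn_mulr.
  by apply: h => r pr rn; apply: hq => //; exact: dvdn_mull.
by apply/funext => w; apply: usM uf _ _ _ _ n0; exact: prime_gt0.
Qed.

Lemma us_exp p a w : prime p -> f (p ^ a)%N w = f p w ^+ a.
Proof.
move=> pp; elim: a => [|a IH]; first by rewrite expn0 expr0; exact: us1 uf w.
by rewrite expnS (usM uf)// ?expn_gt0 ?prime_gt0// IH exprS.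
Qed.

Let measX p a : prime p ->
  measurable_fun [set: R * R] (fun z : R * R => complex.Re (cplx z ^+ a)) /\
  measurable_fun [set: R * R] (fun z : R * R => complex.Im (cplx z ^+ a)).
Proof.
move=> _; elim: a => [|a [h1 h2]].
  by split; under eq_fun do rewrite expr0; exact: measurable_cst.
split; under eq_fun do rewrite exprS ?cReM ?cImM.
  by apply: measurable_funB; apply: measurable_funM => //=; [exact: measurable_fst|exact: measurable_snd].
by apply: measurable_funD; apply: measurable_funM => //=; [exact: measurable_fst|exact: measurable_snd].
Qed.

(* [n] is [p]-maximal: [f n = f p ^+ a * f m] with [a > 0] and [f m] in the past of [p]. *)
Lemma us_martingale p n (z : pastT p -> R[i]) : prime p -> (0 < n)%N -> (p %| n)%N ->
  (forall q, prime q -> (q %| n)%N -> (q <= p)%N) -> cbmeas z ->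
  Ex P (fun w => complex.Re (f n w * z w)) = 0.
Proof.
move=> pp n0 pn hn cz.
have [m cpm nE] := pfactor_coprime pp n0.
set a := logn p n in nE.
have a0 : (0 < a)%N by rewrite logn_gt0 mem_primes pp n0.
have m0 : (0 < m)%N by rewrite lt0n; apply/eqP => m0; move: n0; rewrite nE m0.
have hm q : prime q -> (q %| m)%N -> (q < p)%N.
  move=> pq qm; rewrite ltn_neqAle hn ?andbT//; last by rewrite nE dvdn_mulr.
  by apply/eqP => qp; move: cpm; rewrite prime_coprime// -qp qm.
have cm : cbmeas (fun w : pastT p => f m w * z w) by apply: (@cbmeasM _ _ (pastT p)) => //; exact: cbmeas_past.
have [bR bI] := cm.
have fnE w : f n w = f p w ^+ a * f m w.
  by rewrite {1}nE (usM uf)// ?expn_gt0 ?prime_gt0// us_exp// mulrC.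
rewrite (eq_Ex P (Y := fun w => complex.Re (f p w ^+ a) * complex.Re (f m w * z w)
   - complex.Im (f p w ^+ a) * complex.Im (f m w * z w))); last first.
  by move=> w; rewrite fnE -mulrA cReM.
have [c1 c2] : cbmeas (fun w => f p w ^+ a) by apply: cbmeasX; exact: cbmeas_prime.
have [m1 m2] := measX a pp.
have cpr w : cplx (X p w) = f p w by rewrite /cplx /X /reim/=; case: (f p w).
rewrite ExB; [|by apply: bmeasM => //; exact: bmeas_past bR|by apply: bmeasM => //; exact: bmeas_past bI].
rewrite (eq_Ex P (Y := fun w => complex.Re (cplx (X p w) ^+ a) * complex.Re (f m w * z w))); last by move=> w; rewrite cpr.
rewrite (eq_Ex P (X := fun w => complex.Im (f p w ^+ a) * _) (Y := fun w => complex.Im (cplx (X p w) ^+ a) * complex.Im (f m w * z w))); last by move=> w; rewrite cpr.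
rewrite (Ex_past_mul_eq0 pp m1 _ _ bR); last 2 first.
- by under eq_fun do rewrite cpr.
- by under eq_Ex do rewrite cpr; exact: us_Re uf _ _ pp a0.
rewrite (Ex_past_mul_eq0 pp m2 _ _ bI) ?subrr//.
- by under eq_fun do rewrite cpr.
- by under eq_Ex do rewrite cpr; exact: us_Im uf _ _ pp a0.
Qed.

Lemma us_nsq_mul n w : (0 < n)%N -> f n w * conjc (f n w) = 1.
Proof. by move=> n0; rewrite -nsqE (us_nsq uf w n0). Qed.

(** The largest prime [p] of [m n] divides [m], hence not [n] by coprimality: [f m] carries a
    positive power of [f p] while [f n] lies in the past of [p]. The disjunction ensures [m n > 1],
    so that [p] is prime. *)
Let orth_coprime m n : (0 < m)%N -> (0 < n)%N -> coprime m n -> (n < m)%N \/ (m < n)%N ->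
  (max_pdiv (m * n) %| m)%N -> Ex P (fun w => complex.Re (f m w * conjc (f n w))) = 0.
Proof.
move=> m0 n0 cmn mn pm; set p := max_pdiv _ in pm.
have mn1 : (1 < m * n)%N by nia.
have pp : prime p by exact: max_pdiv_prime.
have hle q : prime q -> (q %| m * n)%N -> (q <= p)%N.
  by move=> pq qmn; apply: max_pdiv_max; rewrite mem_primes pq qmn muln_gt0 m0 n0.
apply: (us_martingale (p := p)) => //.
  by move=> q pq qm; apply: hle => //; exact: dvdn_mulr.
apply: (@cbmeas_conjc _ _ (pastT p)); apply: cbmeas_past => // q pq qn.
rewrite ltn_neqAle hle ?andbT//; last exact: dvdn_mull.
apply/eqP => qp; have : (q %| gcdn m n)%N by rewrite dvdn_gcd qn qp pm.
by rewrite (eqP cmn) dvdn1 => /eqP q1; rewrite q1 in pq.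
Qed.

(** Unimodularity cancels the common factor [f (gcdn m n)], which reduces to coprime arguments. The
    largest prime of their product divides one of them, and conjugation exchanges the two cases. *)
Lemma us_orthonormal m n : (0 < m)%N -> (0 < n)%N ->
  Ex P (fun w => complex.Re (f m w * conjc (f n w))) = (m == n)%:R.
Proof.
move=> m0 n0; case: eqVneq => [->|mn].
  by rewrite -[RHS](Ex_cst P); apply: eq_Ex => w; rewrite us_nsq_mul.
pose g := gcdn m n; have g0 : (0 < g)%N by rewrite gcdn_gt0 m0.
have gm : (g %| m)%N := dvdn_gcdl m n; have gn : (g %| n)%N := dvdn_gcdr m n.
pose m' := (m %/ g)%N; pose n' := (n %/ g)%N.
have mE : m = (m' * g)%N by rewrite divnK.
have nE : n = (n' * g)%N by rewrite divnK.
have m'0 : (0 < m')%N by rewrite divn_gt0// dvdn_leq.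
have n'0 : (0 < n')%N by rewrite divn_gt0// dvdn_leq.
have cmn : coprime m' n'.
  by rewrite /coprime -(eqn_pmul2r g0) mul1n muln_gcdl -mE -nE.
have mn' : m' != n' by apply: contraNneq mn => e; rewrite mE nE e.
have red w : f m w * conjc (f n w) = f m' w * conjc (f n' w).
  rewrite mE nE !(usM uf)// rmorphM/=.
  rewrite [LHS](_ : _ = f m' w * conjc (f n' w) * (f g w * conjc (f g w))); last by ring.
  by rewrite us_nsq_mul// mulr1.
rewrite (eq_Ex P (Y := fun w => complex.Re (f m' w * conjc (f n' w)))); last by move=> w; rewrite red.
have lt : (n' < m')%N \/ (m' < n')%N by case: (ltngtP n' m') mn' => // [?|?] _; [left|right].
have mn1 : (1 < m' * n')%N by nia.
have := max_pdiv_dvd (m' * n'); rewrite Euclid_dvdM ?max_pdiv_prime// => /orP[h|h].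
  exact: orth_coprime.
rewrite (eq_Ex P (Y := fun w => complex.Re (f n' w * conjc (f m' w)))); last first.
  by move=> w; rewrite !cReM !cRe_conjc !cIm_conjc; ring.
apply: orth_coprime => //; first by rewrite coprime_sym.
  by case: lt; [right|left].
by rewrite mulnC.
Qed.

End past.

(** * Taylor bounds for one step of the martingale argument *)

Section trig_bounds.
Context (R : realType).
Implicit Types x y u s : R.

Lemma le_norm_sin x : `|sin x| <= `|x|.
Proof.
wlog x0 : x / 0 <= x => [h|].
  have [/h//|/ltW x0] := leP 0 x.
  by rewrite -normrN -sinN -(normrN x) h// oppr_ge0.
have [c _ hc] := MVT_segment (f := @sin R) (df := @cos R) x0
  (fun y _ => is_derive_sin y) (continuous_subspaceT (@continuous_sin R)).
move: hc; rewrite sin0 !subr0 => ->.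
by rewrite normrM ler_piMl// cos_max.
Qed.

Lemma oneBcosE x : 1 - cos x = 2 * sin (x / 2) ^+ 2.
Proof.
rewrite [in LHS](_ : x = x / 2 *+ 2); last by rewrite mulr2n -splitr.
by rewrite cos_mulr2n cos2sin2; ring.
Qed.

Lemma norm_cosB1_le x : `|cos x - 1| <= x ^+ 2 / 2.
Proof.
rewrite distrC oneBcosE ger0_norm; last by rewrite mulr_ge0// sqr_ge0.
have : `|sin (x / 2)| ^+ 2 <= `|x / 2| ^+ 2.
  by rewrite ler_pXn2r ?nnegrE ?normr_ge0// le_norm_sin.
by rewrite !real_normK ?num_real//; lra.
Qed.

Lemma norm_sinB_le x : `|sin x - x| <= `|x| ^+ 3 / 2.
Proof.
wlog x0 : x / 0 <= x => [h|].
  have [/h//|/ltW x0] := leP 0 x.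
  have := h (- x); rewrite oppr_ge0 => /(_ x0).
  by rewrite sinN -opprD !normrN.
have h y : y \in `]0, x[%R -> is_derive y 1 (fun y : R => sin y - y) (cos y - 1).
  by move=> _; apply: is_deriveB.
have ch : {within `[0, x], continuous (fun y : R => sin y - y)}.
  apply: continuous_subspaceT => y.
  by apply: (@continuousB _ R^o _ _ _ _ (@continuous_sin R y)); exact: cvg_id.
have [c] := MVT_segment x0 h ch.
rewrite in_itv/= => /andP[c0 cx]; rewrite sin0 !subr0 => ->.
rewrite normrM [X in _ * X]ger0_norm// (ger0_norm x0) exprSr.
rewrite [X in _ <= X]mulrAC ler_wpM2r//.
rewrite (le_trans (norm_cosB1_le c))//.
by rewrite ler_pM2r ?invr_gt0// ler_pXn2r.
Qed.

(** With [1 - cos x = 2 sin(x / 2)^2] the remainder is a difference of two squares: one factor is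
    cubic in [x] by [norm_sinB_le], the other linear. *)
Lemma norm_cos_taylor2_le x : `|cos x - 1 + x ^+ 2 / 2| <= x ^+ 4 / 4.
Proof.
have -> : cos x - 1 + x ^+ 2 / 2 =
    - (2 * (sin (x / 2) - x / 2) * (sin (x / 2) + x / 2)).
  have := oneBcosE x; set a := sin _; set b := cos _; nra.
rewrite normrN normrM normrM ger0_norm//.
have h1 := norm_sinB_le (x / 2); have h2 := le_norm_sin (x / 2).
have h3 := ler_normD (sin (x / 2)) (x / 2).
have h4 : `|x / 2| = `|x| / 2 by rewrite normrM [X in _ * X]gtr0_norm ?invr_gt0.
rewrite h4 in h1 h2 h3.
have -> : x ^+ 4 = `|x| ^+ 4 by rewrite -normrX ger0_norm// exprn_even_ge0.
set a := `|sin _ - _| in h1 *; set b := `|sin _ + _| in h3 *.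
set c := `|sin (x / 2)| in h2 h3; set y := `|x| in h1 h2 h3 *.
have y0 : 0 <= y by rewrite normr_ge0.
have a0 : 0 <= a by rewrite normr_ge0.
have h5 : b <= y by lra.
apply: (@le_trans _ _ (2 * (y ^+ 3 / 16) * y)).
  have h6 : a <= y ^+ 3 / 16 by apply: le_trans h1 _; rewrite !exprS expr0; lra.
  by rewrite ler_pM// ?mulr_ge0 ?normr_ge0// ler_pM2l.
have : 0 <= y ^+ 4 by rewrite exprn_ge0.
by rewrite !exprS expr0; lra.
Qed.

Lemma expRB1_le u : 0 <= u -> 0 <= expR u - 1 <= u * expR u.
Proof.
move=> u0; apply/andP; split; first by rewrite subr_ge0 -expR0 ler_expR.
have := expR_ge1Dx (- u); rewrite expRN => h.
have e0 := expR_gt0 u.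
have : (1 - u) * expR u <= 1.
  by rewrite -ler_pdivlMr// div1r.
by lra.
Qed.

Lemma expR_taylor1_le u : 0 <= u -> 0 <= expR u - 1 - u <= u ^+ 2 * expR u.
Proof.
move=> u0; have := expR_ge1Dx u => h.
have /andP[h1 h2] := expRB1_le u0.
apply/andP; split; first by lra.
have h3 : u * (expR u - 1) <= u * (u * expR u) by rewrite ler_wpM2l.
by rewrite expr2 -mulrA; lra.
Qed.

(** One step of the compensated cosine. The term [x * sin s] is isolated because orthogonality will
    remove it. The second-order terms would cancel for [u = x^2 / 2]; truncation only gives
    [u <= x^2 / 2], and the nonnegative defect is kept exactly since it will telescope. *)
Lemma cos_expR_step (s x u C : R) : 0 <= u -> u <= x ^+ 2 / 2 -> expR u <= C ->
  `|cos (s + x) * expR u - cos s + x * sin s|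
    <= (x ^+ 2 / 2 - u) + C * (x ^+ 4 + `|x| ^+ 3).
Proof.
move=> u0 ux uC.
have C1 : 1 <= C by rewrite (le_trans _ uC)// -expR0 ler_expR.
have -> : cos (s + x) * expR u - cos s + x * sin s =
  cos s * (cos x * expR u - 1) - sin s * (sin x * expR u - x).
  by rewrite cosD; ring.
have /andP[e1 e2] := expRB1_le u0; have /andP[e3 e4] := expR_taylor1_le u0.
have hc : `|cos x * expR u - 1| <= (x ^+ 2 / 2 - u) + C * x ^+ 4.
  have -> : cos x * expR u - 1 = (cos x - 1 + x ^+ 2 / 2) + (expR u - 1 - u)
     + (u - x ^+ 2 / 2) + (cos x - 1) * (expR u - 1) by ring.
  apply: le_trans (ler_normD _ _) _.
  apply: le_trans (lerD (ler_normD _ _) (lexx _)) _.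
  apply: le_trans (lerD (lerD (ler_normD _ _) (lexx _)) (lexx _)) _.
  rewrite (ger0_norm e3) (@ler0_norm _ (u - _)) ?subr_le0// opprB normrM (ger0_norm e1).
  have h1 := norm_cos_taylor2_le x; have h2 := norm_cosB1_le x.
  have h3 : expR u - 1 - u <= C * (x ^+ 4 / 4).
    apply: le_trans e4 _; rewrite mulrC ler_pM ?expR_ge0 ?sqr_ge0//.
    rewrite (_ : x ^+ 4 / 4 = (x ^+ 2 / 2) ^+ 2); last by field.
    by rewrite ler_pXn2r// nnegrE// (le_trans u0).
  have h4 : `|cos x - 1| * (expR u - 1) <= C * (x ^+ 4 / 4).
    have -> : C * (x ^+ 4 / 4) = (x ^+ 2 / 2) * (x ^+ 2 / 2 * C) by field.
    apply: ler_pM => //; apply: le_trans e2 _.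
    by rewrite ler_pM ?expR_ge0.
  have h5 : x ^+ 4 / 4 <= C * (x ^+ 4 / 4).
    by rewrite ler_peMl// divr_ge0// exprn_even_ge0.
  have h6 : 0 <= C * x ^+ 4 by apply: mulr_ge0; [lra|exact: exprn_even_ge0].
  by lra.
have hs : `|sin x * expR u - x| <= C * `|x| ^+ 3.
  have -> : sin x * expR u - x = (sin x - x) + sin x * (expR u - 1) by ring.
  apply: le_trans (ler_normD _ _) _; rewrite normrM (ger0_norm e1).
  have h1 := norm_sinB_le x; have h2 := le_norm_sin x.
  have h3 : `|sin x| * (expR u - 1) <= C * (`|x| ^+ 3 / 2).
    have -> : C * (`|x| ^+ 3 / 2) = `|x| * (`|x| ^+ 2 / 2 * C) by field.
    apply: ler_pM => //; apply: le_trans e2 _.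
    by rewrite real_normK ?num_real// ler_pM ?expR_ge0.
  have h5 : `|x| ^+ 3 / 2 <= C * (`|x| ^+ 3 / 2).
    by rewrite ler_peMl// divr_ge0// exprn_ge0.
  by lra.
apply: le_trans (ler_normB _ _) _; rewrite !normrM.
have g1 : `|cos s| * `|cos x * expR u - 1| <= `|cos x * expR u - 1|.
  by rewrite ler_piMl// cos_max.
have g2 : `|sin s| * `|sin x * expR u - x| <= `|sin x * expR u - x|.
  by rewrite ler_piMl// sin_max.
by lra.
Qed.

(** Third moments are thereby traded for second and fourth moments, the only ones computable by
    counting quadruples. *)
Lemma le_cube_am (x t : R) : 0 < t -> `|x| ^+ 3 <= t * x ^+ 2 + x ^+ 4 / t.
Proof.
move=> t0; have -> : `|x| ^+ 3 = x ^+ 2 * `|x|.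
  by rewrite exprSr real_normK ?num_real.
have -> : t * x ^+ 2 + x ^+ 4 / t = x ^+ 2 * (t + `|x| ^+ 2 / t).
  by rewrite real_normK ?num_real//; field; rewrite gt_eqF.
rewrite ler_wpM2l ?sqr_ge0//; set y := `|x|.
have y0 : 0 <= y by rewrite normr_ge0.
have [xt|tx] := leP y t.
  by rewrite (le_trans xt)// lerDl mulr_ge0 ?sqr_ge0// invr_ge0 ltW.
rewrite (@le_trans _ _ (y ^+ 2 / t))//; last by rewrite lerDr ltW.
by rewrite ler_pdivlMr// expr2 ler_wpM2l// ltW.
Qed.

Lemma norm_expRB_le (a b c : R) : a <= c -> b <= c ->
  `|expR a - expR b| <= expR c * `|a - b|.
Proof.
wlog ab : a b / b <= a => [h|ac bc].
  by have [|/ltW] := leP b a; [exact: h|move=> ba ac bc; rewrite (distrC a) (distrC (expR a)); exact: h].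
have u0 : 0 <= a - b by rewrite subr_ge0.
rewrite (ger0_norm u0) ger0_norm ?subr_ge0 ?ler_expR//.
have /andP[_ h] := expRB1_le u0.
have -> : expR a = expR b * expR (a - b) by rewrite -expRD addrC subrK.
have : expR b * (expR (a - b) - 1) <= expR b * ((a - b) * expR (a - b)).
  by rewrite ler_pM2l ?expR_gt0.
rewrite mulrBr mulr1 => /le_trans; apply.
rewrite mulrCA -expRD (addrC b) subrK mulrC ler_wpM2r//.
by rewrite ler_expR.
Qed.

(** The final bookkeeping of [mcleish_bound], where [a] and [b] are [q / t] and [z / t]. *)
Lemma step_sum_le (v t a b : R) : 0 <= v -> 0 <= t -> 0 <= a -> 0 <= b ->
  b / 2 + (t * (v + 1) + b + 2 * a) + (t + b) <= (2 * v + 5) * (t + (a + b)).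
Proof.
move=> v0 t0 a0 b0.
have vt : 0 <= v * t by rewrite mulr_ge0.
have va : 0 <= v * a by rewrite mulr_ge0.
have vb : 0 <= v * b by rewrite mulr_ge0.
lra.
Qed.

End trig_bounds.

(** * A quantitative martingale central limit theorem after McLeish *)

Section mcleish.
Context (R : realType) (d : measure_display) (T : measurableType d).
Variables (P : probability T R) (n : nat) (X : nat -> T -> R) (v phi t : R).
Hypotheses (bX : forall k, bmeas (X k)) (v0 : 0 <= v) (t0 : 0 < t) (t1 : t <= 1).

Let S k w := \sum_(j < k) X j w.
Let V k w := \sum_(j < k) X j w ^+ 2.
(** The cap bounds the weight [exp(H / 2)] by the constant [C]. It sits at [v + 1] rather than [v],
    so that it acts only where [V - v > 1], where [V - v] is at most its own square. *)
Let H k w : R := Num.min (V k w) (v + 1).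
Let D k w := cos (S k w + phi) * expR (H k w / 2).
Let C := expR ((v + 1) / 2).
Let q := \sum_(k < n) Ex P (fun w => X k w ^+ 4).
Let z := Ex P (fun w => (V n w - v) ^+ 2).

(** The only trace of the martingale property: [X k] is orthogonal to the first-order term of the
    step, a function of the [X j] with [j < k]. *)
Hypothesis orth : forall k, (k < n)%N ->
  Ex P (fun w => X k w * (sin (\sum_(j < k) X j w + phi) *
     expR (Num.min (\sum_(j < k) X j w ^+ 2) (v + 1) / 2))) = 0.

Let bS k : bmeas (S k). Proof. by apply: bmeas_sum => j _. Qed.
Let bV k : bmeas (V k). Proof. by apply: bmeas_sum => j _; exact: bmeasX. Qed.
Let bH k : bmeas (H k). Proof. by apply: bmeas_min => //; exact: bmeas_cst. Qed.
Let bEH k : bmeas (fun w => expR (H k w / 2)).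
Proof.
apply: bmeas_expR; rewrite (_ : (fun w => _) = fun w => 2^-1 * H k w).
  exact: bmeasZ.
by apply/funext => w; rewrite mulrC.
Qed.
Let mSphi k : measurable_fun [set: T] (fun w => S k w + phi).
Proof. by apply: measurable_funD; [case: (bS k)|exact: measurable_cst]. Qed.
Let bD k : bmeas (D k).
Proof. by apply: bmeasM => //; exact: bmeas_cos. Qed.

Let C1 : 1 <= C. Proof. by rewrite -expR0 ler_expR divr_ge0// addr_ge0. Qed.

Let HS k w : 0 <= H k.+1 w - H k w <= X k w ^+ 2.
Proof.
rewrite /H /V big_ord_recr/= -/(V k w).
have h : 0 <= X k w ^+ 2 by exact: sqr_ge0.
by apply/andP; split; rewrite !minEle; do 2![case: ifPn; rewrite -?ltNge => ?]; lra.
Qed.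

Let HC k w : expR (H k w / 2) <= C.
Proof. by rewrite ler_expR ler_pM2r ?invr_gt0// ge_min lexx orbT. Qed.

Let step k : (k < n)%N -> `|Ex P (D k.+1) - Ex P (D k)| <=
  C * ((Ex P (fun w => X k w ^+ 2) - (Ex P (H k.+1) - Ex P (H k))) / 2
       + C * (t * Ex P (fun w => X k w ^+ 2) + (2 / t) * Ex P (fun w => X k w ^+ 4))).
Proof.
move=> kn; have := orth kn; rewrite -/(V k _) => o.
have bO : bmeas (fun w => X k w * (sin (S k w + phi) * expR (H k w / 2))).
  by apply: bmeasM => //; apply: bmeasM => //; exact: bmeas_sin.
(* By [orth] the first-order term is added at no cost, which leaves the expression bounded by
   [cos_expR_step]. *)
have -> : Ex P (D k.+1) - Ex P (D k) = Ex P (fun w => D k.+1 w - D k w +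
    X k w * (sin (S k w + phi) * expR (H k w / 2))).
  by rewrite ExD ?o ?addr0 ?ExB//; exact: bmeasB.
have b2 : bmeas (fun w => X k w ^+ 2) by exact: bmeasX.
have b4 : bmeas (fun w => X k w ^+ 4) by exact: bmeasX.
have -> : C * ((Ex P (fun w => X k w ^+ 2) - (Ex P (H k.+1) - Ex P (H k))) / 2
       + C * (t * Ex P (fun w => X k w ^+ 2) + (2 / t) * Ex P (fun w => X k w ^+ 4)))
  = Ex P (fun w => C * (2^-1 * (X k w ^+ 2 - (H k.+1 w - H k w))
       + C * (t * X k w ^+ 2 + (2 / t) * X k w ^+ 4))).
  rewrite ExZ; last first.
    apply: bmeasD; first by apply: bmeasZ; apply: bmeasB => //; exact: bmeasB.
    by apply: bmeasZ; apply: bmeasD; exact: bmeasZ.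
  rewrite ExD; last 2 first.
  - by apply: bmeasZ; apply: bmeasB => //; exact: bmeasB.
  - by apply: bmeasZ; apply: bmeasD; exact: bmeasZ.
  rewrite (ExZ P 2^-1); last by apply: bmeasB => //; exact: bmeasB.
  rewrite ExB//; last exact: bmeasB.
  rewrite ExB// (ExZ P C); last by apply: bmeasD; exact: bmeasZ.
  rewrite ExD; [|exact: bmeasZ..].
  by rewrite (ExZ P t)// (ExZ P (2 / t))// [2^-1 * _]mulrC.
apply: norm_Ex_le.
- by apply: bmeasD => //; exact: bmeasB.
- apply: bmeasZ; apply: bmeasD; first by apply: bmeasZ; apply: bmeasB => //; exact: bmeasB.
  by apply: bmeasZ; apply: bmeasD; exact: bmeasZ.
move=> w; have /andP[d0 d1] := HS k w.
set x := X k w in d0 d1 *; set u := (H k.+1 w - H k w) / 2.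
have -> : D k.+1 w - D k w + x * (sin (S k w + phi) * expR (H k w / 2)) =
  expR (H k w / 2) * (cos ((S k w + phi) + x) * expR u - cos (S k w + phi)
     + x * sin (S k w + phi)).
  rewrite /D (_ : H k.+1 w / 2 = H k w / 2 + u); last by rewrite /u; lra.
  rewrite expRD (_ : S k.+1 w + phi = S k w + phi + x); first by ring.
  by rewrite /S big_ord_recr/= addrAC.
rewrite normrM (ger0_norm (expR_ge0 _)) ler_pM ?expR_ge0//.
have uC : expR u <= C.
  rewrite ler_expR /u ler_pM2r ?invr_gt0//.
  have : H k.+1 w <= v + 1 by rewrite ge_min lexx orbT.
  have : 0 <= H k w by rewrite le_min; apply/andP; split; [apply: sumr_ge0 => j _; exact: sqr_ge0|exact: addr_ge0].
  by lra.
have u0 : 0 <= u by rewrite /u; lra.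
have ux : u <= x ^+ 2 / 2 by rewrite /u; lra.
apply: le_trans (cos_expR_step (S k w + phi) u0 ux uC) _.
have -> : x ^+ 2 / 2 - u = 2^-1 * (x ^+ 2 - (H k.+1 w - H k w)) by rewrite /u; lra.
rewrite lerD2l ler_pM2l ?expR_gt0//.
have h1 := le_cube_am x t0.
have x4 : 0 <= x ^+ 4 by rewrite exprn_even_ge0.
have h2 : x ^+ 4 <= x ^+ 4 / t by rewrite ler_pdivlMr// ler_piMr.
by rewrite mulrAC -mulrA; lra.
Qed.

(** Telescoping the steps keeps the mean of [D n] close to [cos phi]. At the end [exp(H / 2)] is
    replaced by [exp(v / 2)], and dividing by this number, at least [1], gives the claim. With
    fourth moments and variance of order [t^2], the whole bound is of order [t]. *)
Lemma mcleish_bound :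
  `|Ex P (fun w => cos (\sum_(j < n) X j w + phi)) - cos phi * expR (- (v / 2))|
  <= expR (v + 1) * (2 * v + 5) *
     (t + (\sum_(k < n) Ex P (fun w => X k w ^+ 4)
           + Ex P (fun w => (\sum_(j < n) X j w ^+ 2 - v) ^+ 2)) / t).
Proof.
rewrite -/q; rewrite -[Ex P (fun w => (_ - _) ^+ 2)]/z.
have q0 : 0 <= q by apply: sumr_ge0 => k _; apply: Ex_ge0 => w; rewrite exprn_even_ge0.
have z0 : 0 <= z by apply: Ex_ge0 => w; rewrite sqr_ge0.
have CC : C * C = expR (v + 1) by rewrite -expRD -splitr.
have D0 : Ex P (D 0) = cos phi.
  rewrite -[RHS](Ex_cst P); apply: eq_Ex => w.
  rewrite /D /S /H /V !big_ord0 add0r (_ : Num.min 0 (v + 1) = 0).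
    by rewrite mul0r expR0 mulr1.
  by apply/min_idPl; rewrite addr_ge0.
have H0 : Ex P (H 0) = 0.
  rewrite -[RHS](Ex_cst P 0); apply: eq_Ex => w; rewrite /H /V big_ord0.
  by apply/min_idPl; rewrite addr_ge0.
have tele : `|Ex P (D n) - cos phi| <=
    C * ((Ex P (V n) - Ex P (H n)) / 2 + C * (t * Ex P (V n) + (2 / t) * q)).
  have -> : Ex P (V n) = \sum_(k < n) Ex P (fun w => X k w ^+ 2).
    by rewrite Ex_sum// => k _; exact: bmeasX.
  rewrite -D0 /q.
  suff : forall m, (m <= n)%N -> `|Ex P (D m) - Ex P (D 0)| <=
     C * ((\sum_(k < m) Ex P (fun w => X k w ^+ 2) - Ex P (H m)) / 2
      + C * (t * \sum_(k < m) Ex P (fun w => X k w ^+ 2)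
         + (2 / t) * \sum_(k < m) Ex P (fun w => X k w ^+ 4))) by exact.
  elim=> [_|m IH mn]; first by rewrite !big_ord0 H0 !(subrr,mulr0,add0r,mul0r) normr0.
  rewrite !big_ord_recr/=.
  have -> : Ex P (D m.+1) - Ex P (D 0) =
     (Ex P (D m) - Ex P (D 0)) + (Ex P (D m.+1) - Ex P (D m)) by ring.
  apply: le_trans (ler_normD _ _) _.
  apply: le_trans (lerD (IH (ltnW mn)) (step mn)) _.
  by rewrite le_eqVlt; apply/orP; left; apply/eqP; ring.
have EV : Ex P (V n) <= v + 1 + z.
  rewrite -[v + 1](Ex_cst P) /z -ExD; [|exact: bmeas_cst|by apply: bmeasX; apply: bmeasB => //; exact: bmeas_cst].
  apply: le_Ex => //; first by apply: bmeasD; [exact: bmeas_cst|by apply: bmeasX; apply: bmeasB => //; exact: bmeas_cst].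
  by move=> w; have := sqr_ge0 (V n w - v - 1); nra.
(* The two differ only where [V > v + 1], and there the difference [V - v - 1] is below
   [(V - v)^2]. *)
have EVH : Ex P (V n) - Ex P (H n) <= z.
  rewrite -ExB//; apply: le_Ex; first exact: bmeasB.
    by apply: bmeasX; apply: bmeasB => //; exact: bmeas_cst.
  move=> w; rewrite /H minEle; case: ifPn; rewrite -?ltNge => h.
    by rewrite subrr sqr_ge0.
  by nra.
have EH : `|Ex P (D n) - expR (v / 2) * Ex P (fun w => cos (S n w + phi))| <= C * (t + z / t).
  have bc : bmeas (fun w => cos (S n w + phi)) by exact: bmeas_cos.
  rewrite -ExZ// -ExB//; last exact: bmeasZ.
  have bVv : bmeas (fun w => V n w - v) by apply: bmeasB => //; exact: bmeas_cst.
  apply: le_trans (_ : _ <= Ex P (fun w => C * `|V n w - v|)) _; last first.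
    rewrite ExZ; last exact: bmeas_norm.
    rewrite ler_pM2l ?expR_gt0//; exact: Ex_sqr_norm.
  apply: norm_Ex_le.
  - by apply: bmeasB => //; exact: bmeasZ.
  - by apply: bmeasZ; exact: bmeas_norm.
  move=> w; rewrite /D [expR _ * cos _]mulrC -mulrBr normrM.
  apply: (@le_trans _ _ `|expR (H n w / 2) - expR (v / 2)|).
    by rewrite ler_piMl// cos_max.
  apply: le_trans (@norm_expRB_le _ _ _ ((v + 1) / 2) _ _) _.
  - by rewrite ler_pM2r ?invr_gt0// ge_min lexx orbT.
  - by lra.
  rewrite ler_pM2l ?expR_gt0// -mulrBl normrM [X in _ * X]gtr0_norm ?invr_gt0//.
  rewrite ler_pdivrMr// (@le_trans _ _ `|V n w - v|) ?ler_peMr ?ler1n//.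
  (* Capping at a level above [v] only moves [V] closer to [v]. *)
  rewrite /H minEle; case: ifPn; rewrite -?ltNge => h //.
  by rewrite !ger0_norm; lra.
set c := Ex P (fun w => cos (S n w + phi)) in EH *.
have ev : 0 < expR (v / 2) by exact: expR_gt0.
have ev1 : 1 <= expR (v / 2) by rewrite -expR0 ler_expR divr_ge0.
have key : `|expR (v / 2) * c - cos phi| <= expR (v + 1) * (2 * v + 5) * (t + (q + z) / t).
  have -> : expR (v / 2) * c - cos phi = (Ex P (D n) - cos phi) - (Ex P (D n) - expR (v / 2) * c) by ring.
  apply: le_trans (ler_normB _ _) _.
  apply: le_trans (lerD tele EH) _.
  have zt : z <= z / t by rewrite ler_pdivlMr// ler_piMr.
  have zt2 : t * z <= z / t.
    by apply: le_trans zt; rewrite ler_piMl.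
  have qt0 : 0 <= q / t by rewrite divr_ge0// ltW.
  have zt0 : 0 <= z / t by rewrite divr_ge0// ltW.
  have tv : t * Ex P (V n) <= t * (v + 1) + z / t.
    by apply: le_trans (ler_wpM2l (ltW t0) EV) _; rewrite mulrDr; lra.
  have CC1 : C <= C * C by rewrite ler_peMl// expR_ge0.
  apply: (@le_trans _ _ (C * C * (z / t / 2) + C * C * (t * (v + 1) + z / t + 2 * (q / t)) + C * C * (t + z / t))).
    apply: lerD; last by rewrite ler_wpM2r// addr_ge0// ltW.
    rewrite mulrDr; apply: lerD; last first.
      rewrite mulrA ler_wpM2l ?mulr_ge0 ?expR_ge0//.
      by rewrite (_ : 2 / t * q = 2 * (q / t)); [lra|ring].
    apply: (@le_trans _ _ (C * (z / t / 2))); last first.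
      by rewrite ler_wpM2r// divr_ge0.
    by rewrite ler_pM2l ?expR_gt0//; lra.
  rewrite -!mulrDr CC -(mulrA (expR (v + 1))) ler_pM2l ?expR_gt0//.
  by rewrite (mulrDl q z t^-1) step_sum_le// ltW.
apply: le_trans key.
have -> : c - cos phi * expR (- (v / 2)) = expR (- (v / 2)) * (expR (v / 2) * c - cos phi).
  by rewrite mulrBr mulrA -expRD addNr expR0; ring.
rewrite normrM ler_piMl// ger0_norm ?expR_ge0//.
by rewrite -expR0 ler_expR oppr_le0 divr_ge0.
Qed.

End mcleish.

(** * Chebyshev's bound for primes in dyadic intervals *)

Section chebyshev.
Local Open Scope nat_scope.

Lemma prime_dvd_fact p n : prime p -> (p %| n`!) = (p <= n).
Proof.
move=> pp; elim: n => [|n IH].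
  by rewrite fact0 dvdn1 leqn0; case: p pp => [|[]].
rewrite factS Euclid_dvdM// IH; apply/orP/idP.
  by case=> [/dvdn_leq->//|/leqW].
by rewrite leq_eqVlt ltnS => /predU1P[->|->]; [left|right].
Qed.

(** Such a prime divides [(2 n)!] but neither factor [n!] of the denominator. *)
Lemma prime_dvd_central_bin p n : prime p -> n < p <= n.*2 -> p %| 'C(n.*2, n).
Proof.
move=> pp /andP[np pn]; have := @bin_fact n.*2 n.
rewrite -addnn leq_addr => /(_ isT) h.
have : p %| (n + n)`! by rewrite prime_dvd_fact// addnn.
by rewrite -h addnn !Euclid_dvdM// !prime_dvd_fact// -addnn addnK leqNgt np !orbF.
Qed.

Lemma central_bin_le n : 'C(n.*2, n) <= 4 ^ n.
Proof.
have -> : 4 ^ n = \sum_(i < n.*2.+1) 'C(n.*2, i).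
  rewrite (_ : 4 = 2 ^ 2)// -expnM mul2n -[2]/(1 + 1) expnDn.
  by apply: eq_bigr => i _; rewrite !exp1n !muln1.
have ln : n < n.*2.+1 by rewrite ltnS -addnn leq_addr.
by rewrite (bigD1 (Ordinal ln))//= leq_addr.
Qed.

Definition primes_in a b := [seq p <- index_iota a.+1 b.+1 | prime p].

Lemma mem_primes_in a b p : (p \in primes_in a b) = prime p && (a < p <= b).
Proof. by rewrite mem_filter mem_index_iota. Qed.

(** Distinct primes are coprime, so their product still divides the central binomial coefficient. *)
Lemma prod_primes_in_le n : \prod_(p <- primes_in n n.*2) p <= 4 ^ n.
Proof.
apply: leq_trans (central_bin_le n); apply: dvdn_leq.
  by rewrite bin_gt0 -addnn leq_addr.
suff : forall s, uniq s -> {subset s <= primes_in n n.*2} ->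
    \prod_(p <- s) p %| 'C(n.*2, n).
  by apply=> //; rewrite filter_uniq// iota_uniq.
elim=> [|p s IH] /=; first by rewrite big_nil dvd1n.
move=> /andP[ps us] sub; rewrite big_cons.
have := sub p; rewrite inE eqxx mem_primes_in => /(_ isT) /andP[pp np].
rewrite Gauss_dvd; last first.
  rewrite prime_coprime//; apply/negP; rewrite Euclid_dvd_prod// big_has => /hasP[q qs].
  have := sub q; rewrite inE qs orbT mem_primes_in => /(_ isT) /andP[pq _].
  by rewrite dvdn_prime2// => /eqP pq'; rewrite pq' qs in ps.
rewrite prime_dvd_central_bin//= IH// => q qs; apply: sub.
by rewrite inE qs orbT.
Qed.

(** Every prime counted exceeds [2 ^ k]; compare exponents in [(2 ^ k) ^ size <= 4 ^ (2 ^ k)]. *)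
Lemma size_dyadic_primes k : k * size (primes_in (2 ^ k) (2 ^ k.+1)) <= 2 ^ k.+1.
Proof.
have h : (2 ^ k) ^ size (primes_in (2 ^ k) (2 ^ k.+1)) <= 4 ^ (2 ^ k).
  rewrite expnS mul2n; apply: leq_trans (prod_primes_in_le _).
  suff : forall s, {subset s <= primes_in (2 ^ k) (2 ^ k).*2} ->
     (2 ^ k) ^ size s <= \prod_(p <- s) p by exact.
  elim=> [|p s IH] sub; first by rewrite big_nil.
  rewrite big_cons /= expnS leq_mul ?IH//.
    by have := sub p; rewrite inE eqxx mem_primes_in => /(_ isT) /and3P[_ /ltnW].
  by move=> q qs; apply: sub; rewrite inE qs orbT.
move: h; rewrite -expnM (_ : 4 = 2 ^ 2)// -expnM leq_exp2l//.
by rewrite -expnS.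
Qed.

End chebyshev.

(** * A weak Mertens estimate *)

Section mertens.
Context (R : realType).

Lemma sum_inv_dyadic_primes k : (0 < k)%N ->
  \sum_(p <- primes_in (2 ^ k) (2 ^ k.+1)) (p%:R : R)^-1 <= 2 / k%:R.
Proof.
move=> k0; set s := primes_in _ _.
have s2 : 0 < (2 ^ k)%:R :> R by rewrite ltr0n expn_gt0.
apply: (@le_trans _ _ (\sum_(p <- s) ((2 ^ k)%:R : R)^-1)).
  rewrite big_seq [leRHS]big_seq; apply: ler_sum => p.
  rewrite mem_primes_in => /and3P[_ /ltnW kp _].
  by rewrite lef_pV2 ?posrE ?ler_nat// ltr0n (leq_trans _ kp)// expn_gt0.
rewrite big_const_seq iter_addr addr0 count_predT.
rewrite -[leLHS]mulr_natl ler_pdivrMr// mulrAC ler_pdivlMr ?ltr0n//.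
by rewrite -!natrM ler_nat -expnS mulnC; exact: size_dyadic_primes.
Qed.

Lemma primes_in_cat a b c : (a <= b <= c)%N ->
  primes_in a c = primes_in a b ++ primes_in b c.
Proof.
move=> /andP[ab bc]; rewrite /primes_in -filter_cat; congr [seq p <- _ | prime p].
rewrite /index_iota !subSS (_ : (c - a = (b - a) + (c - b))%N); last by lia.
by rewrite iotaD; congr (_ ++ iota _ _); lia.
Qed.

(** The dyadic blocks [2 / k] would sum to order [ln K]. The square root is weaker but inductive,
    and it suffices: it enters Rankin's bound as [L^(1/2)] times [L^(1/3)], still below [L]. *)
Lemma sum_inv_primes_le K :
  \sum_(p <- primes_in 0 (2 ^ K)) (p%:R : R)^-1 <= 1 + 8 * Num.sqrt K%:R.
Proof.
elim: K => [|K IH]; first by rewrite expn0 /primes_in/= big_nil addr_ge0// mulr_ge0// sqrtr_ge0.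
have hK : (0 <= 2 ^ K <= 2 ^ K.+1)%N by rewrite leq0n/= expnS mul2n -addnn leq_addr.
rewrite (primes_in_cat hK) big_cat/=.
case: K IH {hK} => [|K] IH.
  rewrite [X in X + _](_ : _ = 0) ?add0r; last by rewrite expn0 /primes_in/= big_nil.
  rewrite /primes_in/= big_seq1 sqrtr1 mulr1.
  by apply: (@le_trans _ _ 1); rewrite ?invf_le1// ?ler1n//; lra.
apply: le_trans (lerD IH (@sum_inv_dyadic_primes K.+1 isT)) _.
rewrite -addrA lerD2l.
set x := K.+1; set a := Num.sqrt _; set b := Num.sqrt _.
have x1 : 1 <= x%:R :> R by rewrite ler1n.
have a0 : 0 <= a by exact: sqrtr_ge0.
have b0 : 0 <= b by exact: sqrtr_ge0.
have aa : a ^+ 2 = x%:R by rewrite sqr_sqrtr.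
have bb : b ^+ 2 = x%:R + 1 by rewrite sqr_sqrtr// natr1.
have b1 : 1 <= a by rewrite -(ler_pXn2r (n := 2)) ?nnegrE// aa expr1n.
have ba : (b - a) * (b + a) = 1 by rewrite -subr_sqr aa bb; ring.
(* Since [b - a = 1 / (b + a)], this makes the increment [8 (b - a)] at least the new block
   [2 / x]. *)
have ab2 : b + a <= 4 * x%:R.
  rewrite -aa; have : b <= 2 * a ^+ 2.
    rewrite -(ler_pXn2r (n := 2)) ?nnegrE// ?mulr_ge0 ?sqr_ge0// bb -aa.
    have : 1 <= a ^+ 2 by rewrite aa.
    by set y := a ^+ 2; nra.
  have : a <= a ^+ 2 by rewrite expr2 ler_peMl.
  by lra.
have bap : 0 < b + a by lra.
have hb : b - a = (b + a)^-1.
  by apply: (mulIf (lt0r_neq0 bap)); rewrite ba mulVf// lt0r_neq0.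
rewrite -lerBrDl -mulrBr hb ler_pdivrMr ?ltr0n// mulrAC ler_pdivlMr//.
by lra.
Qed.

End mertens.

(** * Smooth numbers and Rankin's trick *)

Section rankin.
Context (R : realType).

Definition smooth k n := all (fun p => (p <= k)%N) (primes n).

Definition psi x k := count (smooth k) (iota 1 x).

Lemma smoothP k n : reflect (forall p, prime p -> (0 < n)%N -> (p %| n)%N -> (p <= k)%N) (smooth k n).
Proof.
apply: (iffP allP) => [h p pp n0 pn|h p].
  by apply: h; rewrite mem_primes pp n0.
by rewrite mem_primes => /and3P[]; exact: h.
Qed.

Lemma smoothS k n : ~~ prime k.+1 -> smooth k.+1 n = smooth k n.
Proof.
move=> npk; apply/smoothP/smoothP => h p pp n0 pn; last exact: leqW (h p pp n0 pn).
have := h p pp n0 pn; rewrite leq_eqVlt ltnS => /predU1P[pk|//].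
by move: npk; rewrite -pk pp.
Qed.

Lemma smooth_div k n p : (0 < n)%N -> (p %| n)%N -> smooth k n -> smooth k (n %/ p).
Proof.
move=> n0 pn /smoothP h; apply/smoothP => q pq _ qn; apply: h => //.
by apply: dvdn_trans qn _; apply/dvdnP; exists p; rewrite mulnC divnK.
Qed.

(** With [p = k.+1], a [p]-smooth number is either prime to [p], hence [k]-smooth, or [p] times a
    [p]-smooth number at most [x / p]. *)
Lemma psi_rec x k : prime k.+1 ->
  (psi x k.+1 <= psi x k + psi (x %/ k.+1) k.+1)%N.
Proof.
move=> pk; set p := k.+1 in pk *.
pose Q n := (p %| n)%N && smooth p (n %/ p).
apply: (@leq_trans (psi x k + count Q (iota 1 x))).
  rewrite /psi -count_predUI -[leqLHS]addn0 leq_add// -!size_filter.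
  apply: uniq_leq_size; first by rewrite filter_uniq// iota_uniq.
  move=> n; rewrite !mem_filter/= => /andP[sn nx]; rewrite nx andbT.
  have n0 : (0 < n)%N by move: nx; rewrite mem_iota => /andP[].
  case pn: (p %| n)%N; first by rewrite /Q pn smooth_div// orbT.
  rewrite orbC; apply/orP; right; apply/smoothP => q qq _ qn.
  move/smoothP : sn => /(_ q qq n0 qn); rewrite leq_eqVlt => /predU1P[qp|//].
  by rewrite -qp qn in pn.
rewrite leq_add2l /psi -!size_filter -(size_map (fun n => n %/ p)%N).
apply: uniq_leq_size.
  rewrite map_inj_in_uniq ?filter_uniq ?iota_uniq// => a b.
  rewrite !mem_filter => /andP[/andP[pa _] _] /andP[/andP[pb _] _] ab.
  by rewrite -(divnK pa) -(divnK pb) ab.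
move=> m /mapP[n + ->]; rewrite mem_filter => /andP[/andP[pn sn] nx].
rewrite mem_filter sn mem_iota/= add1n ltnS.
move: nx; rewrite mem_iota add1n ltnS => /andP[n0 nx].
by rewrite divn_gt0 ?prime_gt0// dvdn_leq//= leq_div2r.
Qed.

Variable s : R.
Hypothesis s0 : 0 < s.

(** The Euler product of the sum of [n^(-s)] over the [k]-smooth integers [n]. *)
Definition euler k : R := \prod_(p <- primes_in 0 k) (1 - p%:R `^ (- s))^-1.

Lemma powRN_lt1 p : prime p -> 0 < (p%:R : R) `^ (- s) < 1.
Proof.
move=> pp; have p1 : 1 < p%:R :> R by rewrite ltr1n prime_gt1.
rewrite powR_gt0 ?(lt_trans ltr01)//= powRN invf_lt1 ?powR_gt0 ?(lt_trans ltr01)//.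
rewrite /powR (gt_eqF (lt_trans ltr01 p1)) expR_gt1.
by apply: mulr_gt0 => //; exact: ln_gt0.
Qed.

Lemma primes_inS k : primes_in 0 k.+1 = primes_in 0 k ++ (if prime k.+1 then [:: k.+1] else [::]).
Proof.
rewrite /primes_in /index_iota !subSS !subn0.
by rewrite (_ : iota 1 k.+1 = iota 1 k ++ [:: k.+1]) ?filter_cat// -[in LHS](addn1 k) iotaD add1n.
Qed.

Lemma euler_gt0 k : 0 < euler k.
Proof.
rewrite /euler big_seq prodr_gt0// => p; rewrite mem_primes_in => /andP[pp _].
by rewrite invr_gt0 subr_gt0; have /andP[] := powRN_lt1 pp.
Qed.

Lemma psi_le x k : (psi x k)%:R <= x%:R `^ s * euler k.
Proof.
elim: k x => [|k IHk] x.
  rewrite /euler /primes_in/= big_nil mulr1.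
  case: x => [|x]; first by rewrite /psi/= powR_ge0.
  apply: (@le_trans _ _ 1); last first.
    by have := @ge0_ler_powR R s (ltW s0) 1 x.+1%:R; rewrite powR1; apply; rewrite ?nnegrE ?ler1n.
  have c0 : count (smooth 0) (iota 2 x) = 0%N.
    apply/eqP; rewrite -leqn0 leqNgt -has_count; apply/hasPn => n.
    rewrite mem_iota => /andP[n2 _]; apply/negP => /smoothP /(_ (pdiv n)) h.
    by have := h (pdiv_prime n2) (ltnW n2) (pdiv_dvd n); rewrite leqNgt pdiv_gt0.
  by rewrite /psi [count _ _]/= c0.
have [pk|npk] := boolP (prime k.+1); last first.
  rewrite /psi (eq_count (a2 := smooth k)); last by move=> n; exact: smoothS.
  by rewrite /euler primes_inS (negbTE npk) cats0; exact: IHk.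
set a : R := k.+1%:R `^ (- s); have /andP[a0 a1] : 0 < a < 1 := powRN_lt1 pk.
have eE : euler k.+1 = euler k / (1 - a).
  by rewrite /euler primes_inS pk big_cat/= big_seq1.
elim/ltn_ind: x => -[|x] IHx; first by rewrite /psi/= mulr_ge0 ?powR_ge0// ltW ?euler_gt0.
apply: (@le_trans _ _ ((psi x.+1 k)%:R + (psi (x.+1 %/ k.+1) k.+1)%:R)).
  by rewrite -natrD ler_nat psi_rec.
apply: le_trans (lerD (IHk _) (IHx _ _)) _; first by rewrite ltn_Pdiv// prime_gt1.
apply: (@le_trans _ _ (x.+1%:R `^ s * euler k + x.+1%:R `^ s * a * euler k.+1)).
  rewrite lerD2l ler_wpM2r ?(ltW (euler_gt0 _))//.
  have -> : a = k.+1%:R^-1 `^ s.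
    by rewrite /a /powR !gt_eqF ?invr_gt0 ?ltr0n// lnV ?posrE ?ltr0n// mulrN mulNr.
  rewrite -powRM ?invr_ge0 ?ler0n// ge0_ler_powR ?nnegrE ?(ltW s0) ?mulr_ge0 ?invr_ge0 ?ler0n//.
  rewrite ler_pdivlMr ?ltr0n// -natrM ler_nat; exact: leq_trunc_div.
(* What remains is the recursion of the Euler product: [euler k + a * euler k.+1 = euler k.+1], with
   [a = p^(-s)]. *)
rewrite -mulrA -mulrDr ler_wpM2l ?powR_ge0// eE.
have a' : 1 - a != 0 by rewrite subr_eq0 eq_sym lt_eqF.
by rewrite le_eqVlt; apply/orP; left; apply/eqP; field.
Qed.

(** For [p >= 2] and [s >= 1/2] one has [p^(-s) <= 3/4], so [1 / (1 - a) = 1 + a / (1 - a) <= exp(4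
    a)]. *)
Lemma euler_le k : 2^-1 <= s ->
  euler k <= expR (4 * \sum_(p <- primes_in 0 k) p%:R `^ (- s)).
Proof.
move=> s2; rewrite mulr_sumr expR_sum /euler big_seq [leRHS]big_seq.
apply: ler_prod => p; rewrite mem_primes_in => /andP[pp _].
set a := _ `^ _; have /andP[a0 a1] : 0 < a < 1 := powRN_lt1 pp.
have a34 : a <= 3 / 4.
  apply: (@le_trans _ _ (2 `^ (- 2^-1))).
    rewrite /a !powRN lef_pV2 ?posrE ?powR_gt0 ?ltr0n ?prime_gt0//.
    apply: (@le_trans _ _ (2 `^ s)); first by rewrite ler_powR// ler1n.
    by rewrite ge0_ler_powR ?nnegrE ?ler0n// ?ler_nat ?prime_gt1// ltW.
  have h43 : 4 / 3 <= Num.sqrt 2 :> R.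
    rewrite -(ler_pXn2r (n := 2)) ?nnegrE ?sqrtr_ge0 ?divr_ge0// sqr_sqrtr//.
    by lra.
  by rewrite powRN powR12_sqrt// -div1r ler_pdivrMr ?sqrtr_gt0//; lra.
have b0 : 0 < 1 - a by lra.
rewrite invr_ge0 (ltW b0)/=.
apply: (@le_trans _ _ (expR (a / (1 - a)))).
  apply: le_trans (expR_ge1Dx _).
  by rewrite le_eqVlt; apply/orP; left; apply/eqP; field; rewrite gt_eqF.
rewrite ler_expR ler_pdivrMr//; nra.
Qed.

End rankin.

(** * Integers with a given largest prime factor *)

Section max_pdiv_count.
Context (R : realType).

Lemma ln_nat_le (K p : nat) : (2 ^ K <= p)%N -> K%:R <= 2 * ln (p%:R : R).
Proof.
move=> Kp; have p0 : (0 < p)%N by rewrite (leq_trans _ Kp)// expn_gt0.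
have h : ln ((2 : R) ^+ K) <= ln p%:R.
  by rewrite ler_ln ?posrE ?exprn_gt0 ?ltr0n// -natrX ler_nat.
have h' : ln 2 * K%:R <= ln p%:R :> R by rewrite mulr_natr -lnXn.
have l2 : 2^-1 <= ln 2 :> R.
  have := @le_ln1Dx R (- 2^-1); rewrite (_ : 1 - 2^-1 = 2^-1); last by lra.
  by rewrite lnV ?posrE//; move=> /(_ _); lra.
have : 2^-1 * K%:R <= ln 2 * K%:R :> R by rewrite ler_wpM2r.
lra.
Qed.

Variables (N : nat) (L l : R).
Hypotheses (N1 : (1 < N)%N) (lE : l = ln N%:R) (l0 : 1 <= ln l)
  (LE : L ^+ 2 = l * ln l) (Lpos : 0 < L) (M1000 : 1000 <= expR (ln L / 6)).

(** Rankin's trick with exponent [1 - h] saves [exp(- 2 L / 5)]. The Euler product costs only [exp]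
    of order [L^(5/6)], which fits into the margin [2/5 - 11/30 = 1/30]. *)
Lemma psi_small p : prime p -> ln (p%:R : R) <= 2 / 5 * L ->
  (psi N p)%:R <= N%:R * expR (- (11 / 30 * L)).
Proof.
move=> pp pL; have l0' := l0; have L0 := ltW Lpos; have Lpos' := Lpos.
have lpos : 0 < l by rewrite ltNge; apply/negP => /ln0 h; move: l0; rewrite h; lra.
have ll : ln l <= l by have := @le_ln1Dx R (l - 1); rewrite (_ : 1 + (l - 1) = l); [move=> /(_ _); lra|ring].
have Ll : L <= l by rewrite -(ler_pXn2r (n := 2)) ?nnegrE ?(ltW lpos)// LE expr2 ler_pM2l.
have N0 : 0 < N%:R :> R by rewrite ltr0n ltnW.
(* Chosen so that [N^(-h) = exp(- 2 L / 5)]. *)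
pose h := 2 / 5 * L / l.
have h0 : 0 <= h by rewrite divr_ge0 ?mulr_ge0// ltW.
have h2 : h <= 2^-1 by rewrite /h ler_pdivrMr//; lra.
have s0 : 0 < 1 - h by lra.
apply: le_trans (psi_le s0 N p) _.
have -> : N%:R `^ (1 - h) = N%:R * expR (- (2 / 5 * L)).
  rewrite /powR gt_eqF// -lE mulrBl mul1r /h mulrVK ?unitfE ?gt_eqF//.
  by rewrite expRD lE lnK ?posrE.
rewrite -mulrA ler_pM2l//.
apply: le_trans (ler_wpM2l (expR_ge0 _) (euler_le s0 p _)) _; first by lra.
rewrite -expRD ler_expR.
(* The least power of two above [p]: [2^(K - 1) <= p] and [ln 2 >= 1/2] give
   [K - 1 <= 2 ln p <= L]. *)
pose K := (trunc_log 2 p).+1.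
have pK : (p <= 2 ^ K)%N by rewrite ltnW// trunc_log_ltn.
have KL : K%:R <= 1 + L.
  rewrite /K -natr1 addrC lerD2l.
  apply: le_trans (ln_nat_le (trunc_logP _ (prime_gt0 pp))) _ => //.
  by lra.
pose M := expR (ln L / 6).
have M6 : M ^+ 6 = L.
  by rewrite /M -expRM_natl mulrC divfK// lnK.
have M0 : 0 < M by exact: expR_gt0.
have M1 : 1000 <= M := M1000.
have sK : Num.sqrt K%:R <= 1 + M ^+ 3.
  rewrite -(ler_pXn2r (n := 2)) ?nnegrE ?sqrtr_ge0 ?addr_ge0 ?exprn_ge0 ?(ltW M0)//.
  rewrite sqr_sqrtr ?ler0n// (le_trans KL)// -M6.
  have : 0 <= M ^+ 3 by rewrite exprn_ge0// ltW.
  have -> : M ^+ 6 = M ^+ 3 * M ^+ 3 by rewrite -exprD.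
  move: (M ^+ 3) => y y0.
  by rewrite (_ : (1 + y) ^+ 2 = 1 + y * y + 2 * y); [lra|ring].
have S : \sum_(q <- primes_in 0 p) q%:R `^ (- (1 - h)) <= M ^+ 2 * (1 + 8 * (1 + M ^+ 3)).
  apply: (@le_trans _ _ (M ^+ 2 * \sum_(q <- primes_in 0 p) (q%:R : R)^-1)).
    rewrite mulr_sumr big_seq [leRHS]big_seq; apply: ler_sum => q.
    rewrite mem_primes_in => /andP[pq /andP[q0 qp]].
    have qpos : 0 < q%:R :> R by rewrite ltr0n.
    have -> : q%:R `^ (- (1 - h)) = expR (h * ln q%:R) / q%:R.
      by rewrite /powR gt_eqF// opprB mulrBl mul1r expRB lnK ?posrE.
    rewrite ler_pM2r ?invr_gt0// /M -expRM_natl ler_expR.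
    have lq : ln (q%:R : R) <= 2 / 5 * L.
      by apply: le_trans pL; rewrite ler_ln ?posrE// ?ltr0n ?prime_gt0// ler_nat.
    (* As [L^2 = l ln l >= l]. Then [q^h <= exp(h * 2 L / 5) = exp((4/25) ln l) <= L^(8/25)], which
       is below [L^(1/3) = M^2]. *)
    have lL : ln l <= 2 * ln L.
      rewrite mulr_natl -lnXn// LE ler_ln ?posrE ?mulr_gt0//; last by lra.
      by rewrite ler_peMr// ltW.
    apply: (@le_trans _ _ (h * (2 / 5 * L))); first by rewrite ler_wpM2l.
    have -> : h * (2 / 5 * L) = 4 / 25 * (L ^+ 2 / l) by rewrite /h; field; rewrite gt_eqF.
    have -> : L ^+ 2 / l = ln l by rewrite LE mulrC mulKf ?gt_eqF.
    have : 0 <= ln L by lra.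
    by lra.
  rewrite ler_wpM2l ?exprn_ge0 ?(ltW M0)//.
  apply: (@le_trans _ _ (\sum_(q <- primes_in 0 (2 ^ K)) (q%:R : R)^-1)).
    rewrite (@primes_in_cat 0 p (2 ^ K)) ?leq0n// big_cat/= lerDl.
    by apply: sumr_ge0 => q _; rewrite invr_ge0 ler0n.
  by apply: le_trans (sum_inv_primes_le R K) _; lra.
apply: (@le_trans _ _ (- (2 / 5 * L) + 4 * (M ^+ 2 * (1 + 8 * (1 + M ^+ 3))))).
  by rewrite lerD2l ler_wpM2l.
(* The threshold [1000] enters here: [M / 30] exceeds the coefficient [32] of [M^3], and the excess
   times [M^3] covers [36]. *)
suff : 4 * (M ^+ 2 * (1 + 8 * (1 + M ^+ 3))) <= L / 30 by lra.
rewrite -M6.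
have y0 : 0 < M ^+ 2 by rewrite exprn_gt0.
have -> : M ^+ 6 / 30 = M ^+ 2 * (M ^+ 3 * (M / 30)) by field.
have -> : 4 * (M ^+ 2 * (1 + 8 * (1 + M ^+ 3))) = M ^+ 2 * (36 + 32 * M ^+ 3) by ring.
rewrite ler_pM2l//.
have y1 : 36 <= M ^+ 3.
  have h1 : 1 <= M ^+ 2 by rewrite exprn_ege1//; lra.
  by rewrite exprS; nra.
by set y := M ^+ 3 in y1 *; nra.
Qed.

(** Primes up to [exp(2 L / 5)] fall under [psi_small]. For a larger prime, counting its multiples
    gives [N / p < N exp(- 2 L / 5)], which is enough as [2/5 > 11/30]. *)
Lemma count_max_pdiv_le p : prime p ->
  (count (fun n => max_pdiv n == p) (iota 1 N))%:R
    <= N%:R * expR (- (11 / 30 * L)) :> R.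
Proof.
move=> pp; have L0 := Lpos; have p0 := prime_gt0 pp; have [pL|pL] := leP (ln (p%:R : R)) (2 / 5 * L).
  apply: le_trans (psi_small pp pL); rewrite ler_nat /psi.
  rewrite -!size_filter; apply: uniq_leq_size; first by rewrite filter_uniq ?iota_uniq.
  move=> n; rewrite !mem_filter => /andP[/eqP np ->]; rewrite andbT.
  apply/smoothP => q qq n0 qn; rewrite -np; apply: max_pdiv_max.
  by rewrite mem_primes qq n0.
apply: (@le_trans _ _ (N %/ p)%:R).
  rewrite ler_nat -size_filter -(size_map (fun n => n %/ p)%N) -[leqRHS](size_iota 1).
  have pd n : max_pdiv n == p -> (p %| n)%N by move=> /eqP<-; exact: max_pdiv_dvd.
  apply: uniq_leq_size.
    rewrite map_inj_in_uniq ?filter_uniq ?iota_uniq// => a b.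
    rewrite !mem_filter => /andP[/pd pa _] /andP[/pd pb _] ab.
    by rewrite -(divnK pa) -(divnK pb) ab.
  move=> m /mapP[n + ->]; rewrite mem_filter mem_iota add1n ltnS => /andP[/pd pn /andP[n0 nx]].
  by rewrite mem_iota add1n ltnS divn_gt0// dvdn_leq//= leq_div2r.
apply: (@le_trans _ _ (N%:R / p%:R)).
  by rewrite ler_pdivlMr ?ltr0n// -natrM ler_nat leq_trunc_div.
rewrite ler_pM2l ?ltr0n 1?ltnW// -[X in X^-1]lnK ?posrE ?ltr0n// -expRN ler_expR.
by lra.
Qed.

End max_pdiv_count.

(** * Counting solutions of the multiplicative equation *)

Section quadruples.
Context (R : realType).
Implicit Types S : seq nat.

Definition sum4 S (g : nat -> nat -> nat -> nat -> R) : R :=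
  \sum_(s1 <- S) \sum_(s2 <- S) \sum_(t1 <- S) \sum_(t2 <- S) g s1 s2 t1 t2.

Lemma le_sum4 S g h : (forall a b c e, g a b c e <= h a b c e) -> sum4 S g <= sum4 S h.
Proof. by move=> gh; do 4![apply: ler_sum => ? _]; exact: gh. Qed.

Lemma sum4D S g h : sum4 S (fun a b c e => g a b c e + h a b c e) = sum4 S g + sum4 S h.
Proof. by rewrite /sum4; do 4![rewrite -big_split; apply: eq_bigr => ? _]. Qed.

Lemma sum4B S g h : sum4 S (fun a b c e => g a b c e - h a b c e) = sum4 S g - sum4 S h.
Proof. by rewrite /sum4; do 4![rewrite -sumrB; apply: eq_bigr => ? _]. Qed.

Lemma sum_filter_le (T : eqType) (s : seq T) (p : pred T) (g h : T -> R) :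
  (forall x, 0 <= h x) -> (forall x, g x <= h x) ->
  \sum_(x <- [seq x <- s | p x]) g x <= \sum_(x <- s) h x.
Proof.
move=> h0 gh; rewrite big_filter.
apply: (@le_trans _ _ (\sum_(x <- s | p x) h x)); first by apply: ler_sum.
rewrite [leRHS](bigID p)/= lerDl; exact: sumr_ge0.
Qed.

Lemma sum4_filter S p g : (forall a b c e, 0 <= g a b c e) ->
  sum4 [seq x <- S | p x] g <= sum4 S g.
Proof.
move=> g0; rewrite /sum4.
have n1 a b c : 0 <= \sum_(t2 <- S) g a b c t2 by apply: sumr_ge0.
have n2 a b : 0 <= \sum_(t1 <- S) \sum_(t2 <- S) g a b t1 t2 by apply: sumr_ge0.
have n3 a : 0 <= \sum_(s2 <- S) \sum_(t1 <- S) \sum_(t2 <- S) g a s2 t1 t2 by apply: sumr_ge0.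
by do 4![apply: sum_filter_le => // ?].
Qed.

Definition energy4 S := sum4 S (fun a b c e => (a * b == c * e)%N%:R).

Definition offdiag S := sum4 S (fun a b c e =>
  [&& (a * b == c * e)%N, ~~ ((a == c) && (b == e)) & ~~ ((a == e) && (b == c))]%:R).

Definition same_P S : R := \sum_(a <- S) \sum_(b <- S) (max_pdiv a == max_pdiv b)%:R.

Lemma sum_eq1 S a (g : nat -> R) : uniq S -> a \in S ->
  \sum_(c <- S) (a == c)%:R * g c = g a.
Proof.
move=> uS aS; rewrite (bigD1_seq a)//= eqxx mul1r big1 ?addr0// => c ca.
by rewrite eq_sym (negbTE ca) mul0r.
Qed.

Lemma sum4_diag1 S (g : nat -> nat -> R) : uniq S ->
  sum4 S (fun a b c e => ((a == c) && (b == e))%:R * g a b) = \sum_(a <- S) \sum_(b <- S) g a b.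
Proof.
move=> uS; apply: eq_big_seq => a aS; apply: eq_big_seq => b bS.
rewrite -[RHS](sum_eq1 (fun=> g a b) uS aS); apply: eq_bigr => c _.
rewrite -[in RHS](sum_eq1 (fun=> g a b) uS bS) mulr_sumr; apply: eq_bigr => e _.
by rewrite -mulnb natrM mulrA.
Qed.

Lemma sum4_diag2 S (g : nat -> nat -> R) : uniq S ->
  sum4 S (fun a b c e => ((a == e) && (b == c))%:R * g a b) = \sum_(a <- S) \sum_(b <- S) g a b.
Proof.
move=> uS; apply: eq_big_seq => a aS; apply: eq_big_seq => b bS.
rewrite exchange_big/=.
rewrite -[RHS](sum_eq1 (fun=> g a b) uS aS); apply: eq_bigr => e _.
rewrite -[in RHS](sum_eq1 (fun=> g a b) uS bS) mulr_sumr; apply: eq_bigr => c _.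
by rewrite -mulnb natrM mulrA.
Qed.

Lemma sum2_cst S (c : R) : \sum_(a <- S) \sum_(b <- S) c = (size S)%:R ^+ 2 * c.
Proof.
rewrite (eq_bigr (fun=> (size S)%:R * c)); last first.
  by move=> a _; rewrite big_const_seq iter_addr addr0 count_predT mulr_natl.
by rewrite big_const_seq iter_addr addr0 count_predT -[LHS]mulr_natl expr2 mulrA.
Qed.

(** Inclusion-exclusion: each of the two families of trivial solutions has [|S|^2] members, and they
    meet where all four entries are equal. *)
Lemma offdiagE S : uniq S ->
  offdiag S = energy4 S - 2 * (size S)%:R ^+ 2 + (size S)%:R.
Proof.
move=> uS.
have h1 := sum4_diag1 (fun _ _ => 1) uS; rewrite sum2_cst mulr1 in h1.
have h2 := sum4_diag2 (fun _ _ => 1) uS; rewrite sum2_cst mulr1 in h2.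
have h3 := sum4_diag1 (fun a b => (a == b)%:R * 1) uS.
have h4 : \sum_(a <- S) \sum_(b <- S) (a == b)%:R * 1 = (size S)%:R :> R.
  rewrite (eq_big_seq (fun=> 1)); last by move=> a aS; rewrite sum_eq1.
  by rewrite big_const_seq iter_addr addr0 count_predT.
rewrite h4 in h3.
have -> : offdiag S = energy4 S - sum4 S (fun a b c e => ((a == c) && (b == e))%:R * 1)
   - sum4 S (fun a b c e => ((a == e) && (b == c))%:R * 1)
   + sum4 S (fun a b c e => ((a == c) && (b == e))%:R * ((a == b)%:R * 1)).
  rewrite -!sum4B -sum4D /offdiag; congr sum4.
  apply/funext => a; apply/funext => b; apply/funext => c; apply/funext => e.
  have pE : (a == c) && (b == e) -> (a * b == c * e)%N by move=> /andP[/eqP-> /eqP->].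
  have qE : (a == e) && (b == c) -> (a * b == c * e)%N by move=> /andP[/eqP-> /eqP->]; rewrite mulnC.
  have pq : (a == c) && (b == e) && (a == b) = ((a == c) && (b == e)) && ((a == e) && (b == c)).
    have [<-|//] := eqVneq a c; have [<-|//] := eqVneq b e => /=.
    by rewrite [b == a]eq_sym andbb.
  rewrite !mulr1 -natrM mulnb pq; move: pE qE; clear.
  case: ((a == c) && (b == e)); case: ((a == e) && (b == c)); case: (a * b == c * e)%N => /= h1 h2;
    by [have := h1 isT|have := h2 isT|lra].
rewrite h1 h2 h3; ring.
Qed.

End quadruples.

(** * Moments of the martingale differences *)

Section moments.
Context (R : realType) (d : measure_display) (T : measurableType d).
Variables (P : probability T R) (f : nat -> T -> R[i]).
Hypothesis uf : unimodular_steinhaus P f.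
Variables (S : seq nat) (N : nat).
Hypotheses (uS : uniq S) (S1 : forall n, n \in S -> (1 < n <= N)%N).

Let S0 n : n \in S -> (0 < n)%N.
Proof. by move=> /S1 /andP[/ltnW]. Qed.

Let PN n : n \in S -> (max_pdiv n < N.+1)%N.
Proof.
move=> nS; rewrite ltnS; apply: leq_trans (max_pdiv_leq (S0 nS)) _.
by have /andP[] := S1 nS.
Qed.

(** Indexed by all integers rather than primes: as elements of [S] exceed [1], the sum is empty
    unless [p] is prime. *)
Definition block p w : R[i] := \sum_(n <- S | max_pdiv n == p) f n w.

Lemma cbmeas_block p : cbmeas (block p).
Proof.
rewrite /block; under eq_fun do rewrite big_seq_cond.
by apply: cbmeas_sum => n /andP[nS _]; apply: (cbmeas_us uf); exact: S0.
Qed.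

Let quad w a b c e : R[i] := f a w * f b w * conjc (f c w) * conjc (f e w).

Definition csum4 (g : nat -> nat -> nat -> nat -> R[i]) : R[i] :=
  \sum_(s1 <- S) \sum_(s2 <- S) \sum_(t1 <- S) \sum_(t2 <- S) g s1 s2 t1 t2.

Let Re_sum I (r : seq I) (Q : pred I) (g : I -> R[i]) :
  complex.Re (\sum_(i <- r | Q i) g i) = \sum_(i <- r | Q i) complex.Re (g i).
Proof. by elim/big_rec2: _ => [//|i y1 y2 _ <-]; rewrite cReD. Qed.

Let Re_natM (n : nat) (z : R[i]) : complex.Re (n%:R * z) = n%:R * complex.Re z.
Proof.
rewrite cReM; have -> : (n%:R : R[i]) = (n%:R)%:C%C by rewrite rmorph_nat.
by rewrite /= mul0r subr0.
Qed.

(** Orthonormality, applied to [f (a b)] and [f (c e)], leaves exactly the quadruples with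
    [a b = c e]. The condition is a parameter because three moments are evaluated this way. *)
Lemma Ex_csum4 (cond : nat -> nat -> nat -> nat -> bool) :
  bmeas (fun w => complex.Re (csum4 (fun a b c e => (cond a b c e)%:R * quad w a b c e))) /\
  Ex P (fun w => complex.Re (csum4 (fun a b c e => (cond a b c e)%:R * quad w a b c e))) =
  sum4 S (fun a b c e => (cond a b c e && (a * b == c * e)%N)%:R : R).
Proof.
have ME w : complex.Re (csum4 (fun a b c e => (cond a b c e)%:R * quad w a b c e)) =
   \sum_(s1 <- S) \sum_(s2 <- S) \sum_(t1 <- S) \sum_(t2 <- S)
     (cond s1 s2 t1 t2)%:R * complex.Re (quad w s1 s2 t1 t2).
  rewrite /csum4; do 4![rewrite Re_sum; apply: eq_bigr => ? _].
  by rewrite Re_natM.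
have qE w a b c e : a \in S -> b \in S -> c \in S -> e \in S ->
    quad w a b c e = f (a * b)%N w * conjc (f (c * e)%N w).
  by move=> aS bS cS eS; rewrite /quad !(usM uf) ?S0// rmorphM/=; ring.
have bq a b c e : a \in S -> b \in S -> c \in S -> e \in S ->
    bmeas (fun w => (cond a b c e)%:R * complex.Re (quad w a b c e)).
  move=> aS bS cS eS; apply: bmeasZ; under eq_fun do rewrite qE//.
  have [] : cbmeas (fun w => f (a * b)%N w * conjc (f (c * e)%N w)) => //.
  by apply: cbmeasM; [|apply: cbmeas_conjc]; apply: (cbmeas_us uf); rewrite muln_gt0 !S0.
have bs (g : nat -> T -> R) : (forall n, n \in S -> bmeas (g n)) ->
    bmeas (fun w => \sum_(n <- S) g n w).
  by move=> hg; under eq_fun do rewrite big_seq; apply: bmeas_sum.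
have Es (g : nat -> T -> R) : (forall n, n \in S -> bmeas (g n)) ->
    Ex P (fun w => \sum_(n <- S) g n w) = \sum_(n <- S) Ex P (g n).
  move=> hg; rewrite (eq_Ex P (Y := fun w => \sum_(n <- S | n \in S) g n w)); last by move=> w; rewrite big_seq.
  by rewrite Ex_sum// [RHS]big_seq.
have b1 a b c : a \in S -> b \in S -> c \in S ->
    bmeas (fun w => \sum_(e <- S) (cond a b c e)%:R * complex.Re (quad w a b c e)).
  by move=> aS bS cS; apply: bs => e eS; exact: bq.
have b2 a b : a \in S -> b \in S ->
    bmeas (fun w => \sum_(c <- S) \sum_(e <- S) (cond a b c e)%:R * complex.Re (quad w a b c e)).
  by move=> aS bS; apply: bs => e eS; exact: b1.
have b3 a : a \in S -> bmeas (fun w => \sum_(b <- S) \sum_(c <- S) \sum_(e <- S)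
     (cond a b c e)%:R * complex.Re (quad w a b c e)).
  by move=> aS; apply: bs => e eS; exact: b2.
split; first by under eq_fun do rewrite ME; apply: bs => e eS; exact: b3.
rewrite (eq_Ex P ME) Es//; apply: eq_big_seq => a aS.
rewrite Es; last by move=> b bS; exact: b2.
apply: eq_big_seq => b bS; rewrite Es; last by move=> c cS; exact: b1.
apply: eq_big_seq => c cS; rewrite Es; last by move=> e eS; exact: bq.
apply: eq_big_seq => e eS.
rewrite ExZ; last first.
  under eq_fun do rewrite qE//.
  have [] : cbmeas (fun w => f (a * b)%N w * conjc (f (c * e)%N w)) => //.
  by apply: cbmeasM; [|apply: cbmeas_conjc]; apply: (cbmeas_us uf); rewrite muln_gt0 !S0.
rewrite (eq_Ex P (Y := fun w => complex.Re (f (a * b)%N w * conjc (f (c * e)%N w)))); last by move=> w; rewrite qE.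
by rewrite (us_orthonormal uf) ?muln_gt0 ?S0// -natrM mulnb.
Qed.

Let blockE p w : block p w = \sum_(n <- S) (max_pdiv n == p)%:R * f n w.
Proof.
rewrite /block big_mkcond; apply: eq_bigr => n _.
by case: ifP => _; rewrite ?mul1r ?mul0r.
Qed.

Let block_conj p w : conjc (block p w) = \sum_(n <- S) (max_pdiv n == p)%:R * conjc (f n w).
Proof.
rewrite blockE rmorph_sum/=; apply: eq_bigr => n _.
by rewrite rmorphM/= rmorph_nat.
Qed.

Let sum_blocks (x y : nat -> R[i]) :
  \sum_(p < N.+1) (\sum_(n <- S) (max_pdiv n == p)%:R * x n) * (\sum_(n <- S) (max_pdiv n == p)%:R * y n) =
  \sum_(a <- S) \sum_(b <- S) (max_pdiv a == max_pdiv b)%:R * (x a * y b).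
Proof.
under eq_bigr => p _ do rewrite mulr_suml.
rewrite exchange_big/=; apply: eq_big_seq => a aS.
rewrite (bigD1 (Ordinal (PN aS)))//= eqxx mul1r [X in _ + X]big1 ?addr0; last first.
  move=> p pa; case: eqP => [E|_]; last by rewrite !mul0r.
  by case/negP: pa; apply/eqP/val_inj; rewrite /= E.
rewrite mulr_sumr; apply: eq_bigr => b _; rewrite eq_sym; ring.
Qed.

(** In [|block|^2] a plain factor meets a conjugated one, so the largest primes of [a, c] and of
    [b, e] are tied, which the trivial solutions [a = c], [b = e] satisfy freely. In [nsq_sum_sqr]
    the ties are [a, b] and [c, e], which no trivial solution satisfies for free. *)
Lemma sqr_sum_nsq w : ((\sum_(p < N.+1) nsq (block p w)) ^+ 2)%:C%C =
  csum4 (fun a b c e => ((max_pdiv a == max_pdiv c) && (max_pdiv b == max_pdiv e))%:R * quad w a b c e).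
Proof.
have E : (\sum_(p < N.+1) nsq (block p w))%:C%C =
   \sum_(a <- S) \sum_(c <- S) (max_pdiv a == max_pdiv c)%:R * (f a w * conjc (f c w)).
  rewrite rmorph_sum/= -sum_blocks; apply: eq_bigr => p _.
  by rewrite nsqE block_conj blockE.
rewrite rmorphXn/= E expr2 mulr_suml; apply: eq_bigr => a _.
rewrite mulr_sumr; apply: eq_bigr => b _.
rewrite mulr_suml; apply: eq_bigr => c _.
rewrite mulr_sumr; apply: eq_bigr => e _.
by rewrite -mulnb natrM /quad; ring.
Qed.

Lemma nsq_sum_sqr w : (nsq (\sum_(p < N.+1) block p w ^+ 2))%:C%C =
  csum4 (fun a b c e => ((max_pdiv a == max_pdiv b) && (max_pdiv c == max_pdiv e))%:R * quad w a b c e).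
Proof.
have E1 : \sum_(p < N.+1) block p w ^+ 2 =
   \sum_(a <- S) \sum_(b <- S) (max_pdiv a == max_pdiv b)%:R * (f a w * f b w).
  by rewrite -sum_blocks; apply: eq_bigr => p _; rewrite expr2 blockE.
have E2 : conjc (\sum_(p < N.+1) block p w ^+ 2) =
   \sum_(a <- S) \sum_(b <- S) (max_pdiv a == max_pdiv b)%:R * (conjc (f a w) * conjc (f b w)).
  rewrite rmorph_sum/= -sum_blocks; apply: eq_bigr => p _.
  by rewrite rmorphXn/= expr2 block_conj.
rewrite nsqE E2 E1 mulr_suml; apply: eq_bigr => a _.
rewrite mulr_suml; apply: eq_bigr => b _.
rewrite mulr_sumr; apply: eq_bigr => c _.
rewrite mulr_sumr; apply: eq_bigr => e _.
by rewrite -mulnb natrM /quad; ring.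
Qed.

Lemma sum_nsq_sqr w : (\sum_(p < N.+1) nsq (block p w) ^+ 2)%:C%C =
  csum4 (fun a b c e => [&& max_pdiv a == max_pdiv b, max_pdiv c == max_pdiv e & max_pdiv a == max_pdiv c]%:R * quad w a b c e).
Proof.
rewrite rmorph_sum/=.
transitivity (\sum_(p < N.+1) csum4 (fun a b c e =>
   ((max_pdiv a == p) && ((max_pdiv b == p) && ((max_pdiv c == p) && (max_pdiv e == p))))%:R * quad w a b c e)).
  apply: eq_bigr => p _; rewrite rmorphXn/= nsqE.
  have -> : (block p w * conjc (block p w)) ^+ 2 = block p w * block p w * conjc (block p w) * conjc (block p w) by ring.
  rewrite block_conj blockE; set SC := (\sum_(n <- S) _ * conjc _).
  rewrite !mulr_suml; apply: eq_bigr => a _.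
  rewrite mulr_sumr !mulr_suml; apply: eq_bigr => b _.
  rewrite {1}/SC mulr_sumr mulr_suml; apply: eq_bigr => c _.
  rewrite /SC mulr_sumr; apply: eq_bigr => e _.
  by rewrite -!mulnb !natrM /quad; ring.
rewrite exchange_big/=; apply: eq_big_seq => a aS.
rewrite exchange_big/=; apply: eq_bigr => b _.
rewrite exchange_big/=; apply: eq_bigr => c _.
rewrite exchange_big/=; apply: eq_bigr => e _.
rewrite (bigD1 (Ordinal (PN aS)))//= eqxx [X in _ + X]big1 ?addr0; last first.
  move=> p pa; case: eqP => [E|_]; last by rewrite mul0r.
  by case/negP: pa; apply/eqP/val_inj; rewrite /= E.
congr (_%:R * _); rewrite /= [max_pdiv b == _]eq_sym.
case: eqVneq => //= ab; rewrite [max_pdiv c == _]eq_sym.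
by case: eqVneq => //= [<-|]; rewrite ?andbT ?andbF// eq_sym.
Qed.

(** The solutions [a = c], [b = e] give the main term [|S|^2]. On the other diagonal the condition
    forces equal largest primes, and the rest is at most [offdiag]. *)
Lemma Ex_sqr_sum_nsq :
  bmeas (fun w => (\sum_(p < N.+1) nsq (block p w)) ^+ 2) /\
  Ex P (fun w => (\sum_(p < N.+1) nsq (block p w)) ^+ 2) <=
    (size S)%:R ^+ 2 + same_P R S + offdiag R S.
Proof.
have [b e] := Ex_csum4 (fun a b c e => (max_pdiv a == max_pdiv c) && (max_pdiv b == max_pdiv e)).
have E w : (\sum_(p < N.+1) nsq (block p w)) ^+ 2 = complex.Re (csum4 (fun a b c e =>
    ((max_pdiv a == max_pdiv c) && (max_pdiv b == max_pdiv e))%:R * quad w a b c e)).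
  by rewrite -sqr_sum_nsq.
split; first by under eq_fun do rewrite E.
rewrite (eq_Ex P E) e.
have := sum4_diag1 (fun _ _ => 1 : R) uS; rewrite sum2_cst mulr1 => <-.
have := sum4_diag2 (fun a b => (max_pdiv a == max_pdiv b)%:R : R) uS; rewrite -/(same_P R S) => <-.
rewrite /offdiag -!sum4D; apply: le_sum4 => a' b' c' e'; rewrite mulr1 -natrM mulnb -!natrD ler_nat.
case: (a' * b' == c' * e')%N; rewrite ?andbF// !andbT.
case: ((a' == c') && (b' == e')) => /=; first by case: (_ && _).
case Yq: ((a' == e') && (b' == c')) => /=; last by case: (_ && _).
case/andP: Yq => _ /eqP <-; rewrite addn0.
by case: (max_pdiv a' == max_pdiv b') => //=; exact: leq_b1.
Qed.

(** Under such a condition each of the two diagonals contributes at most the pairs counted by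
    [same_P]. *)
Lemma cond_sum4_le (cond : nat -> nat -> nat -> nat -> bool) :
  (forall a b c e, cond a b c e -> max_pdiv a = max_pdiv b) ->
  sum4 S (fun a b c e => (cond a b c e && (a * b == c * e)%N)%:R : R) <=
    2 * same_P R S + offdiag R S.
Proof.
move=> hc; rewrite (_ : 2 * same_P R S = same_P R S + same_P R S); last by ring.
have := sum4_diag1 (fun a b => (max_pdiv a == max_pdiv b)%:R : R) uS; rewrite -/(same_P R S) => e1.
have := sum4_diag2 (fun a b => (max_pdiv a == max_pdiv b)%:R : R) uS; rewrite -/(same_P R S) => e2.
rewrite -{1}e1 -e2 /offdiag -!sum4D; apply: le_sum4 => a b c e.
rewrite -!natrM !mulnb -!natrD ler_nat.
case cE: (cond a b c e) => //=; rewrite (hc _ _ _ _ cE) eqxx !andbT.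
by case: (a * b == c * e)%N => //=; case: ((a == c) && _); case: ((a == e) && _).
Qed.

Lemma Ex_nsq_sum_sqr :
  bmeas (fun w => nsq (\sum_(p < N.+1) block p w ^+ 2)) /\
  Ex P (fun w => nsq (\sum_(p < N.+1) block p w ^+ 2)) <= 2 * same_P R S + offdiag R S.
Proof.
have [b e] := Ex_csum4 (fun a b c e => (max_pdiv a == max_pdiv b) && (max_pdiv c == max_pdiv e)).
have E w : nsq (\sum_(p < N.+1) block p w ^+ 2) = complex.Re (csum4 (fun a b c e =>
    ((max_pdiv a == max_pdiv b) && (max_pdiv c == max_pdiv e))%:R * quad w a b c e)).
  by rewrite -nsq_sum_sqr.
split; first by under eq_fun do rewrite E.
by rewrite (eq_Ex P E) e; apply: cond_sum4_le => ? ? ? ? /andP[/eqP].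
Qed.

Lemma Ex_sum_nsq_sqr :
  Ex P (fun w => \sum_(p < N.+1) nsq (block p w) ^+ 2) <= 2 * same_P R S + offdiag R S.
Proof.
have [b e] := Ex_csum4 (fun a b c e => [&& max_pdiv a == max_pdiv b, max_pdiv c == max_pdiv e & max_pdiv a == max_pdiv c]).
have E w : \sum_(p < N.+1) nsq (block p w) ^+ 2 = complex.Re (csum4 (fun a b c e =>
    [&& max_pdiv a == max_pdiv b, max_pdiv c == max_pdiv e & max_pdiv a == max_pdiv c]%:R * quad w a b c e)).
  by rewrite -sum_nsq_sqr.
by rewrite (eq_Ex P E) e; apply: cond_sum4_le => ? ? ? ? /and3P[/eqP].
Qed.

Lemma bmeas_nsq_block p : bmeas (fun w => nsq (block p w)).
Proof. by have [h1 h2] := cbmeas_block p; apply: bmeasD; exact: bmeasX. Qed.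

Lemma Ex_nsq_sum (r : seq nat) (c : pred nat) : uniq r -> (forall n, n \in r -> (0 < n)%N) ->
  Ex P (fun w => nsq (\sum_(n <- r | c n) f n w)) = (count c r)%:R.
Proof.
move=> ur r0.
have E w : nsq (\sum_(n <- r | c n) f n w) =
   \sum_(m <- r | (m \in r) && c m) \sum_(n <- r | (n \in r) && c n) complex.Re (f m w * conjc (f n w)).
  have -> : nsq (\sum_(n <- r | c n) f n w) = complex.Re ((nsq (\sum_(n <- r | c n) f n w))%:C%C) by [].
  rewrite nsqE rmorph_sum/= mulr_suml Re_sum [LHS]big_seq_cond; apply: eq_bigr => m _.
  by rewrite mulr_sumr Re_sum big_seq_cond.
have bm m n : m \in r -> n \in r -> bmeas (fun w => complex.Re (f m w * conjc (f n w))).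
  move=> mr nr; have [] : cbmeas (fun w => f m w * conjc (f n w)) => //.
  by apply: cbmeasM; [|apply: cbmeas_conjc]; apply: (cbmeas_us uf); exact: r0.
rewrite (eq_Ex P E) Ex_sum; last first.
  by move=> m /andP[mr _]; apply: bmeas_sum => n /andP[nr _]; exact: bm.
rewrite -big_seq_cond -sum1_count natr_sum big_seq_cond [RHS]big_seq_cond.
apply: eq_bigr => m /andP[mr cm].
rewrite Ex_sum; last by move=> n /andP[nr _]; exact: bm.
rewrite big_mkcond (bigD1_seq m)//= mr cm (us_orthonormal uf) ?r0// eqxx big1 ?addr0//.
move=> n nm; case: ifP => // /andP[nr _].
by rewrite (us_orthonormal uf) ?r0// eq_sym (negbTE nm).
Qed.

Lemma Ex_sum_nsq : Ex P (fun w => \sum_(p < N.+1) nsq (block p w)) = (size S)%:R.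
Proof.
rewrite Ex_sum; last by move=> p _; exact: bmeas_nsq_block.
rewrite (eq_bigr (fun p : 'I_N.+1 => (count (fun n => max_pdiv n == p) S)%:R)); last first.
  by move=> p _; rewrite /block Ex_nsq_sum.
rewrite -natr_sum; congr (_%:R).
under eq_bigr do rewrite -sum1_count big_mkcond.
rewrite exchange_big/= -sum1_size; apply: eq_big_seq => n nS.
rewrite (bigD1 (Ordinal (PN nS)))//= eqxx big1// => p pn.
case: eqP => // E; by case/negP: pn; apply/eqP/val_inj; rewrite /= E.
Qed.

Variables (rho a b : R).

(** Cramer-Wold reduction: the real linear form [a Re + b Im] of the block, scaled by [rho]. *)
Definition mdiff p w : R := rho * (a * complex.Re (block p w) + b * complex.Im (block p w)).

Lemma bmeas_mdiff p : bmeas (mdiff p).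
Proof. by have [h1 h2] := cbmeas_block p; apply: bmeasZ; apply: bmeasD; exact: bmeasZ. Qed.

Lemma sum_mdiff w : \sum_(p < N.+1) mdiff p w =
  rho * (a * complex.Re (\sum_(n <- S) f n w) + b * complex.Im (\sum_(n <- S) f n w)).
Proof.
have E : \sum_(p < N.+1) block p w = \sum_(n <- S) f n w.
  under eq_bigr do rewrite blockE.
  rewrite exchange_big/=; apply: eq_big_seq => n nS.
  rewrite (bigD1 (Ordinal (PN nS)))//= eqxx mul1r big1 ?addr0// => p pn.
  case: eqP => [E|_]; last by rewrite mul0r.
  by case/negP: pn; apply/eqP/val_inj; rewrite /= E.
rewrite -E -mulr_sumr; congr (_ * _).
elim/big_rec2: _ => [|p y1 y2 _ ->]; first by rewrite /= !mulr0 addr0.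
by rewrite cReD cImD; ring.
Qed.

Let c2 := a ^+ 2 + b ^+ 2.

Lemma sum_Ex_mdiff4 : \sum_(p < N.+1) Ex P (fun w => mdiff p w ^+ 4) <=
  rho ^+ 4 * c2 ^+ 2 * (2 * same_P R S + offdiag R S).
Proof.
apply: (@le_trans _ _ (rho ^+ 4 * c2 ^+ 2 * Ex P (fun w => \sum_(p < N.+1) nsq (block p w) ^+ 2))); last first.
  by rewrite ler_wpM2l ?Ex_sum_nsq_sqr// mulr_ge0// exprn_even_ge0.
rewrite Ex_sum; last by move=> p _; apply: bmeasX; exact: bmeas_nsq_block.
rewrite mulr_sumr; apply: ler_sum => p _.
have bn : bmeas (fun w => nsq (block p w) ^+ 2) by apply: bmeasX; exact: bmeas_nsq_block.
rewrite -ExZ//; apply: le_Ex; [by apply: bmeasX; exact: bmeas_mdiff|exact: bmeasZ|].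
move=> w; rewrite /mdiff exprMn -mulrA ler_wpM2l ?exprn_even_ge0// -exprMn.
have -> : (a * complex.Re (block p w) + b * complex.Im (block p w)) ^+ 4 =
  ((a * complex.Re (block p w) + b * complex.Im (block p w)) ^+ 2) ^+ 2 by rewrite -exprM.
have c20 : 0 <= c2 * nsq (block p w) by apply: mulr_ge0; apply: addr_ge0; exact: sqr_ge0.
rewrite ler_pXn2r ?nnegrE//; last exact: sqr_ge0.
rewrite /c2 /nsq; have := sqr_ge0 (a * complex.Im (block p w) - b * complex.Re (block p w)).
by move: (complex.Re _) (complex.Im _) => x y; nra.
Qed.

Hypothesis rho1 : 0 <= rho.

(** For [z = x + i y], [(a x + b y)^2] is [(c2 / 2) |z|^2] plus a real linear form in [z^2]. Summed
    over blocks, the first part concentrates around [c2 / 2], as the mean of [Q] is exactly [|S|],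
    and the second is small in mean square. *)
Lemma Ex_mdiff_var :
  Ex P (fun w => (\sum_(p < N.+1) mdiff p w ^+ 2 - c2 / 2) ^+ 2) <=
  c2 ^+ 2 / 2 * ((1 - rho ^+ 2 * (size S)%:R) ^+ 2 +
     rho ^+ 4 * (3 * same_P R S + 2 * offdiag R S)).
Proof.
pose Q w := \sum_(p < N.+1) nsq (block p w).
pose B w := \sum_(p < N.+1) block p w ^+ 2.
have VE w : \sum_(p < N.+1) mdiff p w ^+ 2 = rho ^+ 2 * (c2 / 2 * Q w +
    ((a ^+ 2 - b ^+ 2) / 2 * complex.Re (B w) + a * b * complex.Im (B w))).
  rewrite /Q /B; elim/big_rec3: _ => [|p y1 y2 y3 _ ->]; first by rewrite /= !mulr0 !addr0 mulr0.
  by rewrite cReD cImD /mdiff expr2 cReM cImM /nsq /c2; field.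
have bQ : bmeas Q by apply: bmeas_sum => p _; exact: bmeas_nsq_block.
have [bQ2 hQ2] := Ex_sqr_sum_nsq; have [bB hB] := Ex_nsq_sum_sqr.
have bQ1 : bmeas (fun w => (rho ^+ 2 * Q w - 1) ^+ 2).
  by apply: bmeasX; apply: bmeasB; [exact: bmeasZ|exact: bmeas_cst].
apply: (@le_trans _ _ (Ex P (fun w => c2 ^+ 2 / 2 * ((rho ^+ 2 * Q w - 1) ^+ 2 + rho ^+ 4 * nsq (B w))))).
  apply: le_Ex.
  - apply: bmeasX; apply: bmeasB; last exact: bmeas_cst.
    by apply: bmeas_sum => p _; apply: bmeasX; exact: bmeas_mdiff.
  - by apply: bmeasZ; apply: bmeasD => //; exact: bmeasZ.
  move=> w; rewrite VE.
  set q := rho ^+ 2 * Q w; set x := rho ^+ 2 * complex.Re (B w); set y := rho ^+ 2 * complex.Im (B w).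
  have -> : rho ^+ 2 * (c2 / 2 * Q w + ((a ^+ 2 - b ^+ 2) / 2 * complex.Re (B w) + a * b * complex.Im (B w)))
     - c2 / 2 = c2 / 2 * (q - 1) + ((a ^+ 2 - b ^+ 2) / 2 * x + a * b * y).
    by rewrite /q /x /y; field.
  have -> : rho ^+ 4 * nsq (B w) = x ^+ 2 + y ^+ 2 by rewrite /nsq /x /y; ring.
  set u := c2 / 2 * (q - 1); set v := (_ + a * b * y).
  have h1 : (u + v) ^+ 2 <= 2 * u ^+ 2 + 2 * v ^+ 2 by have := sqr_ge0 (u - v); nra.
  (* Lagrange's identity: the coefficients [(a^2 - b^2) / 2] and [a b] have squares summing to
     [(c2 / 2)^2]. *)
  have h2 : v ^+ 2 <= (c2 / 2) ^+ 2 * (x ^+ 2 + y ^+ 2).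
    have -> : (c2 / 2) ^+ 2 * (x ^+ 2 + y ^+ 2) = v ^+ 2 + ((a ^+ 2 - b ^+ 2) / 2 * y - a * b * x) ^+ 2.
      by rewrite /v /c2; field.
    by rewrite lerDl sqr_ge0.
  apply: le_trans h1 _.
  have -> : c2 ^+ 2 / 2 * ((q - 1) ^+ 2 + (x ^+ 2 + y ^+ 2)) =
    2 * u ^+ 2 + 2 * ((c2 / 2) ^+ 2 * (x ^+ 2 + y ^+ 2)) by rewrite /u; field.
  by rewrite lerD2l ler_pM2l.
rewrite ExZ; last by apply: bmeasD => //; exact: bmeasZ.
rewrite ler_wpM2l ?divr_ge0 ?sqr_ge0//.
rewrite ExD//; last exact: bmeasZ.
rewrite ExZ//.
have -> : Ex P (fun w => (rho ^+ 2 * Q w - 1) ^+ 2) =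
   rho ^+ 4 * Ex P (fun w => Q w ^+ 2) + (1 - 2 * (rho ^+ 2 * (size S)%:R)).
  rewrite (eq_Ex P (Y := fun w => rho ^+ 4 * Q w ^+ 2 + (1 - 2 * rho ^+ 2 * Q w))); last by move=> w; ring.
  have b1 : bmeas (fun w => 1 - 2 * rho ^+ 2 * Q w) by apply: bmeasB; [exact: bmeas_cst|exact: bmeasZ].
  rewrite ExD//; last exact: bmeasZ.
  rewrite ExZ// ExB; [|exact: bmeas_cst|exact: bmeasZ].
  by rewrite Ex_cst ExZ// Ex_sum_nsq mulrA.
have r4 : 0 <= rho ^+ 4 by rewrite exprn_ge0.
have h1 := ler_wpM2l r4 hQ2; have h2 := ler_wpM2l r4 hB.
have -> : (1 - rho ^+ 2 * (size S)%:R) ^+ 2 = 1 - 2 * (rho ^+ 2 * (size S)%:R) + rho ^+ 4 * (size S)%:R ^+ 2 by ring.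
move: h1 h2; rewrite !mulrDr; move: (rho ^+ 4 * _) (rho ^+ 4 * Ex P (fun w => nsq (B w))) => X1 X2.
set X3 := rho ^+ 4 * (size S)%:R ^+ 2; set X4 := rho ^+ 4 * same_P R S.
have -> : rho ^+ 4 * (2 * same_P R S) = 2 * X4 by rewrite /X4; ring.
have -> : rho ^+ 4 * (3 * same_P R S) = 3 * X4 by rewrite /X4; ring.
have -> : rho ^+ 4 * (2 * offdiag R S) = 2 * (rho ^+ 4 * offdiag R S) by ring.
by lra.
Qed.

(** The weight is a bounded function of earlier blocks, hence lies in the past of [k], so
    [us_martingale] applies to each [f n] in the block. *)
Lemma mdiff_orth (v phi : R) k : (k < N.+1)%N ->
  Ex P (fun w => mdiff k w * (sin (\sum_(j < k) mdiff j w + phi) *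
     expR (Num.min (\sum_(j < k) mdiff j w ^+ 2) (v + 1) / 2))) = 0.
Proof.
move=> kN.
have [pk|npk] := boolP (prime k); last first.
  rewrite -[RHS](Ex_cst P); apply: eq_Ex => w.
  rewrite /mdiff (_ : block k w = 0) ?mul0r//= ?mulr0 ?addr0 ?mulr0 ?mul0r//.
  rewrite /block big_seq_cond big1// => n /andP[nS /eqP nk].
  by move: npk; rewrite -nk max_pdiv_prime//; have /andP[] := S1 nS.
have cb j : (j < k)%N -> cbmeas (block j : pastT f k -> R[i]).
  move=> jk; rewrite /block.
  have -> : (fun w => \sum_(n <- S | max_pdiv n == j) f n w) =
     (fun w => \sum_(n <- S | (n \in S) && (max_pdiv n == j)) f n w).
    by apply/funext => w; rewrite big_seq_cond.
  apply: (@cbmeas_sum _ _ (pastT f k)) => n /andP[nS /eqP nj].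
  apply: (cbmeas_past uf); first exact: S0.
  move=> q pq qn; apply: leq_ltn_trans jk; rewrite -nj; apply: max_pdiv_max.
  by rewrite mem_primes pq qn S0.
have bm j : (j < k)%N -> bmeas (mdiff j : pastT f k -> R).
  by move=> jk; have [h1 h2] := cb j jk; apply: bmeasZ; apply: bmeasD; exact: bmeasZ.
pose G (w : pastT f k) : R := sin (\sum_(j < k) mdiff j w + phi) *
     expR (Num.min (\sum_(j < k) mdiff j w ^+ 2) (v + 1) / 2).
have bG : bmeas G.
  have bs : bmeas (fun w : pastT f k => \sum_(j < k) mdiff j w).
    by apply: bmeas_sum => j _; exact: bm.
  have bs2 : bmeas (fun w : pastT f k => \sum_(j < k) mdiff j w ^+ 2).
    by apply: bmeas_sum => j _; apply: bmeasX; exact: bm.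
  apply: bmeasM.
    by apply: bmeas_sin; apply: measurable_funD; [case: bs|exact: measurable_cst].
  apply: bmeas_expR.
  have -> : (fun w : pastT f k => Num.min (\sum_(j < k) mdiff j w ^+ 2) (v + 1) / 2) =
    (fun w : pastT f k => 2^-1 * Num.min (\sum_(j < k) mdiff j w ^+ 2) (v + 1)).
    by apply/funext => w; rewrite mulrC.
  by apply: bmeasZ; apply: bmeas_min => //; exact: bmeas_cst.
(* With [z = rho G (a - i b)], the real product [mdiff k w * G w] becomes the real part of
   [block k w * z w]. *)
pose z (w : pastT f k) : R[i] := (rho * a * G w +i* (- (rho * b * G w)))%C.
have cz : cbmeas z by split; [exact: bmeasZ|apply: bmeasN; exact: bmeasZ].
rewrite (eq_Ex P (Y := fun w => \sum_(n <- S | (n \in S) && (max_pdiv n == k)) complex.Re (f n w * z w))); last first.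
  move=> w; rewrite -big_seq_cond -Re_sum -mulr_suml -/(block k w) cReM /= -/(G w) /mdiff.
  by ring.
rewrite Ex_sum; last first.
  move=> n /andP[nS _]; have [] : cbmeas (fun w => f n w * (z w : R[i])) => //.
  apply: cbmeasM; first by apply: (cbmeas_us uf); exact: S0.
  by have [h1 h2] := cz; split; [exact: (bmeas_past uf h1)|exact: (bmeas_past uf h2)].
rewrite big1// => n /andP[nS /eqP nk].
apply: (us_martingale uf pk) => //; first exact: S0.
  by rewrite -nk max_pdiv_dvd.
move=> q pq qn; rewrite -nk; apply: max_pdiv_max.
by rewrite mem_primes pq qn S0.
Qed.

End moments.

(** * Energy of finite sets and pairs with equal largest prime *)

Section energy.
Context (R : realType).
Implicit Types S : seq nat.

Lemma mult_energyE (S : {fset nat}) : (mult_energy S)%:R = energy4 R S.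
Proof.
pose pr := [seq (a, b) | a <- S, b <- S].
have upr : uniq pr.
  by apply: allpairs_uniq; rewrite ?fset_uniq// => -[a b] [a' b'] _ _ /=.
pose q := [seq (x, y) | x <- pr, y <- pr].
have uq : uniq q by apply: allpairs_uniq => // -[a b] [a' b'] _ _ /=.
pose c (s : (nat * nat) * (nat * nat)) := (s.1.1 * s.1.2 == s.2.1 * s.2.2)%N.
have prE x : (x \in pr) = (x \in (S `*` S)%fset).
  rewrite in_fsetM; case: x => a b /=; apply/allpairsP/andP.
    by move=> [[a' b'] /= [h1 h2 [-> ->]]].
  by move=> [h1 h2]; exists (a, b).
have qE x : (x \in q) = (x \in ((S `*` S) `*` (S `*` S))%fset).
  rewrite in_fsetM -!prE; case: x => a b /=; apply/allpairsP/andP.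
    by move=> [[a' b'] /= [h1 h2 [-> ->]]].
  by move=> [h1 h2]; exists (a, b).
have -> : mult_energy S = size [seq s <- q | c s].
  rewrite /mult_energy; apply/perm_size/uniq_perm; rewrite ?fset_uniq ?filter_uniq//.
  by move=> s; rewrite !inE mem_filter qE /c !inE andbC.
rewrite size_filter -sum1_count natr_sum big_mkcond/= /q big_allpairs /=.
rewrite /pr big_allpairs /energy4 /sum4.
apply: eq_bigr => a _; apply: eq_bigr => b _; rewrite big_allpairs.
by apply: eq_bigr => a' _; apply: eq_bigr => b' _; rewrite /c /=; case: eqP.
Qed.

Lemma sum4_perm S S' g : perm_eq S S' -> sum4 S g = sum4 S' g :> R.
Proof.
move=> SS; rewrite /sum4 (perm_big _ SS); do 3![apply: eq_bigr => ? _; rewrite (perm_big _ SS)].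
exact: eq_bigr.
Qed.

Lemma same_P_le S N (c : R) : uniq S -> (forall n, n \in S -> (1 < n <= N)%N) ->
  (forall p, prime p -> (count (fun n => max_pdiv n == p) (iota 1 N))%:R <= c) ->
  same_P R S <= (size S)%:R * c.
Proof.
move=> uS SN hc; rewrite /same_P -sum1_size natr_sum mulr_suml big_seq [leRHS]big_seq.
apply: ler_sum => a aS; rewrite mul1r.
have pa : prime (max_pdiv a) by apply: max_pdiv_prime; have /andP[] := SN a aS.
apply: le_trans (hc _ pa); rewrite -natr_sum ler_nat.
under eq_bigr do rewrite eq_sym.
rewrite (_ : \sum_(b <- S) _ = count (fun n => max_pdiv n == max_pdiv a) S)%N; last first.
  by rewrite -sum1_count [RHS]big_mkcond; apply: eq_bigr => b _; case: eqP.
rewrite -!size_filter; apply: uniq_leq_size; first by rewrite filter_uniq.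
move=> n; rewrite !mem_filter => /andP[-> nS]; rewrite mem_iota /= add1n ltnS.
by have /andP[h ->] := SN n nS; rewrite ltnW.
Qed.

End energy.

(** * Growth of the scale [L] *)

Section asymptotics.
Context (R : realType).

Lemma near_ln_ge (M : R) : \forall N \near \oo, M <= ln (N%:R : R).
Proof.
have h := archi_boundP (expR_ge0 M).
near=> N; have NM : expR M <= N%:R.
  by apply: le_trans (ltW h) _; rewrite ler_nat; near: N; exact: nbhs_infty_ge.
by rewrite -[leLHS](expRK M) ler_ln ?posrE ?expR_gt0// (lt_le_trans (expR_gt0 M)).
Unshelve. all: by end_near.
Qed.

Definition Lscale N : R := Num.sqrt (ln N%:R * ln (ln N%:R)).

(* The last bound holds since [L <= ln N], so that [N exp(-L/3) >= N^(2/3)]. *)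
Lemma near_Lscale (K : R) : \forall N \near \oo,
  [/\ (1 < N)%N, 1 <= ln (ln (N%:R : R)), Lscale N ^+ 2 = ln N%:R * ln (ln N%:R),
      K <= Lscale N & K <= N%:R * expR (- (3^-1 * Lscale N))].
Proof.
near=> N.
have h1 : expR 1 <= ln (N%:R : R) by near: N; exact: near_ln_ge.
have h2 : `|K| + 1 + K ^+ 2 <= ln (N%:R : R) by near: N; exact: near_ln_ge.
have h3 : 2 * K <= ln (N%:R : R) by near: N; exact: near_ln_ge.
have N1 : (1 < N)%N by near: N; exact: nbhs_infty_gt.
have l0 : 0 < ln (N%:R : R) by apply: lt_le_trans h1; exact: expR_gt0.
have ll1 : 1 <= ln (ln (N%:R : R)).
  by rewrite -[leLHS](expRK 1) ler_ln ?posrE ?expR_gt0.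
have L2 : Lscale N ^+ 2 = ln N%:R * ln (ln N%:R).
  by rewrite sqr_sqrtr// mulr_ge0 ?(ltW l0)// (le_trans ler01).
have L0 : 0 <= Lscale N by exact: sqrtr_ge0.
split => //.
- apply: le_trans (ler_norm K) _; rewrite -(ler_pXn2r (n := 2)) ?nnegrE ?normr_ge0//.
  rewrite real_normK ?num_real// L2.
  have K2 : K ^+ 2 <= ln (N%:R : R) by have := normr_ge0 K; lra.
  by apply: le_trans K2 _; rewrite ler_peMr// ltW.
- have Ll : Lscale N <= ln N%:R.
    rewrite -(ler_pXn2r (n := 2)) ?nnegrE ?(ltW l0)// L2 [leRHS]expr2 ler_pM2l//.
    have lE : ln (N%:R : R) = 1 + (ln N%:R - 1) by ring.
    by rewrite {1}lE; apply: le_trans (le_ln1Dx _) _; lra.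
  have -> : (N%:R : R) = expR (ln N%:R) by rewrite lnK// posrE ltr0n ltnW.
  rewrite -expRD; apply: le_trans (expR_ge1Dx _).
  move: (Lscale N) (ln N%:R) Ll h3 l0 {L2 L0 h1 h2 ll1} => x y *.
  by lra.
Unshelve. all: by end_near.
Qed.

End asymptotics.

(** * Explicit bound for the characteristic function *)

Section characteristic_function.
Context (R : realType) (d : measure_display) (T : measurableType d).
Variables (P : probability T R) (f : nat -> T -> R[i]).
Hypothesis uf : unimodular_steinhaus P f.

Lemma norm_cosB_le (x y : R) : `|cos x - cos y| <= `|x - y|.
Proof.
wlog xy : x y / y <= x => [h|].
  by have [/h//|/ltW/h] := leP y x; rewrite distrC (distrC x).
have hc (z : R) : is_derive z 1 (@cos R) (- sin z) by exact: is_derive_cos.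
have [c _ ->] := MVT_segment (f := @cos R) (df := fun z => - sin z) xy
  (fun z _ => hc z) (continuous_subspaceT (@continuous_cos R)).
by rewrite normrM normrN ler_piMl// sin_max.
Qed.

Lemma sqr_lin_le (a b x y : R) :
  (a * x + b * y) ^+ 2 <= (a ^+ 2 + b ^+ 2) * (x ^+ 2 + y ^+ 2).
Proof. by have := sqr_ge0 (a * y - b * x); nra. Qed.

Variables (A : seq nat) (N : nat) (c : pred nat) (t : R).
Hypotheses (uA : uniq A) (AN : forall n, n \in A -> (1 <= n <= N)%N) (c1 : ~~ c 1%N)
  (A0 : (0 < size A)%N) (t0 : 0 < t) (t1 : t <= 1).
Let m : R := (size A)%:R.
Let S := [seq n <- A | c n].
(** The defects are measured in [t^2] because the martingale bound divides moments by its free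
    parameter, which is taken to be this [t]. *)
Hypotheses (hsize : (1 - t ^+ 2) * m <= (size S)%:R)
  (hsame : same_P R S <= t ^+ 2 * m ^+ 2) (hoff : offdiag R S <= t ^+ 2 * m ^+ 2).
Let rho := (Num.sqrt m)^-1.

Let m0 : 0 < m. Proof. by rewrite /m ltr0n. Qed.
Let rho0 : 0 <= rho. Proof. by rewrite /rho invr_ge0 sqrtr_ge0. Qed.
Let rho2 : rho ^+ 2 = m^-1.
Proof. by rewrite /rho exprVn sqr_sqrtr// ltW. Qed.
Let A1 n : n \in A -> (0 < n)%N. Proof. by move=> /AN/andP[]. Qed.

Let SN n : n \in S -> (1 < n <= N)%N.
Proof.
rewrite mem_filter => /andP[cn /AN/andP[n1 ->]]; rewrite andbT ltn_neqAle n1 andbT.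
by apply: contra c1 => /eqP->.
Qed.

Let uS : uniq S. Proof. by rewrite filter_uniq. Qed.

Let cbA : cbmeas (fun w => \sum_(n <- A) f n w).
Proof.
rewrite (_ : (fun w => _) = fun w => \sum_(n <- A | n \in A) f n w); last first.
  by apply/funext => w; rewrite big_seq.
by apply: cbmeas_sum => n nA; apply: (cbmeas_us uf); exact: A1.
Qed.

Let cbS (b : bool) : cbmeas (fun w => \sum_(n <- A | c n == b) f n w).
Proof.
rewrite (_ : (fun w => _) = fun w => \sum_(n <- A | (n \in A) && (c n == b)) f n w); last first.
  by apply/funext => w; rewrite big_seq_cond.
by apply: cbmeas_sum => n /andP[nA _]; apply: (cbmeas_us uf); exact: A1.
Qed.

Lemma Ex_nsq_normalized : Ex P (fun w => rho ^+ 2 * nsq (\sum_(n <- A) f n w)) = 1.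
Proof.
have [h1 h2] := cbA.
rewrite ExZ; last by apply: bmeasD; exact: bmeasX.
by rewrite (Ex_nsq_sum uf predT uA A1) count_predT rho2 mulVf// gt_eqF.
Qed.

Variables (a b phi : R).
Let c2 := a ^+ 2 + b ^+ 2.

Let c20 : 0 <= c2. Proof. by rewrite addr_ge0 ?sqr_ge0. Qed.

Let L (z : R[i]) : R := rho * (a * complex.Re z + b * complex.Im z).

Let bL Z : cbmeas Z -> bmeas (fun w : T => L (Z w)).
Proof. by move=> [h1 h2]; apply: bmeasZ; apply: bmeasD; exact: bmeasZ. Qed.

(** The normalisation is by [|A|], not [|S|]. The fourth moments and the variance are each at most
    [3 c2^2 t^2]; their sum divided by [t] gives the factor [6 c2^2]. *)
Lemma charfn_subset_bound :
  `|Ex P (fun w => cos (L (\sum_(n <- S) f n w) + phi)) - cos phi * expR (- (c2 / 2 / 2))|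
  <= expR (c2 / 2 + 1) * (2 * (c2 / 2) + 5) * (1 + 6 * c2 ^+ 2) * t.
Proof.
have v0 : 0 <= c2 / 2 by rewrite divr_ge0.
have := mcleish_bound (P := P) (n := N.+1) (phi := phi)
  (bmeas_mdiff uf SN rho a b) v0 t0 t1 (mdiff_orth uf SN rho a b (c2 / 2) phi).
rewrite (eq_Ex P (Y := fun w => cos (L (\sum_(n <- S) f n w) + phi))); last first.
  by move=> w; rewrite (sum_mdiff f SN).
move=> /le_trans; apply; rewrite -[leRHS]mulrA ler_pM2l ?mulr_gt0 ?expR_gt0//; last by have c20' := c20; lra.
have r4 : rho ^+ 4 * m ^+ 2 = 1.
  by rewrite (exprM rho 2 2) rho2 exprVn mulVf// expf_neq0// gt_eqF.
have r40 : 0 <= rho ^+ 4 by rewrite exprn_ge0.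
have hs := ler_wpM2l r40 hsame; have ho := ler_wpM2l r40 hoff.
have Et : rho ^+ 4 * (t ^+ 2 * m ^+ 2) = t ^+ 2 by rewrite mulrCA r4 mulr1.
rewrite Et in hs ho.
have q1 : \sum_(p < N.+1) Ex P (fun w => mdiff f S rho a b p w ^+ 4) <= 3 * c2 ^+ 2 * t ^+ 2.
  apply: le_trans (sum_Ex_mdiff4 uf uS SN rho a b) _.
  have -> : rho ^+ 4 * (a ^+ 2 + b ^+ 2) ^+ 2 * (2 * same_P R S + offdiag R S) =
    c2 ^+ 2 * (2 * (rho ^+ 4 * same_P R S) + rho ^+ 4 * offdiag R S) by rewrite /c2; ring.
  have -> : 3 * c2 ^+ 2 * t ^+ 2 = c2 ^+ 2 * (3 * t ^+ 2) by ring.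
  apply: ler_wpM2l; first exact: sqr_ge0.
  by lra.
have q2 : Ex P (fun w => (\sum_(p < N.+1) mdiff f S rho a b p w ^+ 2 - c2 / 2) ^+ 2) <= 3 * c2 ^+ 2 * t ^+ 2.
  apply: le_trans (Ex_mdiff_var uf uS SN a b rho0) _.
  rewrite -/c2 (_ : 3 * c2 ^+ 2 * t ^+ 2 = c2 ^+ 2 / 2 * (6 * t ^+ 2)); last by field.
  apply: ler_wpM2l; first by rewrite divr_ge0 ?sqr_ge0.
  have s1 : rho ^+ 2 * (size S)%:R <= 1.
    by rewrite rho2 mulrC ler_pdivrMr// mul1r /m ler_nat size_filter count_size.
  have s2 : 1 - t ^+ 2 <= rho ^+ 2 * (size S)%:R.
    by rewrite rho2 mulrC ler_pdivlMr.
  have -> : rho ^+ 4 * (3 * same_P R S + 2 * offdiag R S) =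
    3 * (rho ^+ 4 * same_P R S) + 2 * (rho ^+ 4 * offdiag R S) by ring.
  have t0' := t0; have t1' := t1.
  (* The quantity squared lies in [[0, t^2]] with [t <= 1], so squaring does not increase it. *)
  have : (1 - rho ^+ 2 * (size S)%:R) ^+ 2 <= t ^+ 2.
    move: s1 s2; move: (rho ^+ 2 * _) => u s1 s2.
    have t2 : t ^+ 2 <= 1 by rewrite expr_le1// ltW.
    have : (1 - u) * (1 - u) <= 1 * (1 - u) by rewrite ler_wpM2r; lra.
    by rewrite mul1r -expr2; lra.
  by lra.
rewrite (mulrDl 1 (6 * c2 ^+ 2)) mul1r lerD2l ler_pdivrMr//.
have -> : 6 * c2 ^+ 2 * t * t = 3 * c2 ^+ 2 * t ^+ 2 + 3 * c2 ^+ 2 * t ^+ 2 by ring.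
exact: lerD.
Qed.

(** Cosine is 1-Lipschitz, so elements of [A] outside [S] cost the first absolute moment of their
    linear form. Its second moment is at most [c2 t^2], whence the extra [(1 + c2) t] by
    [Ex_sqr_norm]. *)
Lemma charfn_bound :
  `|Ex P (fun w => cos (L (\sum_(n <- A) f n w) + phi)) - cos phi * expR (- (c2 / 2 / 2))|
  <= (expR (c2 / 2 + 1) * (2 * (c2 / 2) + 5) * (1 + 6 * c2 ^+ 2) + (1 + c2)) * t.
Proof.
have h := charfn_subset_bound.
have cS : cbmeas (fun w => \sum_(n <- S) f n w).
  rewrite (_ : (fun w => _) = fun w => \sum_(n <- A | c n == true) f n w)//.
  by apply/funext => w; rewrite big_filter; apply: eq_bigl => n; rewrite eqb_id.
have mc Z : cbmeas Z -> bmeas (fun w : T => cos (L (Z w) + phi)).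
  move=> /bL[hZ _]; apply: bmeas_cos; apply: measurable_funD => //; exact: measurable_cst.
have b1 := mc _ cbA; have b2 := mc _ cS; have b3 := bL (cbS false).
have -> : Ex P (fun w => cos (L (\sum_(n <- A) f n w) + phi)) - cos phi * expR (- (c2 / 2 / 2)) =
  Ex P (fun w => cos (L (\sum_(n <- A) f n w) + phi) - cos (L (\sum_(n <- S) f n w) + phi)) +
  (Ex P (fun w => cos (L (\sum_(n <- S) f n w) + phi)) - cos phi * expR (- (c2 / 2 / 2))).
  by rewrite ExB//; ring.
apply: le_trans (ler_normD _ _) _; rewrite (mulrDl (expR _ * _ * _)) [leRHS]addrC; apply: lerD => //.
apply: (@le_trans _ _ (Ex P (fun w => `|L (\sum_(n <- A | c n == false) f n w)|))).
  apply: norm_Ex_le; [exact: bmeasB|exact: bmeas_norm|move=> w].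
  apply: le_trans (norm_cosB_le _ _) _; rewrite le_eqVlt; apply/orP; left; apply/eqP; congr `|_|.
  rewrite (bigID c)/= -big_filter -/S.
  have -> : \sum_(n <- A | ~~ c n) f n w = \sum_(n <- A | c n == false) f n w.
    by apply: eq_bigl => n; rewrite eqbF_neg.
  by rewrite /L cReD cImD; ring.
apply: le_trans (Ex_sqr_norm P b3 t0) _.
rewrite (mulrDl 1 c2) mul1r lerD2l ler_pdivrMr// -mulrA -expr2.
have [h1 h2] := cbS false.
have bn : bmeas (fun w => nsq (\sum_(n <- A | c n == false) f n w)).
  by apply: bmeasD; exact: bmeasX.
apply: (@le_trans _ _ (Ex P (fun w => rho ^+ 2 * c2 * nsq (\sum_(n <- A | c n == false) f n w)))).
  apply: le_Ex; [exact: bmeasX|exact: bmeasZ|move=> w].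
  by rewrite /L exprMn -mulrA ler_wpM2l ?sqr_ge0//; exact: sqr_lin_le.
rewrite ExZ// (Ex_nsq_sum uf (fun n => c n == false) uA A1) mulrAC -mulrC ler_wpM2l//.
rewrite rho2 mulrC ler_pdivrMr//.
have E : (size S)%:R + (count (fun n => c n == false) A)%:R = m.
  rewrite -natrD /S size_filter /m -(count_predC c); congr (_ + _)%:R.
  by apply: eq_count => n; rewrite /= eqbF_neg.
by move: hsize; rewrite mulrBl mul1r -E; lra.
Qed.

End characteristic_function.

(** * The hypotheses turned into small defects *)

Section energy_asymptotics.
Context (R : realType).
Variables (A S : nat -> {fset nat}).
Hypotheses (hA : \forall N \near \oo, forall n, n \in A N -> (1 <= n <= N)%N)
  (hcard : \forall N \near \oo,
     N%:R * expR (- (3^-1 * Num.sqrt (ln N%:R * ln (ln N%:R)))) <= #|` A N|%:R :> R)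
  (hsub : \forall N \near \oo, (S N `<=` A N)%fset)
  (hsize : asymp_const (1 : R) (fun N => #|` S N|%:R) (fun N => #|` A N|%:R))
  (henergy : asymp_const (2 : R) (fun N => (mult_energy (S N))%:R)
     (fun N => #|` S N|%:R ^+ 2)).

(* The element [1] is dropped because it has no largest prime factor. *)
Definition core N n := (n \in S N) && (n != 1%N).

Lemma near_core_small (eta : R) : 0 < eta -> \forall N \near \oo,
  [/\ forall n, n \in A N -> (1 <= n <= N)%N, (0 < #|` A N|)%N,
      (1 - eta) * #|` A N|%:R <= (size [seq n <- A N | core N n])%:R :> R,
      same_P R [seq n <- A N | core N n] <= eta * #|` A N|%:R ^+ 2 &
      offdiag R [seq n <- A N | core N n] <= eta * #|` A N|%:R ^+ 2].
Proof.
move=> eta0.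
have [e1 /cvgrPdist_le e1_0 he1] := hsize; have [e2 /cvgrPdist_le e2_0 he2] := henergy.
have eta20 : 0 < eta / 2 by rewrite divr_gt0.
pose E : R := expR (6 * ln 1000).
have E0 : 0 < E by exact: expR_gt0.
have ei0 : 0 < eta^-1 by rewrite invr_gt0.
(* [K] bounds both [L] and [|A|] from below. [E = 1000^6] yields [L^(1/6) >= 1000], [30 / eta]
   yields [exp(- L / 30) <= eta], and [2 / eta] yields [eta |A| >= 2], which absorbs the dropped
   element [1] and the linear term of [offdiagE]. *)
pose K : R := E + 30 / eta + 2 / eta + 1.
have K1 : E <= K by rewrite /K; lra.
have K2 : 30 / eta <= K by rewrite /K; lra.
have K3 : 2 / eta <= K by rewrite /K; lra.
have K4 : 1 <= K by rewrite /K; lra.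
near=> N.
have AN : forall n, n \in A N -> (1 <= n <= N)%N by near: N.
have cN : N%:R * expR (- (3^-1 * Lscale R N)) <= #|` A N|%:R :> R by near: N; exact: hcard.
have SA : (S N `<=` A N)%fset by near: N.
have E1 : #|` S N|%:R = (1 + e1 N) * #|` A N|%:R :> R by near: N; exact: he1.
have E2 : (mult_energy (S N))%:R = (2 + e2 N) * #|` S N|%:R ^+ 2 :> R by near: N; exact: he2.
have n1 : `|0 - e1 N| <= eta / 2 by near: N; exact: e1_0.
have n2 : `|0 - e2 N| <= eta / 2 by near: N; exact: e2_0.
have [N1 ll1 L2 KL Km] : [/\ (1 < N)%N, 1 <= ln (ln (N%:R : R)),
    Lscale R N ^+ 2 = ln N%:R * ln (ln N%:R),
    K <= Lscale R N & K <= N%:R * expR (- (3^-1 * Lscale R N))].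
  by near: N; exact: near_Lscale.
set m : R := #|` A N|%:R in cN E1 *.
set L := Lscale R N in cN L2 KL Km.
have Kmm : K <= m by exact: le_trans cN.
have m1 : 1 <= m by exact: le_trans Kmm.
have em : 2 <= eta * m by rewrite mulrC -ler_pdivrMr// (le_trans K3).
set S1 := [seq n <- A N | core N n].
have uS1 : uniq S1 by rewrite filter_uniq ?fset_uniq.
have pS : perm_eq S1 [seq n <- S N | n != 1%N].
  apply: uniq_perm; rewrite ?filter_uniq ?fset_uniq// => n.
  rewrite !mem_filter /core; case nS: (n \in S N); rewrite ?andbF//= (fsubsetP SA) ?andbT//.
have S1A : (size S1)%:R <= m by rewrite /S1 size_filter /m ler_nat count_size.
have SmA : #|` S N|%:R <= m by rewrite /m ler_nat fsubset_leq_card.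
split => //.
- by rewrite -(ltr_nat R) (lt_le_trans ltr01).
- have : #|` S N|%:R - 1 <= (size S1)%:R :> R.
    rewrite (perm_size pS) size_filter lerBlDr natr1 ler_nat -addn1.
    rewrite -(count_predC (pred1 1%N)) count_uniq_mem ?fset_uniq// addnC leq_add2l.
    by case: (_ \in _).
  by rewrite E1; move: n1; rewrite sub0r normrN ler_norml => /andP[? ?]; nra.
- have L0 : 0 < L by apply: lt_le_trans KL; apply: lt_le_trans K4.
  have L6 : 1000 <= expR (ln L / 6).
    rewrite -[leLHS]lnK ?posrE ?ltr0n// ler_expR ler_pdivlMr// mulrC.
    by rewrite -[leLHS]expRK ler_ln ?posrE// (le_trans K1).
  have hc := count_max_pdiv_le N1 erefl ll1 L2 L0 L6.
  have SN n : n \in S1 -> (1 < n <= N)%N.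
    rewrite mem_filter => /andP[/andP[_ nn1] /AN/andP[n0 ->]].
    by rewrite andbT ltn_neqAle eq_sym nn1.
  apply: le_trans (same_P_le uS1 SN hc) _.
  rewrite expr2 [leRHS]mulrCA; apply: ler_pM => //.
  (* [11/30 = 1/3 + 1/30]: the first part is the lower bound for [|A|], the second the saving. *)
  have -> : N%:R * expR (- (11 / 30 * L)) = N%:R * expR (- (3^-1 * L)) * expR (- (L / 30)) :> R.
    by rewrite -[RHS]mulrA -expRD; congr (_ * expR _); field.
  rewrite mulrC; apply: ler_pM; rewrite ?expR_ge0 ?mulr_ge0 ?expR_ge0//.
  rewrite expRN -[leRHS]invrK lef_pV2 ?posrE ?invr_gt0 ?expR_gt0//.
  apply: le_trans (expR_ge1Dx _).
  have : 30 / eta <= L by exact: le_trans KL.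
  by move: (eta^-1) => x ?; lra.
- apply: (@le_trans _ _ (offdiag R (S N))).
    rewrite /offdiag (sum4_perm _ pS); apply: sum4_filter => *; exact: ler0n.
  (* The main term [2 |S|^2] of the energy cancels, leaving [e2 N * |S|^2 + |S|]; each summand gets
     half of [eta]. *)
  rewrite offdiagE ?fset_uniq// -mult_energyE E2.
  move: n2; rewrite sub0r normrN => n2.
  have h0 : 0 <= #|` S N|%:R :> R by [].
  move: SmA h0; move: (#|` S N|%:R : R) => s SmA h0.
  have h1 : e2 N * s ^+ 2 <= eta / 2 * m ^+ 2.
    apply: le_trans (ler_norm _) _; rewrite normrM (ger0_norm (sqr_ge0 s)).
    by apply: ler_pM; rewrite ?sqr_ge0// ler_pXn2r// nnegrE (le_trans h0).
  have h2 : s <= eta / 2 * m ^+ 2.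
    apply: le_trans SmA _; rewrite expr2 mulrA ler_peMl//; last by lra.
    by lra.
Unshelve. all: by end_near.
Qed.

End energy_asymptotics.

(** * Tail bounds *)

Section tightness.
Context (R : realType) (d : measure_display) (T : measurableType d).
Variable P : probability T R.

Lemma measurable_norm_gt (X : T -> R) (K : R) : measurable_fun [set: T] X ->
  measurable [set w | K < `|X w|].
Proof.
move=> mX.
have mN : measurable_fun [set: T] (fun w => `|X w|) by exact: measurableT_comp.
rewrite (_ : [set w | _] = [set: T] `&` (fun w => `|X w|) @^-1` `]K, +oo[).
  exact: mN.
by apply/seteqP; split => w /=; rewrite in_itv/= andbT// => -[].
Qed.

Lemma tail_le (X : T -> R) (K K' : R) : measurable_fun [set: T] X -> K <= K' ->
  Ex P \1_[set w | K' < `|X w|] <= Ex P \1_[set w | K < `|X w|].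
Proof.
move=> mX KK; apply: le_Ex; [exact/bmeas_indic/measurable_norm_gt..|move=> w].
rewrite !indicE ler_nat; case: (boolP (w \in [set w | K' < _])) => //.
by rewrite inE/= => h; rewrite mem_set//= (le_lt_trans KK).
Qed.

(** Continuity from above: the tail events decrease to the empty set. *)
Lemma tail_small (X : T -> R) (e : R) : measurable_fun [set: T] X -> 0 < e ->
  exists2 K : R, 0 < K & Ex P \1_[set w | K < `|X w|] <= e.
Proof.
move=> mX e0.
pose F n := [set w | n.+1%:R < `|X w|].
have mF n : measurable (F n) by exact: measurable_norm_gt.
have F0 : \bigcap_n F n = set0.
  apply/seteqP; split => // w /(_ (Num.bound `|X w|) I); rewrite /F /= => h.
  have := lt_trans h (archi_boundP (normr_ge0 (X w))).
  by rewrite ltr_nat ltnNge leqnSn.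
have : (P \o F) n @[n --> \oo] --> P (\bigcap_n F n).
  apply: nonincreasing_cvg_mu => //.
  - by rewrite (le_lt_trans (probability_le1 P (mF _)))// ltry.
  - by rewrite F0.
  - move=> n k nk; rewrite subsetEset => w; rewrite /F/=; apply: le_lt_trans.
    by rewrite ler_nat.
rewrite F0 measure0 => h.
move/fine_cvgP : h => [_].
have -> : fine \o (P \o F) = fun n => Ex P \1_(F n).
  by apply/funext => n /=; rewrite -Ex_indic.
move=> /cvgrPdist_le/(_ e e0) [n _ /(_ n (leqnn n))]; rewrite sub0r normrN => hn.
by exists n.+1%:R => //; exact: le_trans (ler_norm _) hn.
Qed.

Lemma tail_chebyshev (X : T -> R) (K : R) : bmeas X -> 0 < K ->
  Ex P \1_[set w | K < `|X w|] <= Ex P (fun w => X w ^+ 2) / K ^+ 2.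
Proof.
move=> bX K0; rewrite mulrC -ExZ; last exact: bmeasX.
apply: le_Ex; [by apply/bmeas_indic/measurable_norm_gt; case: bX|by apply: bmeasZ; exact: bmeasX|move=> w].
rewrite indicE; have [|_] := boolP (w \in _); last by rewrite mulr_ge0// ?invr_ge0 ?sqr_ge0.
rewrite inE/= => h; rewrite mulrC ler_pdivlMr ?exprn_gt0// mul1r -[leRHS]real_normK ?num_real//.
by rewrite ler_pXn2r ?nnegrE ?normr_ge0 ?ltW.
Qed.

End tightness.

(** The original [f] may be unbounded on the null event, so only measurability is recorded for
    it. *)
Lemma measurable_steinhaus (R : realType) (d : measure_display) (T : measurableType d)
    (P : probability T R) (f : nat -> T -> R[i]) n : steinhaus P f -> (0 < n)%N ->
  measurable_fun [set: T] (fun w => complex.Re (f n w)) /\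
  measurable_fun [set: T] (fun w => complex.Im (f n w)).
Proof.
move=> [fM fU _]; move: n; apply: complete_mult_ind.
  have E w : f 1%N w = 1 by have [] := fM w.
  by split; under eq_fun do rewrite E; exact: measurable_cst.
move=> p n pp n0 [h1 h2].
have [/measurable_fun_pairP[h3 h4] _] := fU p pp.
have E w : f (p * n)%N w = f p w * f n w.
  by have [_ h] := fM w; exact: h (prime_gt0 pp) n0.
split; under eq_fun do rewrite E ?cReM ?cImM.
  by apply: measurable_funB; exact: measurable_funM.
by apply: measurable_funD; exact: measurable_funM.
Qed.

(** * Convergence to the complex normal law *)

Section normal_limit.
Context (R : realType) (d d' : measure_display) (T : measurableType d) (T' : measurableType d').
Variables (P : probability T R) (f : nat -> T -> R[i]) (A S : nat -> {fset nat}).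
Hypothesis uf : unimodular_steinhaus P f.
Hypotheses (hA : \forall N \near \oo, forall n, n \in A N -> (1 <= n <= N)%N)
  (hcard : \forall N \near \oo,
     N%:R * expR (- (3^-1 * Num.sqrt (ln N%:R * ln (ln N%:R)))) <= #|` A N|%:R :> R)
  (hsub : \forall N \near \oo, (S N `<=` A N)%fset)
  (hsize : asymp_const (1 : R) (fun N => #|` S N|%:R) (fun N => #|` A N|%:R))
  (henergy : asymp_const (2 : R) (fun N => (mult_energy (S N))%:R)
     (fun N => #|` S N|%:R ^+ 2)).
Variables (P' : probability T' R) (Z : T' -> R[i]).
Hypothesis hZ : std_complex_normal P' Z.

Let rho N : R := (Num.sqrt #|` A N|%:R)^-1.
(** [A N] is known to consist of positive integers only for large [N]; the filter makes [W N]
    bounded and measurable for every [N]. *)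
Let W N w := \sum_(n <- A N | (0 < n)%N) f n w.
Let Xn N w := rho N * complex.Re (W N w).
Let Yn N w := rho N * complex.Im (W N w).

Let cW N : cbmeas (W N).
Proof. by apply: cbmeas_sum => n n0; exact: (cbmeas_us uf). Qed.

Let bXn N : bmeas (Xn N). Proof. by have [? ?] := cW N; exact: bmeasZ. Qed.
Let bYn N : bmeas (Yn N). Proof. by have [? ?] := cW N; exact: bmeasZ. Qed.

Let WE N w : (forall n, n \in A N -> (1 <= n <= N)%N) -> W N w = \sum_(n <- A N) f n w.
Proof.
move=> AN; rewrite /W big_seq_cond [RHS]big_seq; apply: eq_bigl => n.
by case nA : (n \in _) => //=; have /andP[] := AN n nA.
Qed.

Lemma charfn_cvg (a b phi : R) :
  Ex P (fun w => cos (a * Xn N w + b * Yn N w + phi)) @[N --> \oo] -->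
  Ex P' (fun w => cos (a * complex.Re (Z w) + b * complex.Im (Z w) + phi)).
Proof.
rewrite (std_complex_normal_cos a b phi hZ); apply/cvgrPdist_le => e e0.
set c2 := a ^+ 2 + b ^+ 2.
have c20 : 0 <= c2 by rewrite addr_ge0 ?sqr_ge0.
pose C := expR (c2 / 2 + 1) * (2 * (c2 / 2) + 5) * (1 + 6 * c2 ^+ 2) + (1 + c2).
have C0 : 0 < C.
  rewrite /C ltr_pwDr ?ltr_pwDl// mulr_ge0 ?mulr_ge0 ?expR_ge0//; first by lra.
  by rewrite addr_ge0// mulr_ge0 ?sqr_ge0.
pose t := Num.min 1 (e / C).
have t0 : 0 < t by rewrite lt_min ltr01 divr_gt0.
have t1 : t <= 1 by rewrite ge_min lexx.
near=> N.
have [AN A0 h1 h2 h3] : [/\ forall n, n \in A N -> (1 <= n <= N)%N, (0 < #|` A N|)%N,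
      (1 - t ^+ 2) * #|` A N|%:R <= (size [seq n <- A N | core S N n])%:R :> R,
      same_P R [seq n <- A N | core S N n] <= t ^+ 2 * #|` A N|%:R ^+ 2 &
      offdiag R [seq n <- A N | core S N n] <= t ^+ 2 * #|` A N|%:R ^+ 2].
  near: N; apply: near_core_small => //; exact: exprn_gt0.
have c1 : ~~ core S N 1%N by rewrite /core eqxx andbF.
have := charfn_bound uf (fset_uniq (A N)) AN c1 A0 t0 t1 h1 h2 h3 a b phi.
rewrite distrC (eq_Ex P (Y := fun w => cos (a * Xn N w + b * Yn N w + phi))); last first.
  by move=> w; rewrite /Xn /Yn (WE w AN) /rho; congr cos; ring.
move=> /le_trans; apply; rewrite -/C mulrC -ler_pdivlMr//.
by rewrite ge_min lexx orbT.
Unshelve. all: by end_near.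
Qed.

Lemma bmeas_normalized (g : R * R -> R) N : continuous g -> (exists M, forall z, `|g z| <= M) ->
  bmeas (fun w => g (Xn N w, Yn N w)).
Proof.
by move=> cg bg; apply: continuous2_bmeas => //; [case: (bXn N)|case: (bYn N)].
Qed.

Lemma normalized_sum_cvg (g : R * R -> R) : continuous g -> (exists M, forall z, `|g z| <= M) ->
  Ex P (fun w => g (Xn N w, Yn N w)) @[N --> \oo] --> Ex P' (fun w => g (reim (Z w))).
Proof.
move=> cg bg; have [X [Y [_ _ _ ZE]]] := hZ.
rewrite (eq_Ex P' (Y := fun w => g (X w, Y w))); last by move=> w; rewrite ZE.
have mX : measurable_fun [set: T'] X by exact: measurable_funP.
have mY : measurable_fun [set: T'] Y by exact: measurable_funP.
apply: (@portmanteau R d d' T T' P P' Xn Yn X Y) => //.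
- by move=> n; case: (bXn n).
- by move=> n; case: (bYn n).
- move=> a b phi.
  have E : Ex P' (fun w => cos (a * complex.Re (Z w) + b * complex.Im (Z w) + phi)) =
           Ex P' (fun w => cos (a * X w + b * Y w + phi)) by apply: eq_Ex => w; rewrite ZE.
  by rewrite -E; exact: charfn_cvg.
move=> e e0.
have [K1 K10 h1] := tail_small P' mX e0; have [K2 K20 h2] := tail_small P' mY e0.
(* Large enough for the tails of both limit variables, and with [K >= 1] and [K >= 1 / e], so that
   Chebyshev's [1 / K^2] is at most [e]. *)
pose K := K1 + K2 + 1 + e^-1.
have ei : 0 < e^-1 by rewrite invr_gt0.
have K0 : 0 < K by rewrite /K; lra.
exists K => //; split; last first.
  split; first by apply: le_trans h1; apply: tail_le => //; rewrite /K; lra.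
  by apply: le_trans h2; apply: tail_le => //; rewrite /K; lra.
have eK : 1 / K ^+ 2 <= e.
  rewrite ler_pdivrMr ?exprn_gt0// mulrC -ler_pdivrMr// mul1r.
  have : 1 <= K by rewrite /K; lra.
  have : e^-1 <= K by rewrite /K; lra.
  move: (e^-1) ei => x *; apply: (@le_trans _ _ K) => //.
  by rewrite expr2 ler_peMr// ltW.
near=> N.
have [AN A0] : (forall n, n \in A N -> (1 <= n <= N)%N) /\ (0 < #|` A N|)%N.
  near: N; have := near_core_small hA hcard hsub hsize henergy ltr01.
  by apply: filterS => N [].
have [n1 n2] := cW N.
have bn : bmeas (fun w => rho N ^+ 2 * nsq (W N w)).
  by apply: bmeasZ; apply: bmeasD; exact: bmeasX.
have nE : Ex P (fun w => rho N ^+ 2 * nsq (W N w)) = 1.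
  rewrite -[RHS](Ex_nsq_normalized uf (fset_uniq (A N)) AN A0).
  by apply: eq_Ex => w; rewrite WE.
split; (apply: le_trans (tail_chebyshev P _ K0) _ => //);
  apply: le_trans eK; rewrite ler_pM2r ?invr_gt0 ?exprn_gt0// -nE;
  apply: le_Ex => // [|w]; try exact: bmeasX;
  rewrite /Xn /Yn exprMn ler_wpM2l ?sqr_ge0//.
  by rewrite lerDl sqr_ge0.
by rewrite lerDr sqr_ge0.
Unshelve. all: by end_near.
Qed.

End normal_limit.
Lemma measurable_steinhaus_sum (R : realType) (d : measure_display) (T : measurableType d)
    (P : probability T R) (f : nat -> T -> R[i]) (s : seq nat) : steinhaus P f ->
  (forall n, n \in s -> (0 < n)%N) ->
  measurable_fun [set: T] (fun w => complex.Re (\sum_(n <- s) f n w)) /\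
  measurable_fun [set: T] (fun w => complex.Im (\sum_(n <- s) f n w)).
Proof.
move=> hf; elim: s => [_|n s IH s0].
  by split; under eq_fun do rewrite big_nil; exact: measurable_cst.
have [h1 h2] := measurable_steinhaus hf (s0 n (mem_head _ _)).
have [h3 h4] := IH (fun k ks => s0 k (@mem_behead _ (n :: s) k ks)).
by split; under eq_fun do rewrite big_cons ?cReD ?cImD; exact: measurable_funD.
Qed.

Theorem theorem1p1 (R : realType)
    (d : measure_display) (T : measurableType d) (P : probability T R)
    (f : nat -> T -> R[i]) (hf : steinhaus P f)
    (A : nat -> {fset nat})
    (hA : \forall N \near \oo, forall n, n \in A N -> (1 <= n <= N)%N)
    (hcard : \forall N \near \oo,
       N%:R * expR (- (3^-1 * Num.sqrt (ln N%:R * ln (ln N%:R))))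
         <= #|` A N|%:R :> R)
    (hS : exists S : nat -> {fset nat},
       [/\ \forall N \near \oo, (S N `<=` A N)%fset,
           asymp_const (1 : R) (fun N => #|` S N|%:R) (fun N => #|` A N|%:R) &
           asymp_const (2 : R) (fun N => (mult_energy (S N))%:R)
                               (fun N => #|` S N|%:R ^+ 2)])
    (d' : measure_display) (T' : measurableType d') (P' : probability T' R)
    (Z : T' -> R[i]) (hZ : std_complex_normal P' Z) :
  cvg_in_distribution P
    (fun N w => ((Num.sqrt #|` A N|%:R)^-1)%:C%C * \sum_(n <- A N) f n w)
    P' Z.
Proof.
move=> g cg bg; have [S [hsub hsize henergy]] := hS.
have uf := modif_unimodular hf.
have bZ : bmeas (fun w => g (reim (Z w))).
  have [X [Y [_ _ _ ZE]]] := hZ.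
  rewrite (_ : (fun w => _) = fun w => g (X w, Y w)); last by apply/funext => w; rewrite ZE.
  by apply: continuous2_bmeas => //; exact: measurable_funP.
rewrite (expectationE P' bZ).
have h := normalized_sum_cvg uf hA hcard hsub hsize henergy hZ cg bg.
(* The real-valued expectation for the modified function. It suffices that the original expectation
   equals it for large [N], since a limit ignores finitely many terms. *)
pose u N := Ex P (fun w => g ((Num.sqrt #|` A N|%:R)^-1 *
    complex.Re (\sum_(n <- A N | (0 < n)%N) modif f n w),
  (Num.sqrt #|` A N|%:R)^-1 * complex.Im (\sum_(n <- A N | (0 < n)%N) modif f n w))).
suff H : \forall N \near \oo, ('E_P[fun w => g (reim (((Num.sqrt #|` A N|%:R)^-1)%:C%C *
    \sum_(n <- A N) f n w)%R)] = (u N)%:E)%E.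
  apply/fine_cvgP; split; first by apply: filterS H => N ->.
  apply: cvg_trans h; apply: near_eq_cvg.
  by apply: filterS H => N /= ->.
near=> N.
have AN : forall n, n \in A N -> (1 <= n <= N)%N by near: N.
have A1 n : n \in A N -> (0 < n)%N by move=> /AN/andP[].
have bf : bmeas (fun w => g (reim (((Num.sqrt #|` A N|%:R)^-1)%:C%C * \sum_(n <- A N) f n w))).
  have m : measurable_fun [set: T] (fun w => complex.Re (\sum_(n <- A N) f n w)) /\
           measurable_fun [set: T] (fun w => complex.Im (\sum_(n <- A N) f n w)).
    exact: (measurable_steinhaus_sum hf).
  apply: continuous2_bmeas => //; under eq_fun do rewrite ?cReM ?cImM/= mul0r ?subr0 ?addr0.
    by apply: measurable_funM; [exact: measurable_cst|exact: m.1].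
  by apply: measurable_funM; [exact: measurable_cst|exact: m.2].
(* The two integrands are bounded and coincide on [good], hence have the same expectation. *)
rewrite (expectationE P bf); congr EFin; apply: (Ex_eq_mod_good hf) => //.
  exact: (bmeas_normalized A uf).
move=> w gw; congr g; rewrite /reim cReM cImM /= !mul0r subr0 addr0.
have -> : \sum_(n <- A N | (0 < n)%N) modif f n w = \sum_(n <- A N) f n w.
  rewrite big_seq_cond [RHS]big_seq; apply: eq_big => [n|n _].
    by case nA : (n \in _) => //=; rewrite A1.
  exact: modifE.
by [].
Unshelve. all: by end_near.
Qed.
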